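(* For $i=1,2$ let $K_i$ be a function field of one variable over a finite field $\mathbb{F}_i$ with $q_i=p_i^{r_i}$ elements ($p_i$ prime), and define $$G_2^{FF}(n)=\sum_{\substack{A_1,A_2\\ NA_1+NA_2=n}}\Lambda_{K_1}(A_1)\Lambda_{K_2}(A_2)\ (n\in\mathbb{N}),\qquad \Phi_2^{FF}(s)=\sum_{n=1}^{\infty}\frac{G_2^{FF}(n)}{n^s}\ (\Re s>2).$$ If $p_1=p_2$, then $\Phi_2^{FF}(s)$ can be continued meromorphically to the whole complex plane $\mathbb{C}$.
   Context: For an effective divisor $A_i$ of $K_i$, $NA_i=q_i^{\deg A_i}$; the sum defining $G_2^{FF}(n)$ runs over pairs of effective divisors $A_1$ of $K_1$ and $A_2$ of $K_2$. The von Mangoldt function is $\Lambda_{K_i}(A_i)=\log(NP_i)$ if $A_i=hP_i$ for some prime (place) $P_i$ of $K_i$ and some $h\in\mathbb{N}$, and $\Lambda_{K_i}(A_i)=0$ otherwise. The Dirichlet series $\Phi_2^{FF}(s)$ converges absolutely for $\Re s>2$. *)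

(* Defs.v *)
From HB Require Import structures.
From mathcomp Require Import all_boot all_order all_algebra.
From mathcomp Require Import finmap multiset complex.
From mathcomp Require Import all_classical all_reals all_analysis.
Set Implicit Arguments.
Unset Strict Implicit.
Unset Printing Implicit Defensive.
Import Order.TTheory GRing.Theory Num.Theory numFieldNormedType.Exports.
Local Open Scope classical_set_scope.
Local Open Scope ring_scope.

(* [z] lies in the subfield F(x) of K. *)
Definition in_ratfun (F K : fieldType) (iota : {rmorphism F -> K}) (x z : K) :=
  exists p q : {poly F},
    (map_poly iota q).[x] != 0 /\
    z = (map_poly iota p).[x] / (map_poly iota q).[x].

(* K/F is a function field of one variable: K is a finite extension of F(x)
   for some x transcendental over F.  As usual for this definition, F is not
   required to be algebraically closed in K. *)
Definition function_field (F K : fieldType) (iota : {rmorphism F -> K}) :=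
  exists x : K, ~ algebraicOver iota x /\
    exists e : seq K, forall y : K, exists c : 'I_(size e) -> K,
      (forall i, in_ratfun iota x (c i)) /\ y = \sum_i c i * e`_i.

(* A place of K/F is given by its normalized discrete valuation [ord], that is,
   by a discrete valuation ring of K containing F and with fraction field K.
   [ord] is meaningful on nonzero elements only; the value [ord 0 = 0] replaces
   +oo, and is fixed so that equal places are equal as functions. *)
Record place (F K : fieldType) (iota : {rmorphism F -> K}) := Place {
  ord :> K -> int;
  _ : ord 0 = 0;
  _ : forall x y, x != 0 -> y != 0 -> ord (x * y) = ord x + ord y;
  _ : forall x y, x != 0 -> y != 0 -> x + y != 0 ->
        Num.min (ord x) (ord y) <= ord (x + y);
  _ : exists2 x, x != 0 & ord x = 1;
  _ : forall a, ord (iota a) = 0 }.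

HB.instance Definition _ (F K : fieldType) (iota : {rmorphism F -> K}) :=
  gen_eqMixin (place iota).
HB.instance Definition _ (F K : fieldType) (iota : {rmorphism F -> K}) :=
  gen_choiceMixin (place iota).

(* valuation ring of P (the convention [ord 0 = 0] puts 0 in it) *)
Definition place_ring (F K : fieldType) (iota : {rmorphism F -> K})
  (P : place iota) : set K := [set x | 0 <= P x].

Definition place_ideal (F K : fieldType) (iota : {rmorphism F -> K})
  (P : place iota) : set K := [set x | x = 0 \/ 0 < P x].

(* The classes of the [b i] form an F-basis of the residue field of P. *)
Definition residue_basis (F K : fieldType) (iota : {rmorphism F -> K})
    (P : place iota) (d : nat) (b : 'I_d -> K) :=
  (forall i, place_ring P (b i)) /\
  forall x, place_ring P x ->
    exists! c : 'rV[F]_d, place_ideal P (x - \sum_i iota (c 0 i) * b i).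

(* deg P, the dimension over F of the residue field; it is finite when K/F is a
   function field. *)
Definition place_deg (F K : fieldType) (iota : {rmorphism F -> K})
    (P : place iota) : nat :=
  xget 0%N [set d | exists b : 'I_d -> K, residue_basis P b].

(* Effective divisors, written additively, are finite multisets of places; the
   divisor hP is [msetn h P]. *)
Definition effdiv (F K : fieldType) (iota : {rmorphism F -> K}) : choiceType :=
  {mset (place iota)}%mset.

Definition effdiv_deg (F K : fieldType) (iota : {rmorphism F -> K})
    (A : effdiv iota) : nat :=
  (\sum_(P <- finsupp A) A P * place_deg P)%N.

Definition effdiv_norm (F : finFieldType) (K : fieldType)
    (iota : {rmorphism F -> K}) (A : effdiv iota) : nat :=
  (#|F| ^ effdiv_deg A)%N.

(* For A = hP with h > 0, both h and P are determined by A. *)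
Definition von_mangoldt (R : realType) (F : finFieldType) (K : fieldType)
    (iota : {rmorphism F -> K}) (A : effdiv iota) : R :=
  xget 0 [set y | exists (P : place iota) (h : nat),
    [/\ (0 < h)%N, A = msetn h P
      & y = ln (effdiv_norm (msetn 1 P))%:R]].

(* The index set is finite when K1/F1 and K2/F2 are function fields. *)
Definition G2FF (R : realType) (F1 F2 : finFieldType) (K1 K2 : fieldType)
    (iota1 : {rmorphism F1 -> K1}) (iota2 : {rmorphism F2 -> K2}) (n : nat) : R :=
  \sum_(A \in [set A : effdiv iota1 * effdiv iota2 |
                 (effdiv_norm A.1 + effdiv_norm A.2)%N = n])
     von_mangoldt R A.1 * von_mangoldt R A.2.

Definition cexp (R : realType) (z : R[i]) : R[i] :=
  ((expR (complex.Re z) * cos (complex.Im z))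
     +i* (expR (complex.Re z) * sin (complex.Im z)))%C.

(* n ^ s for a positive integer n *)
Definition natcpow (R : realType) (n : nat) (s : R[i]) : R[i] :=
  cexp (s * (ln n%:R)%:C%C).

(* N |-> \sum_(n = 1)^N G2FF n / n ^ s *)
Definition Phi2FF_partial (R : realType) (F1 F2 : finFieldType)
    (K1 K2 : fieldType) (iota1 : {rmorphism F1 -> K1})
    (iota2 : {rmorphism F2 -> K2}) (s : R[i]) (N : nat) : R[i]^o :=
  \sum_(1 <= n < N.+1) (G2FF R iota1 iota2 n)%:C%C / natcpow n s.

Definition holomorphic_at (R : realType) (f : R[i]^o -> R[i]^o) (a : R[i]^o) :=
  \forall z \near a, derivable f z 1.

(* Meromorphic on the whole plane; the value of f at a pole is irrelevant. *)
Definition meromorphic (R : realType) (f : R[i]^o -> R[i]^o) :=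
  forall a : R[i]^o, exists (k : nat) (g : R[i]^o -> R[i]^o),
    holomorphic_at g a /\ \forall z \near a^', f z = g z / (z - a) ^+ k.

(* Main.v *)
Require Import Defs.
From mathcomp Require Import all_boot all_order all_algebra finmap multiset complex.
From mathcomp Require Import all_classical all_reals all_analysis.
From mathcomp Require Import zify ring lra.
Set Implicit Arguments.
Unset Strict Implicit.
Unset Printing Implicit Defensive.
Import Order.TTheory GRing.Theory Num.Theory numFieldNormedType.Exports.
Local Open Scope classical_set_scope.
Local Open Scope ring_scope.

(** Riemann's theorem gives a linear recurrence for the numbers of effective divisors of degree n:
    if D0 has degree d, count the pairs (A, E) of effective divisors with A of degree n + d, E of
    degree n and A ~ E + D0 in two ways.  Comparing with the sum of von Mangoldt weights over the
    divisors hP of degree k, this sum is an exponential sum n_1 b_1^k + ... + n_r b_r^k, and its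
    trivial size O(k q^k) forces |b_i| <= q.  Hence Phi is a finite combination of double series
    with general term b^i g^j (q1^i + q2^j)^(-s).  As p1 = p2, Q := q1^r2 = q2^r1, and the shift
    (i, j) -> (i + r2, j + r1) multiplies the general term by w = b^r2 g^r1 Q^(-s); therefore 1 - w
    times the double series is a finite combination of single series in g^j (c + q2^j)^(-s).  For
    large j the binomial expansion and summation over j turn such a series into
    sum_m binom(-s, m) c^m y_m^B / (1 - y_m) with y_m = g q2^(-m-s), which is meromorphic. *)

(** * Growth of function fields *)

Lemma bernoulli_expn (u l : nat) : (u ^ l.+1 + l.+1 * u ^ l <= u.+1 ^ l.+1)%N.
Proof.
elim: l => [|l IH]; first by rewrite !expn1 expn0; lia.
rewrite (expnS u.+1) (expnS u l.+1).
have : (u.+1 * (u ^ l.+1 + l.+1 * u ^ l) <= u.+1 * u.+1 ^ l.+1)%N by rewrite leq_mul2l IH orbT.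
have := expnS u l; nia.
Qed.

Lemma geometric_rate_le (t u A : nat) : (0 < u)%N ->
  (forall l, t ^ l <= A * u ^ l)%N -> (t <= u)%N.
Proof.
move=> u0 H; rewrite leqNgt; apply/negP => ut.
have h := H (A * u).+1.
have h1 : (u.+1 ^ (A * u).+1 <= t ^ (A * u).+1)%N by rewrite leq_exp2r.
have := bernoulli_expn u (A * u); rewrite (expnS u).
have : (0 < u ^ (A * u))%N by rewrite expn_gt0 u0.
move: h; rewrite (expnS u).
set w := (u ^ (A * u))%N; set z := (u.+1 ^ _)%N in h1 *; set t' := (t ^ _)%N in h1 *.
move=> h w0 h2.
have : (u * w + (A * u).+1 * w <= A * (u * w))%N by lia.
nia.
Qed.

Section Growth.
Variables (F : finFieldType) (K : fieldType) (iota : {rmorphism F -> K}).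

Section Lattice.
Variables (x : K) (n : nat) (e : 'I_n -> K).

Let ev (p : {poly F}) : K := (map_poly iota p).[x].

Let evM p r : ev (p * r) = ev p * ev r.
Proof. by rewrite /ev rmorphM hornerM. Qed.

Let ev_sum (I : finType) (p : I -> {poly F}) : ev (\sum_i p i) = \sum_i ev (p i).
Proof. by rewrite /ev rmorph_sum horner_sum. Qed.

Let ev_prod (I : finType) (P : pred I) (p : I -> {poly F}) :
  ev (\prod_(i | P i) p i) = \prod_(i | P i) ev (p i).
Proof. by rewrite /ev rmorph_prod horner_prod. Qed.

Let inM (m : nat) (g : {poly F}) (z : K) := exists p : 'I_n -> {poly F},
  (forall i, size (p i) <= m)%N /\ z * ev g = \sum_i ev (p i) * e i.

Let inM_le m m' g z : (m <= m')%N -> inM m g z -> inM m' g z.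
Proof.
by move=> mm [p [sp zp]]; exists p; split=> // i; apply: leq_trans mm.
Qed.

Let inM_mul m (g h : {poly F}) z : inM m g z -> inM (m + size h) (g * h) z.
Proof.
move=> [p [sp zp]]; exists (fun i => p i * h); split=> [i|].
  apply: leq_trans (size_polyMleq _ _) _.
  by rewrite (leq_trans (leq_pred _)) // leq_add2r.
rewrite evM mulrA zp mulr_suml; apply: eq_bigr => i _.
by rewrite evM mulrAC.
Qed.

Let inM_add m g z z' : inM m g z -> inM m g z' -> inM m g (z + z').
Proof.
move=> [p [sp zp]] [p' [sp' zp']]; exists (fun i => p i + p' i); split=> [i|].
  by rewrite (leq_trans (size_polyD _ _)) // geq_max sp sp'.
rewrite mulrDl zp zp' -big_split /=; apply: eq_bigr => i _.
by rewrite -mulrDl /ev rmorphD hornerD.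
Qed.

Hypothesis gen : forall y : K, exists c : 'I_n -> K,
  (forall i, in_ratfun iota x (c i)) /\ y = \sum_i c i * e i.

Let inM_ex z : exists m g, ev g != 0 /\ inM m g z.
Proof.
have [c [cr ->]] := gen z.
have /choice [pq pqP] : forall i, exists pq : {poly F} * {poly F},
    ev pq.2 != 0 /\ c i = ev pq.1 / ev pq.2.
  by move=> i; have [p [q pqi]] := cr i; exists (p, q).
pose g := \prod_i (pq i).2.
pose p i := (pq i).1 * \prod_(j | j != i) (pq j).2.
exists (\max_i size (p i))%N, g; split.
  by rewrite ev_prod; apply/prodf_neq0 => i _; have [] := pqP i.
exists p; split=> [i|]; first exact: (leq_bigmax i).
rewrite mulr_suml; apply: eq_bigr => i _.
have [q0 ->] := pqP i.
rewrite /p evM ev_prod /g ev_prod (bigD1 i) //=.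
by field.
Qed.

Let inM_common (I : finType) (z : I -> K) :
  exists m g, ev g != 0 /\ forall i, inM m g (z i).
Proof.
have /choice [mg mgP] : forall i, exists mg : nat * {poly F},
    ev mg.2 != 0 /\ inM mg.1 mg.2 (z i).
  by move=> i; have [m [g mgi]] := inM_ex (z i); exists (m, g).
pose h i := \prod_(j | j != i) (mg j).2.
exists (\max_i ((mg i).1 + size (h i)))%N, (\prod_i (mg i).2); split.
  by rewrite ev_prod; apply/prodf_neq0 => i _; have [] := mgP i.
move=> i; apply: inM_le (_ : (mg i).1 + size (h i) <= _)%N _.
  exact: (leq_bigmax (F := fun i => (mg i).1 + size (h i))%N i).
by rewrite (bigD1 i) //=; apply: inM_mul; have [] := mgP i.
Qed.

(* Multiplication by [y] raises the degree of the coordinates with respect to [e] by at most a constant,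
   so that the combinations lie in a set of at most [q ^ (n * (m + l * c))] elements. *)
Lemma combinations_growth (y : K) : exists C, forall (T : finType) (s : T -> K),
  (forall l, injective (fun a : {ffun 'I_l -> T} => \sum_(j < l) s (a j) * y ^+ j)) ->
  (#|T| <= #|F| ^ C)%N.
Proof.
have [mY [gY [gY0 yP]]] := inM_common (fun i => y * e i).
pose c := (mY + size gY)%N.
have inM_y m (g : {poly F}) z : inM m g z -> inM (m + c) (g * gY) (y * z).
  move=> [p [sp zp]].
  have /choice [P PP] : forall i, exists p : 'I_n -> {poly F},
      (forall k, size (p k) <= mY)%N /\ y * e i * ev gY = \sum_k ev (p k) * e k by [].
  exists (fun k => \sum_i p i * P i k); split=> [k|].
    apply: (leq_trans (size_sum _ _ _)); apply/bigmax_leqP => i _.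
    apply: leq_trans (size_polyMleq _ _) _.
    rewrite (leq_trans (leq_pred _)) // leq_add //.
    by apply: leq_trans (leq_addr _ _); have [] := PP i.
  rewrite evM -mulrA [z * _]mulrA zp mulr_suml mulr_sumr.
  under eq_bigr => i _.
    have -> : y * (ev (p i) * e i * ev gY) = ev (p i) * (y * e i * ev gY) by ring.
    have [_ ->] := PP i; rewrite mulr_sumr.
    over.
  rewrite exchange_big /=; apply: eq_bigr => k _.
  by rewrite ev_sum mulr_suml; apply: eq_bigr => i _; rewrite evM mulrA.
exists (n * c)%N => T s inj.
have [m0 [g0 [g00 sP]]] := inM_common s.
have inM_s a l : inM (m0 + l * c) (g0 * gY ^+ l) (s a).
  elim: l => [|l IH]; first by rewrite mul0n addn0 expr0 mulr1.
  rewrite mulSnr addnA exprSr mulrA.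
  by apply: inM_le (inM_mul gY IH); rewrite leq_add2l leq_addl.
have inM_comb l (a : 'I_l -> T) :
    inM (m0 + l * c) (g0 * gY ^+ l) (\sum_(j < l) s (a j) * y ^+ j).
  elim: l a => [|l IH] a.
    rewrite big_ord0; exists (fun=> 0); split=> [i|]; first by rewrite size_poly0.
    by rewrite mul0r big1 // => i _; rewrite /ev rmorph0 horner0 mul0r.
  rewrite big_ord_recl expr0 mulr1; apply: inM_add; first exact: inM_s.
  have -> : \sum_(i < l) s (a (lift ord0 i)) * y ^+ lift ord0 i =
            y * \sum_(i < l) s (a (lift ord0 i)) * y ^+ i.
    by rewrite mulr_sumr; apply: eq_bigr => i _; rewrite exprS; ring.
  rewrite mulSnr addnA exprSr mulrA.
  exact/inM_y/(IH (fun i => a (lift ord0 i))).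
have q0 : (0 < #|F|)%N by apply/card_gt0P; exists 0.
apply: (@geometric_rate_le _ _ (#|F| ^ (n * m0))); first by rewrite expn_gt0 q0.
move=> l; rewrite -expnM -expnD -mulnA -mulnDr [(c * l)%N]mulnC.
set m := (m0 + l * c)%N.
have /choice [M MP] : forall a : {ffun 'I_l -> T}, exists M : 'M[F]_(n, m),
    (\sum_(j < l) s (a j) * y ^+ j) * ev (g0 * gY ^+ l) =
    \sum_i ev (rVpoly (row i M)) * e i.
  move=> a; have [p [sp ->]] := inM_comb l a.
  exists (\matrix_(i < n, j < m) (p i)`_j); apply: eq_bigr => i _; congr (ev _ * _).
  have -> : row i (\matrix_(i < n, j < m) (p i)`_j) = poly_rV (p i) :> 'rV_m by apply/matrixP=> k j; rewrite !mxE.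
  by rewrite poly_rV_K.
have : injective M.
  move=> a b Mab; apply: (inj l).
  have /mulIf : ev (g0 * gY ^+ l) != 0.
    rewrite evM mulf_neq0 // /ev rmorphXn horner_exp expf_neq0 //.
  by apply; rewrite !MP Mab.
by move/leq_card; rewrite card_ffun card_ord card_mx.
Qed.

End Lattice.

Lemma function_field_growth : function_field iota -> forall y : K,
  exists C, forall (T : finType) (s : T -> K),
  (forall l, injective (fun a : {ffun 'I_l -> T} => \sum_(j < l) s (a j) * y ^+ j)) ->
  (#|T| <= #|F| ^ C)%N.
Proof. by move=> [x [_ [e eP]]] y; apply: (@combinations_growth x _ _ eP). Qed.

End Growth.

Section Quotients.
Variables (F : finFieldType) (K : fieldType) (iota : {rmorphism F -> K}).
Implicit Types (V W U : set K).

Definition subring_set (R : set K) :=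
  [/\ R 1, forall x y, R x -> R y -> R (x - y) & forall x y, R x -> R y -> R (x * y)].

Definition subspace_set V :=
  [/\ V 0, forall x y, V x -> V y -> V (x - y) & forall a x, V x -> V (iota a * x)].

Definition incongruent (T : Type) V W (s : T -> K) :=
  (forall t, V (s t)) /\ forall t u, W (s t - s u) -> t = u.

Lemma combinations_inj (R : set K) (y : K) (T : finType) (s : T -> K) :
  subring_set R -> R y -> y != 0 ->
  incongruent R [set x | exists2 w, R w & x = y * w] s ->
  forall l, injective (fun a : {ffun 'I_l -> T} => \sum_(j < l) s (a j) * y ^+ j).
Proof.
move=> [R1 RB RM] Ry y0 [Rs sinj].
have R0 : R 0 by rewrite -(subrr 1); apply: RB.
have RN x : R x -> R (- x) by move=> Rx; rewrite -sub0r; apply: RB.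
have RD x z : R x -> R z -> R (x + z) by move=> Rx Rz; rewrite -[z]opprK; apply/RB/RN.
have RX j : R (y ^+ j) by elim: j => [|j IH]; rewrite ?expr0 ?exprS //; apply: RM.
have Rcomb l (a : 'I_l -> T) : R (\sum_(j < l) s (a j) * y ^+ j).
  by elim/big_ind: _ => // j _; apply: RM.
have shift l (a : 'I_l.+1 -> T) : \sum_(j < l.+1) s (a j) * y ^+ j =
    s (a ord0) + y * \sum_(j < l) s (a (lift ord0 j)) * y ^+ j.
  rewrite big_ord_recl expr0 mulr1 mulr_sumr; congr (_ + _).
  by apply: eq_bigr => i _; rewrite exprS mulrCA.
have inj l : forall a b : 'I_l -> T,
    \sum_(j < l) s (a j) * y ^+ j = \sum_(j < l) s (b j) * y ^+ j -> a =1 b.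
  elim: l => [|l IH] a b; first by move=> _ [].
  rewrite !shift => ab.
  have ab0 : a ord0 = b ord0.
    apply: sinj; exists (\sum_(j < l) s (b (lift ord0 j)) * y ^+ j -
                         \sum_(j < l) s (a (lift ord0 j)) * y ^+ j).
      exact: RB.
    by apply/eqP; rewrite mulrBr subr_eq addrAC [_ + s _]addrC -ab addrK.
  move: ab; rewrite ab0 => /addrI /(mulfI y0) /IH ab i.
  by case: (unliftP ord0 i) => [j ->|->].
by move=> l a b /= /inj ab; apply/ffunP.
Qed.

Definition qdim V W d := exists b : 'I_d -> K, (forall i, V (b i)) /\
  forall x, V x -> exists! c : 'rV[F]_d, W (x - \sum_i iota (c 0 i) * b i).

Lemma subspace_add V x y : subspace_set V -> V x -> V y -> V (x + y).
Proof.
by case=> V0 VB _ Vx Vy; rewrite -[y]opprK -[- y]sub0r; apply/VB/VB.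
Qed.

Lemma subspace_comb V (I : finType) (c : I -> F) (b : I -> K) : subspace_set V ->
  (forall i, V (b i)) -> V (\sum_i iota (c i) * b i).
Proof.
move=> sV Vb; elim/big_ind: _ => [|x y|i _]; first by case: sV.
  exact: subspace_add.
by case: sV => _ _; apply.
Qed.

Let q0 : (1 < #|F|)%N.
Proof. exact: card_finNzRing_gt1. Qed.

Lemma qdim_family V W d : subspace_set V -> subspace_set W -> qdim V W d ->
  exists (s : 'rV[F]_d -> K) (r : K -> 'rV[F]_d),
    incongruent V W s /\ forall x, V x -> W (x - s (r x)).
Proof.
move=> sV sW [b [Vb bP]]; exists (fun c => \sum_i iota (c 0 i) * b i).
have /choice [r rP] : forall x, exists c : 'rV[F]_d, V x -> W (x - \sum_i iota (c 0 i) * b i).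
  move=> x; have [/bP [c [Wc _]]|nV] := pselect (V x); first by exists c.
  by exists 0.
exists r; split=> [|x]; last exact: rP.
have Vc (c : 'rV[F]_d) : V (\sum_i iota (c 0 i) * b i) by apply: subspace_comb.
split=> // t u Wtu; have [c [_ cP]] := bP _ (Vc t).
rewrite -(cP u Wtu) -(cP t) // subrr; by case: sW.
Qed.

Lemma incongruent_card_le V W d (T : finType) (s : T -> K) :
  subspace_set V -> subspace_set W -> qdim V W d -> incongruent V W s -> (#|T| <= #|F| ^ d)%N.
Proof.
move=> sV sW dV [Vs sinj]; have [b [r [_ rP]]] := qdim_family sV sW dV.
have : injective (r \o s).
  move=> t u /= rtu; apply: sinj.
  have -> : s t - s u = s t - b (r (s t)) - (s u - b (r (s u))) by rewrite rtu; ring.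
  by case: sW => _ WB _; apply: WB; apply: rP.
by move/leq_card; rewrite card_mx mul1n.
Qed.

Lemma qdim_exists V W N : subspace_set V -> subspace_set W ->
  (forall (T : finType) (s : T -> K), incongruent V W s -> (#|T| <= N)%N) ->
  exists d, qdim V W d.
Proof.
move=> sV sW bnd.
pose P d := `[<exists b : 'I_d -> K, (forall i, V (b i)) /\
  forall c : 'rV[F]_d, W (\sum_i iota (c 0 i) * b i) -> c = 0>].
have P0 : P 0%N by apply/asboolP; exists (fun=> 0); split=> [[]|c _] //; apply: thinmx0.
have Pmax d : P d -> (d <= N)%N.
  move/asboolP => [b [Vb bP]]; apply: leq_trans (ltnW (ltn_expl d q0)) _.
  have := bnd 'rV[F]_d (fun c => \sum_i iota (c 0 i) * b i).
  rewrite card_mx mul1n; apply; split=> [c|t u]; first exact: subspace_comb.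
  rewrite -sumrB => Wtu; apply/eqP; rewrite -subr_eq0; apply/eqP/bP.
  by congr W: Wtu; apply: eq_bigr => i _; rewrite !mxE rmorphB mulrBl.
have exP : exists d, P d by exists 0%N.
have [d /asboolP [b [Vb bP]] dmax] := ex_maxnP exP Pmax.
exists d, b; split=> // x Vx.
have [[c Wc]|nex] := pselect (exists c : 'rV[F]_d, W (x - \sum_i iota (c 0 i) * b i)).
  exists c; split=> // c' Wc'; apply/eqP; rewrite -subr_eq0; apply/eqP/bP.
  case: (sW) => _ WB _; have := WB _ _ Wc' Wc; congr W.
  rewrite opprB addrC addrA subrK -sumrB; apply: eq_bigr => i _.
  by rewrite !mxE rmorphB mulrBl.
suff /dmax : P d.+1 by rewrite ltnn.
apply/asboolP; exists (fun i => if unlift ord0 i is Some j then b j else x).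
split=> [i|c]; first by case: unlift.
rewrite big_ord_recl unlift_none.
under eq_bigr do rewrite liftK.
move=> Wc.
have [c0|c0] := eqVneq (c 0 ord0) 0.
  have cb : (\row_j c 0 (lift ord0 j)) = 0 :> 'rV[F]_d.
    apply: bP; congr W: Wc; rewrite c0 rmorph0 mul0r add0r.
    by apply: eq_bigr => i _; rewrite mxE.
  apply/rowP=> i; rewrite mxE; case: (unliftP ord0 i) => [j ->|-> //].
  by have /rowP/(_ j) := cb; rewrite !mxE.
case: nex; exists (\row_j (- (c 0 ord0)^-1 * c 0 (lift ord0 j))).
case: (sW) => _ _ /(_ (c 0 ord0)^-1 _ Wc); congr W.
rewrite mulrDr mulrA -rmorphM mulVf // rmorph1 mul1r mulr_sumr -sumrN; congr (_ + _).
by apply: eq_bigr => i _; rewrite mxE mulNr rmorphN rmorphM; ring.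
Qed.

Lemma qdim_of_card V W d (T : finType) (s : T -> K) :
  subspace_set V -> subspace_set W -> incongruent V W s -> #|T| = (#|F| ^ d)%N ->
  (forall (T' : finType) (s' : T' -> K), incongruent V W s' -> (#|T'| <= #|F| ^ d)%N) ->
  qdim V W d.
Proof.
move=> sV sW isd cT bnd; have [d' dV] := qdim_exists sV sW bnd.
suff -> : d = d' by [].
apply/eqP; rewrite eqn_leq -(leq_exp2l d d' q0) -(leq_exp2l d' d q0) -cT.
rewrite (incongruent_card_le sV sW dV isd) cT /=.
have [b [_ [ib _]]] := qdim_family sV sW dV.
by have := bnd _ _ ib; rewrite card_mx mul1n.
Qed.

Lemma qdim_le V W (d : nat) V' W' (d' : nat) (f : K -> K) : subspace_set V -> subspace_set W ->
  subspace_set V' -> subspace_set W' -> qdim V' W' d' ->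
  (forall x, V x -> V' (f x)) ->
  (forall x y, V x -> V y -> W' (f x - f y) -> W (x - y)) ->
  qdim V W d -> (d <= d')%N.
Proof.
move=> sV sW sV' sW' dV' fV fW dV; have [b [_ [[Vb ib] _]]] := qdim_family sV sW dV.
rewrite -(leq_exp2l _ _ q0) -[X in (X <= _)%N](_ : #|{: 'rV[F]_d}| = _).
  apply: (incongruent_card_le (s := f \o b) sV' sW' dV'); split=> [t|t u /= /fW]; first exact: fV.
  by move=> /(_ (Vb _) (Vb _)) /ib.
by rewrite card_mx mul1n.
Qed.

Lemma qdim_unique V W (d d' : nat) : subspace_set V -> subspace_set W ->
  qdim V W d -> qdim V W d' -> d = d'.
Proof.
move=> sV sW dV dV'; apply/eqP; rewrite eqn_leq.
by rewrite (qdim_le (f := id) sV sW sV sW dV') // (qdim_le (f := id) sV sW sV sW dV).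
Qed.

Lemma qdim_sub V W V' W' (d' : nat) (f : K -> K) : subspace_set V -> subspace_set W ->
  subspace_set V' -> subspace_set W' -> qdim V' W' d' ->
  (forall x, V x -> V' (f x)) ->
  (forall x y, V x -> V y -> W' (f x - f y) -> W (x - y)) ->
  exists2 d, qdim V W d & (d <= d')%N.
Proof.
move=> sV sW sV' sW' dV' fV fW.
have [T s [Vs is_]|d dV] := qdim_exists (N := #|F| ^ d') sV sW.
  apply: (incongruent_card_le (s := f \o s) sV' sW' dV'); split=> [t|t u /= /fW]; first exact: fV.
  by move=> /(_ (Vs _) (Vs _)) /is_.
by exists d => //; apply: qdim_le dV' fV fW dV.
Qed.

Lemma qdim_add V W U d e : subspace_set V -> subspace_set W -> subspace_set U ->
  W `<=` V -> U `<=` W -> qdim V W d -> qdim W U e -> qdim V U (d + e).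
Proof.
move=> sV sW sU WV UW dV dW.
have [b [r [[Vb ib] rP]]] := qdim_family sV sW dV.
have [b' [r' [[Vb' ib'] rP']]] := qdim_family sW sU dW.
have [_ VB _] := sV; have [_ WB _] := sW; have [_ UB _] := sU.
apply: (@qdim_of_card _ _ _ ('rV[F]_d * 'rV[F]_e)%type (fun c => b c.1 + b' c.2)) => //.
- split=> [c|[c c'] [h h'] /=]; first by apply: subspace_add => //; apply: WV.
  have -> : b c + b' c' - (b h + b' h') = b c - b h - (b' h' - b' c') by ring.
  move=> Uch; have ch : c = h.
    apply: ib; rewrite -[_ - _](subrK (b' h' - b' c')).
    by apply: subspace_add => //; [apply: UW|apply: WB].
  by move: Uch; rewrite ch subrr sub0r opprB => /ib' ->.
- by rewrite card_prod !card_mx !mul1n expnD.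
move=> T s [Vs is_].
have : injective (fun t => (r (s t), r' (s t - b (r (s t))))).
  move=> t u [rtu]; rewrite -rtu => rtu'; apply: is_.
  have := UB _ _ (rP' _ (rP _ (Vs t))) (rP' (s u - b (r (s t))) _).
  rewrite rtu' => H.
  have -> : s t - s u = s t - b (r (s t)) - b' (r' (s u - b (r (s t)))) -
     (s u - b (r (s t)) - b' (r' (s u - b (r (s t))))) by ring.
  by apply: H; rewrite rtu; apply: rP.
by move/leq_card; rewrite card_prod !card_mx !mul1n expnD.
Qed.

End Quotients.

Lemma incongruent_growth (F : finFieldType) (K : fieldType) (iota : {rmorphism F -> K}) :
  function_field iota -> forall y : K, y != 0 ->
  exists C, forall (R : set K) (T : finType) (s : T -> K),
  subring_set R -> R y -> incongruent R [set x | exists2 w, R w & x = y * w] s ->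
  (#|T| <= #|F| ^ C)%N.
Proof.
move=> ff y y0; have [C CP] := function_field_growth ff y.
by exists C => R T s sR Ry is_; apply: CP; apply: combinations_inj is_.
Qed.

(** * Places *)

Section Places.
Variables (F : finFieldType) (K : fieldType) (iota : {rmorphism F -> K}).
Implicit Types (P Q : place iota) (x y z : K).

Definition vge P (k : int) : set K := [set z | z = 0 \/ k <= P z].

Lemma place_ord0 P : P 0 = 0. Proof. by case: P. Qed.

Lemma ordM P x y : x != 0 -> y != 0 -> P (x * y) = P x + P y.
Proof. by case: P x y. Qed.

Lemma ordD P x y : x != 0 -> y != 0 -> x + y != 0 -> Num.min (P x) (P y) <= P (x + y).
Proof. by case: P x y. Qed.

Lemma uniformizer P : exists2 x, x != 0 & P x = 1.
Proof. by case: P. Qed.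

Lemma ord_iota P a : P (iota a) = 0. Proof. by case: P a. Qed.

Lemma place_ord1 P : P 1 = 0.
Proof. by rewrite -(rmorph1 iota) ord_iota. Qed.

Lemma ordN P x : P (- x) = P x.
Proof.
have [->|x0] := eqVneq x 0; first by rewrite oppr0.
by rewrite -mulN1r ordM ?oppr_eq0 ?oner_eq0 // -(rmorphN1 iota) ord_iota add0r.
Qed.

Lemma ordV P x : P x^-1 = - P x.
Proof.
have [->|x0] := eqVneq x 0; first by rewrite invr0 place_ord0 oppr0.
by apply/eqP; rewrite -addr_eq0 -ordM ?invr_eq0 // mulVf // place_ord1.
Qed.

Lemma ordX P x n : P (x ^+ n) = P x *+ n.
Proof.
have [->|x0] := eqVneq x 0; first by rewrite expr0n place_ord0 mul0rn; case: n; rewrite /= (place_ord0, place_ord1).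
by elim: n => [|n IH]; rewrite ?expr0 ?place_ord1 // exprS ordM ?expf_neq0 // IH mulrS.
Qed.

Lemma vge_ord P k x : x != 0 -> vge P k x -> k <= P x.
Proof. by move=> /eqP x0 []. Qed.

Lemma vge_le P k l x : k <= l -> vge P l x -> vge P k x.
Proof. by move=> kl [->|h]; [left|right; apply: le_trans h]. Qed.

Lemma vgeN P k x : vge P k x -> vge P k (- x).
Proof. by case=> [->|h]; [left; rewrite oppr0|right; rewrite ordN]. Qed.

Lemma vgeD P k x y : vge P k x -> vge P k y -> vge P k (x + y).
Proof.
move=> [->|hx]; first by rewrite add0r.
move=> [->|hy]; first by rewrite addr0; right.
have [->|x0] := eqVneq x 0; first by rewrite add0r; right.
have [->|y0] := eqVneq y 0; first by rewrite addr0; right.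
have [->|xy0] := eqVneq (x + y) 0; first by left.
by right; apply: le_trans (ordD P x0 y0 xy0); rewrite le_min hx.
Qed.

Lemma vgeB P k x y : vge P k x -> vge P k y -> vge P k (x - y).
Proof. by move=> hx hy; apply/vgeD/vgeN. Qed.

Lemma vgeM P k l x y : vge P k x -> vge P l y -> vge P (k + l) (x * y).
Proof.
move=> [->|hx]; first by rewrite mul0r; left.
move=> [->|hy]; first by rewrite mulr0; left.
have [->|x0] := eqVneq x 0; first by rewrite mul0r; left.
have [->|y0] := eqVneq y 0; first by rewrite mulr0; left.
by right; rewrite ordM // lerD.
Qed.

Lemma vge0 P k : vge P k 0. Proof. by left. Qed.

Lemma vge1 P : vge P 0 1. Proof. by right; rewrite place_ord1. Qed.

Lemma vge_iota P a : vge P 0 (iota a). Proof. by right; rewrite ord_iota. Qed.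

Lemma vgeX P x n : vge P 0 x -> vge P 0 (x ^+ n).
Proof.
move=> h; elim: n => [|n IH]; first exact: vge1.
by rewrite exprS -[0 : int]addr0; apply: vgeM.
Qed.

Lemma vge_sum P k (I : Type) (r : seq I) (p : pred I) (f : I -> K) :
  (forall i, p i -> vge P k (f i)) -> vge P k (\sum_(i <- r | p i) f i).
Proof. by move=> h; elim/big_ind: _ => //; [apply: vge0|apply: vgeD]. Qed.

Lemma vge_mulr P k x y : y != 0 -> vge P k (x * y) <-> vge P (k - P y) x.
Proof.
move=> y0; split=> h.
  by rewrite -(mulfK y0 x) -ordV; apply: vgeM => //; right.
by rewrite -(subrK (P y) k); apply: vgeM => //; right.
Qed.

Lemma ord_dominant P x y : x != 0 -> vge P (P x + 1) y -> x + y != 0 /\ P (x + y) = P x.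
Proof.
move=> x0 hy.
have xy0 : x + y != 0.
  apply/eqP => xy; move: hy; have -> : y = - x by apply/eqP; rewrite -addr_eq0 addrC xy.
  by move=> /vgeN; rewrite opprK => /(vge_ord x0); lia.
split=> //; apply/eqP; rewrite eq_le; apply/andP; split; last first.
  apply: vge_ord => //; apply: vgeD; first by right.
  by apply: vge_le hy; rewrite lerDl.
rewrite leNgt; apply/negP => lt.
have := vgeB (k := P x + 1) (P := P) (x := x + y) (y := y).
rewrite addrK => /(_ _ hy); have h : vge P (P x + 1) (x + y) by right; lia.
by move/(_ h)/(vge_ord x0); lia.
Qed.

Lemma place_eq P Q : P =1 Q -> P = Q.
Proof.
case: P Q => [p p0 pM pD pu pi] [r r0 rM rD ru ri] /= /funext pr.
by move: p0 pM pD pu pi; rewrite pr => *; congr Place; apply: Prop_irrelevance.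
Qed.

Lemma vge_subspace P k : subspace_set iota (vge P k).
Proof.
split=> [|x y|a x]; [exact: vge0|exact: vgeB|].
by move=> h; rewrite -[k]add0r; apply: vgeM => //; apply: vge_iota.
Qed.

Lemma vge_subring P : subring_set (vge P 0).
Proof.
split=> [|x y|x y]; [exact: vge1|exact: vgeB|].
by rewrite -{3}[0 : int]addr0; apply: vgeM.
Qed.

Lemma subspace_bigcap (I : Type) (V : I -> set K) :
  (forall i, subspace_set iota (V i)) -> subspace_set iota [set x | forall i, V i x].
Proof.
move=> sV; split=> [i|x y hx hy i|a x hx i]; have [V0 VB VZ] := sV i => //.
  by apply: VB.
exact: VZ.
Qed.

Hypothesis ff : function_field iota.

Lemma qdim_residue P : qdim iota (vge P 0) (vge P 1) (place_deg P).
Proof.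
have ring_vge : place_ring P = vge P 0.
  apply/funext => x; apply/propext; split=> [h|[->|] //]; first by right.
  by rewrite /place_ring /= place_ord0.
have ideal_vge : place_ideal P = vge P 1.
  apply/funext => x; apply/propext; split=> -[->|h]; try by left.
    by right; rewrite -gtz0_ge1.
  by right; rewrite gtz0_ge1.
suff [d dP] : exists d, qdim iota (vge P 0) (vge P 1) d.
  have ex : exists d, exists b : 'I_d -> K, residue_basis P b.
    by exists d; rewrite /residue_basis ring_vge ideal_vge.
  have := xgetPex 0%N ex; rewrite /place_deg; set d' := xget _ _.
  by rewrite /= /residue_basis ring_vge ideal_vge.
have [t t0 t1] := uniformizer P.
have [C CP] := incongruent_growth ff t0.
apply: (@qdim_exists _ _ _ _ _ (#|F| ^ C)%N); [exact: vge_subspace|exact: vge_subspace|].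
move=> T s [Vs is_]; apply: (CP (vge P 0)) => //; first exact: vge_subring.
  by right; rewrite t1.
split=> // a b [w hw sab]; apply: is_; rewrite sab -[1 : int]addr0.
by apply: vgeM => //; right; rewrite t1.
Qed.

Lemma place_deg_gt0 P : (0 < place_deg P)%N.
Proof.
have dP := qdim_residue P; rewrite lt0n; apply/eqP => d0.
have := incongruent_card_le (s := fun c : 'rV[F]_1 => iota (c 0 0))
  (vge_subspace P 0) (vge_subspace P 1) dP.
rewrite d0 card_mx expn0 muln1 expn1 => H.
have : (1 < #|F|)%N by exact: card_finNzRing_gt1.
rewrite ltnNge H //; split=> [c|c c']; first exact: vge_iota.
rewrite -rmorphB => -[/eqP|]; last by rewrite ord_iota.
by rewrite fmorph_eq0 subr_eq0 => /eqP h; apply/rowP => i; rewrite ord1.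
Qed.

End Places.

Section ValuationRing.
Variables (F : finFieldType) (K : fieldType) (iota : {rmorphism F -> K}).
Hypothesis ff : function_field iota.
Variables (O : set K) (t : K).
Hypotheses (sO : subring_set O) (Oiota : forall a, O (iota a)).
Hypothesis Oval : forall w : K, w != 0 -> O w \/ O w^-1.
Hypotheses (t0 : t != 0) (Ot : O t) (nOt : ~ O t^-1).

Let O1 : O 1. Proof. by case: sO. Qed.
Let OB x y : O x -> O y -> O (x - y). Proof. by case: sO => _ + _; apply. Qed.
Let OM x y : O x -> O y -> O (x * y). Proof. by case: sO => _ _; apply. Qed.
Let O0 : O 0. Proof. by rewrite -(subrr 1); apply: OB. Qed.
Let ON x : O x -> O (- x). Proof. by move=> h; rewrite -sub0r; apply: OB. Qed.
Let OD x y : O x -> O y -> O (x + y).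
Proof. by move=> hx hy; rewrite -[y]opprK; apply/OB/ON. Qed.
Let OX x n : O x -> O (x ^+ n).
Proof. by move=> h; elim: n => [|n IH]; rewrite ?expr0 // exprS; apply: OM. Qed.

(* The elements [b 1, ..., b N] are independent over F modulo [a]. *)
Lemma divisor_chain_bound a : a != 0 -> O a -> exists C, forall N (b : nat -> K),
  O (a / b 0%N) ->
  (forall i, (i < N)%N -> [/\ O (b i.+1), b i != 0, b i.+1 != 0, O (b i / b i.+1)
                             & ~ O (b i.+1 / b i)]) -> (N <= C)%N.
Proof.
move=> a0 Oa; have [C CP] := incongruent_growth ff a0.
exists C => N b ab bP.
have q1 : (1 < #|F|)%N by exact: card_finNzRing_gt1.
rewrite -(leq_exp2l _ _ q1).
have <- : #|{ffun 'I_N -> F}| = (#|F| ^ N)%N by rewrite card_ffun card_ord.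
apply: (CP O _ (fun c : {ffun 'I_N -> F} => \sum_i iota (c i) * b i.+1)) => //.
have bdiv i j : (i <= j < N.+1)%N -> O (b i / b j).
  elim: j => [|j IH].
    rewrite leqn0 => /andP[/eqP -> _].
    have [->|h] := eqVneq (b 0%N) 0; first by rewrite mul0r.
    by rewrite divff.
  rewrite leq_eqVlt => /andP[/predU1P[->|ij] jN].
    by have [_ _ h _ _] := bP j jN; rewrite divff.
  have [_ h1 h2 h3 _] := bP j jN.
  have -> : b i / b j.+1 = (b i / b j) * (b j / b j.+1) by rewrite mulrA divfK.
  by apply: OM => //; apply: IH; apply/andP; split; [exact: ij|exact: ltnW].
split=> [c|c c'].
  by by elim/big_ind: _ => // i _; apply: OM => //; have [] := bP i (ltn_ord i).
rewrite -sumrB => -[w Ow E]; apply/eqP; apply: contrapT => cc'.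
have /existsP : [exists i, c i != c' i].
  rewrite -negb_forall; apply/negP => /forallP h; apply: cc'.
  by apply/eqP/ffunP => i; apply/eqP.
move=> [i0 i0P].
case: (@arg_maxnP _ i0 (fun i => c i != c' i) (fun i : 'I_N => (i : nat)) i0P) => i iP imax.
have [_ h1 h2 h3 h4] := bP i (ltn_ord i).
pose d := iota (c i - c' i).
have d0 : d != 0 by rewrite fmorph_eq0 subr_eq0.
have Odb : O (d * b i.+1 / b i).
  have -> : d * b i.+1 = a * w - \sum_(j | j != i) (iota (c j) * b j.+1 - iota (c' j) * b j.+1).
    by rewrite -E (bigD1 i) //= addrK /d rmorphB mulrBl.
  rewrite mulrBl; apply: OB.
    have -> : a * w / b i = (a / b 0%N) * (b 0%N / b i) * w.
      have b00 : b 0%N != 0 by case: (nat_of_ord i) (ltn_ord i) => [|k] kN; have [] := bP 0%N (leq_ltn_trans (leq0n _) kN).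
      by field; rewrite ?b00 ?h1 ?h2.
    by apply/OM => //; apply: OM => //; apply: bdiv; rewrite /= ltnS ltnW.
  rewrite mulr_suml; elim/big_ind: _ => // j ji.
  have [cj|cj] := eqVneq (c j) (c' j); first by rewrite cj subrr mul0r.
  rewrite -mulrBl -rmorphB -mulrA; apply: OM => //; apply: bdiv.
  have ji' : (j < i)%N by rewrite ltn_neqAle ji; apply: imax.
  by rewrite ji' ltnS ltnW.
apply: h4; have -> : b i.+1 / b i = iota ((c i - c' i)^-1) * (d * b i.+1 / b i).
  by rewrite fmorphV -/d -mulrA mulKf.
exact: OM.
Qed.

Let maximal (b : K) := [/\ b != 0, O b & ~ O b^-1].

Let uniformizer_ex : exists p, maximal p /\ forall b, maximal b -> O (b / p).
Proof.
apply: contrapT => nex.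
have step : forall b : K, exists c : K, maximal b -> [/\ maximal c, O (b / c) & ~ O (c / b)].
  move=> b; have [mb|nb] := pselect (maximal b); last by exists 0.
  apply: contrapT => nc; apply: nex; exists b; split=> // c mc.
  apply: contrapT => ncb; apply: nc; exists c => _; split=> //.
  have [b0 _ _] := mb; have [c0 _ _] := mc.
  have bc0 : b / c != 0 by rewrite mulf_neq0 ?invr_eq0.
  by have [//|] := Oval bc0; rewrite invf_div => /ncb.
have [f fP] := choice step.
have [C CP] := divisor_chain_bound t0 Ot.
have mt i : maximal (iter i f t) by elim: i => [|i IH] //=; have [] := fP _ IH.
have := CP C.+1 (fun i => iter i f t); rewrite ltnn => H; apply: notF; apply: H => [|i _].
  by rewrite /= divff.
have [h1 h2 h3] := fP _ (mt i); have [a1 a2 _] := mt i; have [b1 b2 _] := mt i.+1.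
by split.
Qed.

Lemma valuation_ring_place : exists P : place iota, P t^-1 < 0.
Proof.
have [p [[p0 Op np] pP]] := uniformizer_ex.
have Opn (k : nat) a : O a -> O (a * p ^ k) by move=> Oa; apply: OM => //; apply: OX.
have unitN a : a != 0 -> O a -> ~ O (a / p) -> O a^-1.
  move=> a0 Oa nap; apply: contrapT => na; apply: nap; apply: pP; by split.
have upper a : a != 0 -> O a -> exists k : nat, O (a / p ^+ k) /\ ~ O (a / p ^+ k.+1).
  move=> a0 Oa; have [C CP] := divisor_chain_bound a0 Oa.
  have bnd k : `[< O (a / p ^+ k) >] -> (k <= C)%N.
    move=> /asboolP Oak; apply: (CP k (fun i => p ^+ (k - i))); first by rewrite subn0.
    move=> i ik; have -> : (k - i = (k - i.+1).+1)%N by lia.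
    have e0 : p ^+ (k - i.+1) != 0 by rewrite expf_neq0.
    split; rewrite ?expf_neq0 //; first exact: OX.
      by rewrite exprS mulfK.
    have -> // : p ^+ (k - i.+1) / p ^+ (k - i.+1).+1 = p^-1.
    by rewrite exprS; field; rewrite ?p0 ?e0.
  have ex : exists k, `[< O (a / p ^+ k) >] by exists 0%N; apply/asboolP; rewrite expr0 divr1.
  have [k /asboolP kP kmax] := ex_maxnP ex bnd.
  exists k; split=> // h; have /kmax : `[< O (a / p ^+ k.+1) >] by apply/asboolP.
  by rewrite ltnn.
pose isord x (k : int) := O (x * p ^ (- k)) /\ O (x * p ^ (- k))^-1.
have pk0 (k : int) : p ^ k != 0 by rewrite expfz_neq0.
have ord_exO a : a != 0 -> O a -> exists k, isord a k.
  move=> a0 Oa; have [k [k1 k2]] := upper a a0 Oa.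
  exists (k : int); rewrite /isord -invr_expz; split; first exact: k1.
  apply: unitN => //; first by rewrite mulf_neq0 ?invr_eq0.
  by move: k2; rewrite exprSr invfM mulrA.
have ord_ex a : a != 0 -> exists k, isord a k.
  move=> a0; have [/ord_exO|Oa] := Oval a0; first exact.
  have [//|k [k1 k2]] := ord_exO a^-1 _ Oa; first by rewrite invr_eq0.
  exists (- k); rewrite /isord opprK.
  have e : (a * p ^ k) = (a^-1 * p ^ (- k))^-1 by rewrite invfM invrK invr_expz opprK.
  by rewrite e invrK.
have ord_ge a k l : a != 0 -> isord a k -> (l <= k <-> O (a * p ^ (- l))).
  move=> a0 [k1 k2]; split=> [lk|Ol].
    have -> : a * p ^ (- l) = a * p ^ (- k) * p ^ `|k - l|%N.
      rewrite -mulrA -expfzDr //; congr (_ * p ^ _); lia.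
    exact: Opn.
  rewrite leNgt; apply/negP => kl; apply: np.
  have -> : p^-1 = (a * p ^ (- l)) * (a * p ^ (- k))^-1 * p ^ (`|l - k|.-1)%N.
    have -> : (a * p ^ (- l)) * (a * p ^ (- k))^-1 = p ^ (- l) * p ^ k.
      by rewrite -invr_expz -invr_expz; field; rewrite ?a0 ?pk0.
    rewrite -!expfzDr // -[p^-1]/(p ^ (-1)); congr (p ^ _); lia.
  by apply/Opn/OM.
have ord_uniq a k l : a != 0 -> isord a k -> isord a l -> k = l.
  move=> a0 ik il; apply/eqP; rewrite eq_le; apply/andP; split.
    by apply/(ord_ge _ _ _ a0 il); case: ik.
  by apply/(ord_ge _ _ _ a0 ik); case: il.
have /choice [v vP] : forall a, exists k : int, (a = 0 -> k = 0) /\ (a != 0 -> isord a k).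
  move=> a; have [->|a0] := eqVneq a 0; first by exists 0.
  have [k kP] := ord_ex a a0; exists k; split=> // a0'; by rewrite a0' eqxx in a0.
have vO a : a != 0 -> isord a (v a) by have [] := vP a.
have vge0 a k : a != 0 -> (k <= v a <-> O (a * p ^ (- k))) by move=> a0; apply/ord_ge/vO.
have vunit a : a != 0 -> O a -> O a^-1 -> v a = 0.
  move=> a0 Oa Oa'; apply: (ord_uniq a) => //; first exact: vO.
  by rewrite /isord oppr0 expr0z mulr1.
have v0 : v 0 = 0 by have [+ _] := vP 0; apply.
have vM x y : x != 0 -> y != 0 -> v (x * y) = v x + v y.
  move=> x0 y0; apply: (ord_uniq (x * y)); rewrite ?mulf_neq0 //; first by apply: vO; rewrite mulf_neq0.
  have [a1 a2] := vO x x0; have [b1 b2] := vO y y0.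
  have e : x * y * p ^ (- (v x + v y)) = (x * p ^ (- v x)) * (y * p ^ (- v y)).
    by rewrite opprD expfzDr //; ring.
  rewrite /isord e; split; first exact: OM.
  by rewrite invfM; exact: OM.
have vD x y : x != 0 -> y != 0 -> x + y != 0 -> Num.min (v x) (v y) <= v (x + y).
  move=> x0 y0 xy0; apply/vge0 => //; rewrite mulrDl.
  by apply: OD; apply/(vge0 _ _ _).1 => //; rewrite ge_min lexx ?orbT.
have v1 : exists2 x, x != 0 & v x = 1.
  exists p => //; apply: (ord_uniq p) => //; first exact: vO.
  by rewrite /isord -[p ^ (-1)]/(p^-1) divff // invr1.
have vi a : v (iota a) = 0.
  have [->|a0] := eqVneq a 0; first by rewrite rmorph0.
  by apply: vunit; rewrite ?fmorph_eq0 // -fmorphV.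
exists (Place v0 vM vD v1 vi) => /=.
rewrite ltNge; apply/negP => h; apply: nOt; move/vge0 : h.
by rewrite invr_eq0 oppr0 expr0z mulr1; apply.
Qed.

End ValuationRing.

Section PlaceExistence.
Variables (F : finFieldType) (K : fieldType) (iota : {rmorphism F -> K}).
Hypothesis ff : function_field iota.

Section MaximalSubring.
Variables (O : set K) (t : K).
Hypotheses (sO : subring_set O) (t0 : t != 0) (Ot : O t) (nOt : ~ O t^-1).
Hypothesis Omax : forall O', subring_set O' -> O `<=` O' -> ~ O' t^-1 -> O' `<=` O.

Let O1 : O 1. Proof. by case: sO. Qed.
Let OB x y : O x -> O y -> O (x - y). Proof. by case: sO => _ + _; apply. Qed.
Let OM x y : O x -> O y -> O (x * y). Proof. by case: sO => _ _; apply. Qed.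
Let O0 : O 0. Proof. by rewrite -(subrr 1); apply: OB. Qed.
Let ON x : O x -> O (- x). Proof. by move=> h; rewrite -sub0r; apply: OB. Qed.
Let OD x y : O x -> O y -> O (x + y).
Proof. by move=> hx hy; rewrite -[y]opprK; apply/OB/ON. Qed.
Let OX x n : O x -> O (x ^+ n).
Proof. by move=> h; elim: n => [|n IH]; rewrite ?expr0 // exprS; apply: OM. Qed.
Let O_sum (I : finType) (f : I -> K) : (forall i, O (f i)) -> O (\sum_i f i).
Proof. by move=> h; elim/big_ind: _. Qed.

Let over (p : {poly K}) := forall i, O p`_i.

Let generated (w : K) : ~ O w -> exists2 p, over p & p.[w] = t^-1.
Proof.
move=> nOw; apply: contrapT => np; apply: nOw.
apply: (Omax (O' := [set z | exists2 p, over p & p.[w] = z])).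
- split=> [|_ _ [p hp <-] [r hr <-]|_ _ [p hp <-] [r hr <-]].
  + exists 1; rewrite ?hornerE // => i; rewrite coef1; by case: eqP.
  + by exists (p - r); rewrite ?hornerE // => i; rewrite coefB; apply: OB.
  + exists (p * r); rewrite ?hornerE // => i; rewrite coefM.
    by apply: O_sum => j; apply: OM.
- move=> z Oz; exists z%:P; rewrite ?hornerE // => i; rewrite coefC; by case: eqP.
- by move=> [p hp hw]; apply: np; exists p.
- exists 'X; rewrite ?hornerE // => i; rewrite coefX; by case: eqP.
Qed.

Let unit_1t (a : K) : O a -> O (1 - t * a)^-1.
Proof.
move=> Oa; set u := 1 - t * a.
have u0 : u != 0.
  rewrite subr_eq0; apply/eqP => e; apply: nOt.
  by have -> : t^-1 = a by rewrite -[LHS]mulr1 e mulKf.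
have Ou : O u by apply/OB/OM.
apply: contrapT => /generated[p op pu].
have [a' Oa' ea'] : exists2 a', O a' & u ^+ size p = 1 - t * a'.
  elim: (size p) => [|n [b Ob eb]]; first by exists 0; rewrite // mulr0 subr0 expr0.
  exists (a + b - t * a * b); first by apply: OB; [exact: OD|apply: OM => //; exact: OM].
  by rewrite exprS eb /u; ring.
have [b Ob eb] : exists2 b, O b & u ^+ size p = t * b.
  exists (t^-1 * u ^+ size p); last by rewrite mulVKf.
  rewrite -pu horner_coef mulr_suml; apply: O_sum => i.
  have -> : p`_i * u^-1 ^+ i * u ^+ size p = p`_i * u ^+ (size p - i).
    by rewrite -mulrA exprVn [_^-1 * _]mulrC -expfB_cond // (negbTE u0) add0n ltnW.
  by apply: OM => //; apply: OX.
apply: nOt; have -> : t^-1 = a' + b; last exact: OD.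
by rewrite -[LHS]mulr1 (_ : 1 = t * (a' + b)) ?mulKf // mulrDr -eb ea' addrC subrK.
Qed.

(* Two integral relations of [t^-1] over [w] and over [w^-1] shorten each other. *)
Let no_relations N : forall (w : K) (p r : {poly K}), w != 0 -> over p -> over r ->
  (size p + size r <= N)%N -> (size r <= size p)%N ->
  t * p.[w] = 1 -> t * r.[w^-1] = 1 -> False.
Proof.
elim: N => [|N IH] w p r w0 op or spr srp hp hr.
  move: hp; have /eqP : size p = 0%N by lia.
  by rewrite size_poly_eq0 => /eqP ->; rewrite hornerC mulr0 => /eqP; rewrite eq_sym oner_eq0.
have := hr; rewrite horner_coef.
case er : (size r) => [|m] hr'.
  by move/eqP: hr'; rewrite big_ord0 mulr0 eq_sym oner_eq0.
case ep : (size p) => [|n]; first by lia.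
pose u := (1 - t * r`_0)^-1.
have Ou : O u by apply: unit_1t.
have u0 : 1 - t * r`_0 != 0.
  rewrite subr_eq0; apply/eqP => e; apply: nOt.
  by have -> : t^-1 = r`_0 by rewrite -[LHS]mulr1 e mulKf.
have mn : (m <= n)%N by lia.
have wn : w ^+ n = t * \sum_(j < m) u * r`_j.+1 * w ^+ (n - j.+1).
  have : 1 - t * r`_0 = t * \sum_(j < m) r`_j.+1 * w^-1 ^+ j.+1.
    move: hr'; rewrite big_ord_recl expr0 mulr1 mulrDr => <-.
    by rewrite addrAC subrr add0r; congr (_ * _); apply: eq_bigr.
  move=> E; have -> : w ^+ n = u * (1 - t * r`_0) * w ^+ n by rewrite /u mulVf // mul1r.
  rewrite E -!mulrA mulrCA; congr (_ * _); rewrite mulr_suml mulr_sumr.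
  apply: eq_bigr => j _; rewrite -!mulrA; congr (_ * (_ * _)).
  have jn : (j.+1 <= n)%N by apply: leq_trans mn.
  by rewrite exprVn [_^-1 * _]mulrC -expfB_cond // (negbTE w0) add0n.
pose p' := \poly_(i < n) p`_i + \sum_(j < m) (p`_n * t * u * r`_j.+1) *: 'X^(n - j.+1).
have op' : over p'.
  move=> i; rewrite /p' coefD coef_poly coef_sum; apply: OD; first by case: ifP.
  apply: O_sum => j; rewrite coefZ coefXn; apply: OM; first by do 3!apply: OM => //.
  by case: eqP.
have sp' : (size p' <= n)%N.
  apply: leq_trans (size_polyD _ _) _; rewrite geq_max size_poly /=.
  apply: (leq_trans (size_sum _ _ _)); apply/bigmax_leqP => j _.
  apply: leq_trans (size_scale_leq _ _) _; rewrite size_polyXn.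
  have := ltn_ord j; lia.
have hp' : t * p'.[w] = 1.
  rewrite -hp; congr (_ * _); rewrite /p' hornerD horner_poly horner_sum.
  rewrite horner_coef ep big_ord_recr /= wn; congr (_ + _).
  rewrite mulrA mulr_sumr; apply: eq_bigr => j _.
  by rewrite hornerZ hornerXn !mulrA.
have [le|lt] := leqP (size r) (size p').
  by apply: (IH w p' r) => //; lia.
apply: (IH w^-1 r p') => //; rewrite ?invr_eq0 ?invrK //; last by lia.
by lia.
Qed.

Lemma maximal_subring_val (w : K) : w != 0 -> O w \/ O w^-1.
Proof.
move=> w0; have [|/generated[p op hp]] := pselect (O w); first by left.
have [|/generated[r or hr]] := pselect (O w^-1); first by right.
have hp' : t * p.[w] = 1 by rewrite hp divff.
have hr' : t * r.[w^-1] = 1 by rewrite hr divff.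
have [le|/ltnW le] := leqP (size r) (size p).
  by case: (no_relations w0 op or (leqnn _) le hp' hr').
have w0' : w^-1 != 0 by rewrite invr_eq0.
by case: (no_relations w0' or op (leqnn _) le hr'); rewrite invrK.
Qed.

End MaximalSubring.

Lemma pole_exists (y : K) : ~ algebraicOver iota y -> exists P : place iota, P y < 0.
Proof.
move=> ny; pose t := y^-1.
have y0 : y != 0 by apply/eqP => y0; apply: ny; rewrite y0; apply: algebraic0.
have t0 : t != 0 by rewrite invr_eq0.
pose good (A : set K) := [/\ subring_set A, forall a, A (iota a), A t & ~ A y].
have base : good [set z | exists p : {poly F}, z = (map_poly iota p).[t]].
  split=> [|a||].
  - split=> [|_ _ [p ->] [r ->]|_ _ [p ->] [r ->]].
    + by exists 1; rewrite rmorph1 hornerC.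
    + by exists (p - r); rewrite rmorphB hornerD hornerN.
    + by exists (p * r); rewrite rmorphM hornerM.
  - by exists a%:P; rewrite map_polyC hornerC.
  - by exists 'X; rewrite map_polyX hornerX.
  - move=> [p yp]; apply: ny; rewrite -[y]invrK; apply: algebraic_inv.
    exists ('X * p - 1).
      apply/negP => /eqP/(congr1 (fun p : {poly F} => p`_0)).
      by rewrite coefB coefXM coef1 coef0 sub0r => /eqP; rewrite oppr_eq0 oner_eq0.
    rewrite /root rmorphB rmorphM rmorph1 /= map_polyX !hornerE -/t -yp /t mulVf //.
    by rewrite subrr.
have [|A [PA Amax]] := Zorn_bigcup (P := fun A => A = set0 \/ good A).
  move=> S SP tot.
  have [[B SB gB]|nB] := pselect (exists2 B, S B & good B); last first.
    left; apply/seteqP; split=> // z [B SB Bz].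
    by have [B0|gB] := SP _ SB; [rewrite B0 in Bz|case: nB; exists B].
  right; have gS C z : S C -> C z -> good C.
    by move=> SC Cz; have [C0|//] := SP _ SC; rewrite C0 in Cz.
  have up x z : (\bigcup_(C in S) C) x -> (\bigcup_(C in S) C) z ->
      exists C, [/\ S C, good C, C x & C z].
    move=> [C SC Cx] [D SD Dz]; have [CD|DC] := tot _ _ SC SD.
      by exists D; split=> //; [apply: gS Dz|apply: CD].
    by exists C; split=> //; [apply: gS Cx|apply: DC].
  case: (gB) => -[B1 BB BM] Bi Bt nBy; split=> [|a||].
  - split=> [|x z hx hz|x z hx hz]; first by exists B.
      by have [C [SC [[_ CB _] _ _ _] Cx Cz]] := up _ _ hx hz; exists C => //; apply: CB.
    by have [C [SC [[_ _ CM] _ _ _] Cx Cz]] := up _ _ hx hz; exists C => //; apply: CM.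
  - by exists B.
  - by exists B.
  - by move=> [C SC Cy]; have [_ _ _] := gS _ _ SC Cy; apply.
have gA : good A.
  case: PA => // A0; have [] := Amax _ _ (or_intror base).
  rewrite A0; split=> // h; have [[_ _ _] _ + _] := base; by move/h.
have [sA Ai At nAy] := gA.
have nAt : ~ A t^-1 by rewrite invrK.
have Aval := maximal_subring_val sA t0 At nAt.
have [|P] := valuation_ring_place ff sA Ai _ t0 At nAt; last by rewrite invrK; exists P.
apply: Aval => O' sO' AO' nO'; apply: contrapT => nO'A.
apply: (Amax O'); first by split.
right; split=> // [a||]; [exact: AO'|exact: AO'|by rewrite -[y]invrK].
Qed.

End PlaceExistence.

(** * Approximation and Riemann's theorem *)

Lemma mulrn_gt0_ge (a : int) n : 0 < a -> n%:Z <= a *+ n.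
Proof. by move=> a0; rewrite -mulr_natr natz; nia. Qed.

Lemma mulrn_lt0_le (a : int) n : a < 0 -> a *+ n <= - n%:Z.
Proof. by move=> a0; rewrite -mulr_natr natz; nia. Qed.

Section WeakApproximation.
Variables (F : finFieldType) (K : fieldType) (iota : {rmorphism F -> K}).
Implicit Types (P Q : place iota) (S A B : seq (place iota)).

Lemma place_incl P Q : (forall x, 0 <= P x -> 0 <= Q x) -> P = Q.
Proof.
move=> PQ; have [p p0 p1] := uniformizer P.
have unit x : P x = 0 -> Q x = 0.
  move=> Px; apply/eqP; rewrite eq_le PQ ?Px // andbT -oppr_ge0 -ordV.
  by apply: PQ; rewrite ordV Px.
have QP x : Q x = P x * Q p.
  have [->|x0] := eqVneq x 0; first by rewrite !place_ord0 mul0r.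
  have ordXz (R : place iota) (k : int) : R (p ^ k) = k * R p :> int.
    case: k => n; first by rewrite -exprnP ordX -mulr_natl natz.
    by rewrite NegzE -invr_expz -exprnP ordV ordX -mulr_natl natz mulNr.
  have pz0 k : p ^ k != 0 by rewrite expfz_neq0.
  have /unit : P (x * p ^ (- P x)) = 0.
    by rewrite ordM // ordXz p1 mulr1 subrr.
  by rewrite ordM // ordXz; lia.
have [y y0 y1] := uniformizer Q.
have Qp : Q p = 1.
  have := PQ p; rewrite p1 => /(_ isT) Qp0; move: y1; rewrite QP; move: (P y) (Q p) Qp0 => a b b0 ab.
  have a0 : 0 < a by rewrite ltNge; apply/negP => a0; nia.
  nia.
by apply: place_eq => x; rewrite QP Qp mulr1.
Qed.

Lemma places_separated P Q : P <> Q -> exists2 s, s != 0 & P s < 0 /\ 0 < Q s.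
Proof.
have half P' Q' : P' <> Q' -> exists a, [/\ a != 0, 0 <= P' a & Q' a < 0].
  move=> PQ; apply: contrapT => na; apply: PQ; apply: place_incl => x Px.
  rewrite leNgt; apply/negP => Qx; apply: na; exists x; split=> //.
  by apply/eqP => x0; rewrite x0 place_ord0 in Qx.
move=> PQ; have [a [a0 Pa Qa]] := half P Q PQ.
have [b [b0 Qb Pb]] := half Q P (fun e => PQ (esym e)).
by exists (b / a); rewrite ?mulf_neq0 ?invr_eq0 // !ordM ?invr_eq0 // !ordV; lia.
Qed.

Lemma ord_1DX_pole P (s : K) n : s != 0 -> P s < 0 ->
  1 + s ^+ n.+1 != 0 /\ P (1 + s ^+ n.+1) = P s *+ n.+1.
Proof.
move=> s0 Ps; rewrite addrC -ordX; apply: ord_dominant; first by rewrite expf_neq0.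
by right; rewrite ordX place_ord1; lia.
Qed.

Lemma ord_1DX_zero P (s : K) n : s != 0 -> 0 < P s ->
  1 + s ^+ n.+1 != 0 /\ P (1 + s ^+ n.+1) = 0.
Proof.
move=> s0 Ps; rewrite -(place_ord1 P); apply: ord_dominant; first exact: oner_neq0.
by right; rewrite ordX place_ord1; lia.
Qed.

Lemma approx_pole S P : P \notin S ->
  exists2 s, s != 0 & P s < 0 /\ forall Q, Q \in S -> 0 < Q s.
Proof.
elim: S => [_|Q S IH].
  have [p p0 p1] := uniformizer P; exists p^-1; rewrite ?invr_eq0 //.
  by rewrite ordV p1.
rewrite inE negb_or => /andP[/eqP PQ /IH [s s0 [Ps Ss]]].
have [u u0 [Pu Qu]] := places_separated PQ.
pose r := \max_(R <- S) `|R u|%N.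
have rP R : R \in S -> (`|R u| <= r)%N by move=> RS; apply: (leq_bigmax_seq (F := fun R : place iota => `|R u|%N) R RS isT).
have [Qs|Qs|Qs] := ltgtP (Q s) 0.
- have [d0 _] := ord_1DX_pole r s0 Ps.
  have sr0 : s ^+ r.+1 != 0 by rewrite expf_neq0.
  have h (R : place iota) : R (u * (s ^+ r.+1 / (1 + s ^+ r.+1))) = R u + (R s *+ r.+1 - R (1 + s ^+ r.+1)).
    by rewrite !ordM ?ordV ?ordX ?mulf_neq0 ?invr_eq0.
  exists (u * (s ^+ r.+1 / (1 + s ^+ r.+1))); first by rewrite !mulf_neq0 ?invr_eq0.
  split; first by rewrite h; have [_ ->] := ord_1DX_pole r s0 Ps; lia.
  move=> R; rewrite inE => /predU1P[->|RS]; rewrite h.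
    by have [_ ->] := ord_1DX_pole r s0 Qs; lia.
  have [_ ->] := ord_1DX_zero r s0 (Ss R RS); have := rP R RS; have := mulrn_gt0_ge r.+1 (Ss R RS); lia.
- exists s => //; split=> // R; rewrite inE => /predU1P[->|] //; exact: Ss.
- have sr0 : s ^+ r.+1 != 0 by rewrite expf_neq0.
  exists (u * s ^+ r.+1); first by rewrite mulf_neq0.
  split; first by rewrite ordM // ordX; have := mulrn_lt0_le r.+1 Ps; lia.
  move=> R; rewrite inE => /predU1P[->|RS]; rewrite ordM // ordX.
    by rewrite Qs mul0rn addr0.
  by have := rP R RS; have := mulrn_gt0_ge r.+1 (Ss R RS); lia.
Qed.

Lemma approx S P (k : nat) : P \notin S ->
  exists e, vge P k (e - 1) /\ forall Q, Q \in S -> vge Q k e.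
Proof.
move=> /approx_pole[s s0 [Ps Ss]].
have [d0 dP] := ord_1DX_pole k s0 Ps.
have sr0 : s ^+ k.+1 != 0 by rewrite expf_neq0.
exists (s ^+ k.+1 / (1 + s ^+ k.+1)); split=> [|Q QS]; right.
  have -> : s ^+ k.+1 / (1 + s ^+ k.+1) - 1 = - (1 + s ^+ k.+1)^-1 by field; rewrite d0.
  by rewrite ordN ordV dP; have := mulrn_lt0_le k.+1 Ps; lia.
rewrite ordM ?invr_eq0 // ordV ordX; have [_ ->] := ord_1DX_zero k s0 (Ss Q QS).
by have := mulrn_gt0_ge k.+1 (Ss Q QS); lia.
Qed.

Lemma seq_of_multiplicity S (f : place iota -> nat) : uniq S ->
  exists A, forall P, count_mem P A = if P \in S then f P else 0%N.
Proof.
elim: S => [_|Q S IH /= /andP[QS /IH [A AP]]]; first by exists [::].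
exists (nseq (f Q) Q ++ A) => P; rewrite count_cat count_nseq AP in_cons /= [Q == P]eq_sym.
by have [->|PQ] := eqVneq P Q; rewrite /= ?(negbTE QS) /= ?mul1n ?addn0.
Qed.

Hypothesis ff : function_field iota.

Lemma zeros_bounded z : z != 0 -> exists C, forall S, uniq S ->
  (forall P, P \in S -> 0 < P z) -> (size S <= C)%N.
Proof.
move=> z0; have [C CP] := incongruent_growth ff z0.
have q1 : (1 < #|F|)%N by exact: card_finNzRing_gt1.
exists C => S uS zS; rewrite -(leq_exp2l _ _ q1).
have <- : #|{ffun 'I_(size S) -> F}| = (#|F| ^ size S)%N by rewrite card_ffun card_ord.
pose pl (i : 'I_(size S)) := tnth (in_tuple S) i.
have plS i : pl i \in S by apply: mem_tnth.
have pl_inj i j : pl i = pl j -> i = j.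
  by rewrite /pl !(tnth_nth (pl i)) /= => /eqP; rewrite nth_uniq // => /eqP/val_inj.
have /choice [e eP] : forall i, exists e, vge (pl i) 1 (e - 1) /\
    forall j, j != i -> vge (pl j) 1 e.
  move=> i; have [|e [e1 e2]] := @approx (rem (pl i) S) (pl i) 1; first by rewrite mem_rem_uniqF.
  exists e; split=> // j ji; apply: e2; rewrite (rem_filter _ uS) mem_filter plS andbT /=.
  by apply: contraNneq ji => /pl_inj ->.
have eR i j : vge (pl j) 0 (e i).
  have [->|ji] := eqVneq j i; last by apply: (@vge_le _ _ _ _ 0 1) => //; have [_] := eP i; apply.
  rewrite -[e i](subrK 1); apply: vgeD; last exact: vge1.
  by apply: (@vge_le _ _ _ _ 0 1) => //; have [] := eP i.
pose R := [set w | forall i, vge (pl i) 0 w].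
apply: (CP R _ (fun c : {ffun 'I_(size S) -> F} => \sum_i iota (c i) * e i)).
- split=> [i|x y hx hy i|x y hx hy i]; first exact: vge1.
    exact: vgeB.
  by rewrite -[0 : int]addr0; apply: vgeM.
- by move=> i; right; apply/ltW/zS.
split=> [c i|c c'].
  apply: vge_sum => j _; rewrite -[0 : int]addr0; apply: vgeM => //; exact: vge_iota.
rewrite -sumrB => -[w hw E]; apply/ffunP => i; apply/eqP; rewrite -subr_eq0.
apply/eqP; have : vge (pl i) 1 (iota (c i - c' i)).
  have -> : iota (c i - c' i) = z * w - iota (c i - c' i) * (e i - 1) -
     \sum_(j | j != i) (iota (c j) * e j - iota (c' j) * e j).
    by rewrite -E (bigD1 i) //= rmorphB; ring.
  apply: vgeB; first apply: vgeB.
  - rewrite -[1 : int]addr0; apply: vgeM => //; right.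
    by have := zS _ (plS i); lia.
  - by rewrite -[1 : int]add0r; apply: vgeM; [exact: vge_iota|have [] := eP i].
  apply: vge_sum => j ji; rewrite -mulrBl -rmorphB -[1 : int]add0r; apply: vgeM; first exact: vge_iota.
  by have [_] := eP j; apply; rewrite eq_sym.
by case=> [/eqP|]; rewrite ?ord_iota // fmorph_eq0 => /eqP.
Qed.

Lemma zero_divisor_ex z : z != 0 -> exists A, forall P, (count_mem P A)%:Z = Num.max 0 (P z).
Proof.
move=> z0; have [C CP] := zeros_bounded z0.
pose good n := `[< exists S, [/\ uniq S, forall P, P \in S -> 0 < P z & size S = n] >].
have ex : exists n, good n by exists 0%N; apply/asboolP; exists [::].
have ub n : good n -> (n <= C)%N by move=> /asboolP[S [uS zS <-]]; apply: CP.
have [n /asboolP[S [uS zS Sn]] nmax] := ex_maxnP ex ub.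
have [A AP] := seq_of_multiplicity (fun P => `|P z|%N) uS.
exists A => P; rewrite AP; case: ifP => [/zS Pz|PS].
  by rewrite max_r ?ltW // gtz0_abs.
suff Pz0 : P z <= 0 by rewrite max_l.
rewrite leNgt; apply/negP => Pz.
suff /nmax : good n.+1 by rewrite ltnn.
apply/asboolP; exists (P :: S); split; rewrite /= ?PS ?uS ?Sn //.
by move=> Q; rewrite inE => /predU1P[->|/zS].
Qed.

Definition semilocal S B := [set w | forall P, P \in S -> vge P (count_mem P B) w].

Lemma semilocal_subspace S B : subspace_set iota (semilocal S B).
Proof.
split=> [P _|x y hx hy P PS|a x hx P PS]; first exact: vge0.
  by apply: vgeB; [apply: hx|apply: hy].
by rewrite -[X in vge P X]add0r; apply: vgeM; [apply: vge_iota|apply: hx].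
Qed.

Lemma qdim_refl V : subspace_set iota V -> qdim iota V V 0.
Proof.
move=> sV; exists (fun=> 0); split=> [[]//|x Vx]; exists 0; split=> [|c _].
  by rewrite big_ord0 subr0.
by rewrite thinmx0.
Qed.

Lemma semilocal_step S B P : P \in S ->
  qdim iota (semilocal S B) (semilocal S (P :: B)) (place_deg P).
Proof.
move=> PS; have dP := qdim_residue ff P.
have sV := semilocal_subspace S B; have sW := semilocal_subspace S (P :: B).
have sV' := vge_subspace P 0; have sW' := vge_subspace P 1.
have [p p0 p1] := uniformizer P.
set k := count_mem P B.
have pk0 : p ^+ k != 0 by rewrite expf_neq0.
have Ppk : P (p ^+ k) = k by rewrite ordX p1; lia.
have cP : (count_mem P (P :: B))%:Z = k%:Z + 1 by rewrite /= eqxx PoszD addrC.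
have [d dV dle] : exists2 d, qdim iota (semilocal S B) (semilocal S (P :: B)) d & (d <= place_deg P)%N.
  apply: (qdim_sub (f := fun w => w / p ^+ k) sV sW sV' sW' dP) => [x hx|x y hx hy].
    rewrite (_ : 0 = k%:Z + P (p ^+ k)^-1); last by rewrite ordV Ppk subrr.
    by apply: vgeM; [apply: hx|right].
  rewrite -mulrBl => h Q QS.
  have [->|QP] := eqVneq Q P.
    by rewrite cP addrC -[x - y](divfK pk0); apply: vgeM => //; right; rewrite Ppk.
  have -> : count_mem Q (P :: B) = count_mem Q B by rewrite /= eq_sym (negbTE QP).
  by apply: vgeB; [apply: hx|apply: hy].
suff -> : place_deg P = d by [].
apply/eqP; rewrite eqn_leq dle andbT.
have q1 : (1 < #|F|)%N by exact: card_finNzRing_gt1.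
rewrite -(leq_exp2l _ _ q1).
have [s [r [[sv is_] _]]] := qdim_family sV' sW' dP.
pose w c : K := p ^+ k * s c.
pose M := (\max_(Q <- S) \max_c (count_mem Q B + `|Q (w c)|)).+1%N.
have MP Q c : Q \in S -> (count_mem Q B + `|Q (w c)| < M)%N.
  move=> QS; rewrite ltnS.
  apply: leq_trans (leq_bigmax_seq (F := fun Q : place iota => \max_c (count_mem Q B + `|Q (w c)|)%N) Q QS isT).
  exact: (leq_bigmax (F := fun c => count_mem Q B + `|Q (w c)|)%N c).
have [|e [e1 e2]] := @approx [seq Q <- S | Q != P] P M; first by rewrite mem_filter eqxx.
have Hw c : vge P (k%:Z + 1) (e * w c - w c).
  rewrite -{2}[w c]mul1r -mulrBl addrC; apply: vgeM.
    by apply: vge_le e1; lia.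
  by rewrite /w -[k%:Z]addr0; apply: vgeM => //; right; rewrite Ppk.
have -> : (#|F| ^ place_deg P)%N = #|{: 'rV[F]_(place_deg P)}| by rewrite card_mx mul1n.
apply: (incongruent_card_le (s := fun c => e * w c) sV sW dV); split=> [c Q QS|c c' /(_ P PS)].
  have [->|QP] := eqVneq Q P.
    rewrite -[e * _](subrK (w c)); apply: vgeD; first by apply: vge_le (Hw c); lia.
    by rewrite -/k /w -[k%:Z]addr0; apply: vgeM => //; right; rewrite Ppk.
  have h : vge Q M e by apply: e2; rewrite mem_filter QP.
  have [->|w0] := eqVneq (w c) 0; first by rewrite mulr0; apply: vge0.
  apply: (@vge_le _ _ _ _ _ (M%:Z + Q (w c))).
    by have := MP Q c QS; lia.
  by apply: vgeM => //; right.
rewrite cP => h; apply: is_.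
have h2 : vge P (k%:Z + 1) (w c - w c').
  have -> : w c - w c' = (e * w c - e * w c') -
     (e * w c - w c) + (e * w c' - w c') by ring.
  by apply: vgeD => //; apply: vgeB.
move: h2; rewrite /w -mulrBr mulrC => /(vge_mulr P _ _ pk0).1.
by rewrite Ppk addrC addKr.
Qed.

Lemma semilocal_dim S B : {subset B <= S} ->
  qdim iota (semilocal S [::]) (semilocal S B) (\sum_(P <- B) place_deg P).
Proof.
elim: B => [_|P B IH sub].
  by rewrite big_nil; apply/qdim_refl/semilocal_subspace.
rewrite big_cons addnC; apply: (qdim_add (W := semilocal S B)); try exact: semilocal_subspace.
- by move=> w hw Q QS; apply: vge_le (hw Q QS).
- by move=> w hw Q QS; apply: vge_le (hw Q QS); rewrite /=; lia.
- by apply: IH => Q QB; apply: sub; rewrite inE QB orbT.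
- by apply: semilocal_step; apply: sub; rewrite inE eqxx.
Qed.

End WeakApproximation.

Section RiemannSpaces.
Variables (F : finFieldType) (K : fieldType) (iota : {rmorphism F -> K}).
Implicit Types (P Q : place iota) (A B C : seq (place iota)) (z w : K).

(* A divisor is represented as a difference [A - B] of two lists of places. *)
Definition rr_space A B : set K :=
  [set z | forall P, vge P ((count_mem P B)%:Z - (count_mem P A)%:Z) z].

Definition ldeg A := (\sum_(P <- A) place_deg P)%N.

Definition ell A B : nat := xget 0%N [set d | qdim iota (rr_space A B) [set 0] d].

Lemma rr_subspace A B : subspace_set iota (rr_space A B).
Proof. by apply: subspace_bigcap => P; apply: vge_subspace. Qed.

Lemma zero_subspace : subspace_set iota [set 0].
Proof.
split=> //= [x y -> ->|a x ->]; first by rewrite subrr.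
by rewrite mulr0.
Qed.

Lemma perm_eq_count A B : (forall P, count_mem P A = count_mem P B) -> perm_eq A B.
Proof. by move=> h; apply/allP => P _ /=; apply/eqP/h. Qed.

Lemma count_mem_cons P Q B : count_mem P (Q :: B) = ((Q == P) + count_mem P B)%N.
Proof. by []. Qed.

Lemma rr_space_eq A B A' B' :
  (forall P, (count_mem P A)%:Z - (count_mem P B)%:Z =
             (count_mem P A')%:Z - (count_mem P B')%:Z) ->
  rr_space A B = rr_space A' B'.
Proof.
move=> h; apply/funext => z; rewrite /rr_space /=.
apply/propext; split=> hz P; have := h P => {}h.
  by rewrite -opprB -h opprB.
by rewrite -opprB h opprB.
Qed.

Lemma ldeg_cat A B : ldeg (A ++ B) = (ldeg A + ldeg B)%N.
Proof. by rewrite /ldeg big_cat. Qed.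

Lemma ldeg_cons P A : ldeg (P :: A) = (place_deg P + ldeg A)%N.
Proof. by rewrite /ldeg big_cons. Qed.

Lemma ldeg_flatten_nseq l A : ldeg (flatten (nseq l A)) = (l * ldeg A)%N.
Proof.
elim: l => [|l IH]; first by rewrite /ldeg big_nil.
by rewrite /= ldeg_cat IH mulSn.
Qed.

Lemma count_flatten_nseq P l A :
  count_mem P (flatten (nseq l A)) = (l * count_mem P A)%N.
Proof. by elim: l => // l IH; rewrite /= count_cat IH mulSn. Qed.

Lemma algebraic_ord_le0 P w : algebraicOver iota w -> P w <= 0.
Proof.
move=> [p p0 pw]; rewrite leNgt; apply/negP => Pw.
have w0 : w != 0 by apply/eqP => w0; rewrite w0 place_ord0 in Pw.
have [m [q /implyP /(_ p0) q0 pq]] := multiplicity_XsubC p 0.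
have qw : root (map_poly iota q) w.
  move: pw; rewrite pq rmorphM rmorphXn /= rmorphB /= map_polyX map_polyC /= rmorph0 subr0.
  rewrite !rootE hornerM horner_exp hornerX mulf_eq0 => /orP[//|].
  by rewrite expf_eq0 (negbTE w0) andbF.
have : vge P 1 (iota q.[0]).
  move/rootP: qw; rewrite horner_coef size_map_poly.
  case E : (size q) => [|n].
    by move=> _; rewrite horner_coef E big_ord0 rmorph0; left.
  rewrite big_ord_recl expr0 mulr1 coef_map /= -horner_coef0 => /eqP.
  rewrite addr_eq0 => /eqP ->; apply: vgeN; apply: vge_sum => i _.
  rewrite coef_map exprS -[1 : int]add0r; apply: vgeM; first exact: vge_iota.
  rewrite -[1 : int]addr0; apply: vgeM; first by right; lia.
  by apply: vgeX; right; lia.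
case=> [/eqP|]; last by rewrite ord_iota.
by rewrite fmorph_eq0 -rootE (negbTE q0).
Qed.

Hypothesis ff : function_field iota.

Lemma constant_ord0 P w : w != 0 -> rr_space [::] [::] w -> P w = 0.
Proof.
move=> w0 hw; have Pge Q : 0 <= Q w by apply: vge_ord => //; have := hw Q; rewrite /= subrr.
have [aw|/(pole_exists ff)[Q]] := pselect (algebraicOver iota w); last first.
  by rewrite ltNge Pge.
by apply/eqP; rewrite eq_le Pge algebraic_ord_le0.
Qed.

Lemma rr_step A B P : exists2 d,
  qdim iota (rr_space A B) (rr_space A (P :: B)) d & (d <= place_deg P)%N.
Proof.
have [p p0 p1] := uniformizer P.
pose m : int := (count_mem P A)%:Z - (count_mem P B)%:Z.
have [u u0 Pu] : exists2 u, u != 0 & P u = m.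
  have [mn|mn] := lerP 0 m.
    by exists (p ^+ `|m|); rewrite ?expf_neq0 // ordX p1 natz gez0_abs.
  exists (p ^+ `|m|)^-1; rewrite ?invr_eq0 ?expf_neq0 // ordV ordX p1 natz ltz0_abs //.
  by rewrite opprK.
apply: (qdim_sub (f := fun x => x * u) (rr_subspace _ _) (rr_subspace _ _)
  (vge_subspace P 0) (vge_subspace P 1) (qdim_residue ff P)) => [x hx|x y hx hy].
  have -> : 0 = (count_mem P B)%:Z - (count_mem P A)%:Z + P u by rewrite Pu /m; lia.
  by apply: vgeM; [apply: hx|right].
rewrite -mulrBl => h Q.
have [->|QP] := eqVneq Q P.
  move/(vge_mulr _ _ _ u0): h; rewrite Pu; apply: vge_le.
  by rewrite count_mem_cons eqxx add1n /m; lia.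
have -> : count_mem Q (P :: B) = count_mem Q B by rewrite /= eq_sym (negbTE QP).
by apply: vgeB; [apply: hx|apply: hy].
Qed.

Lemma rr_space_subr A B P : rr_space A (P :: B) `<=` rr_space A B.
Proof.
move=> z hz Q; apply: vge_le (hz Q); rewrite count_mem_cons; case: (P == Q); lia.
Qed.

Lemma rr_space_cons2 A B P : rr_space (P :: A) (P :: B) = rr_space A B.
Proof. by apply: rr_space_eq => Q; rewrite !count_mem_cons; case: (P == Q); lia. Qed.

Hypothesis place0 : place iota.

Lemma ell_exists A B : exists d, qdim iota (rr_space A B) [set 0] d.
Proof.
suff H : exists d, qdim iota (rr_space A [::]) [set 0] d.
  have [d dP] := H.
  have [||d'] := qdim_sub (f := id) (rr_subspace A B) zero_subspace
    (rr_subspace A [::]) zero_subspace dP.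
  - by move=> x hx Q; apply: vge_le (hx Q) => /=; lia.
  - by [].
  by exists d'.
elim: A => [|P A [d dP]].
  have [||d] := qdim_sub (f := id) (rr_subspace [::] [::]) zero_subspace
    (vge_subspace place0 0) (vge_subspace place0 1) (qdim_residue ff place0).
  - by move=> x hx; have := hx place0; rewrite /= subrr.
  - move=> x y hx hy [/= -> //|].
    have [->//|xy0] := eqVneq (x - y) 0.
    rewrite (constant_ord0 _ xy0) //; by case: (rr_subspace [::] [::]) => _ h _; apply: h.
  by exists d.
have [e eP _] := rr_step (P :: A) [::] P.
exists (e + d)%N; apply: (qdim_add (W := rr_space A [::])) => //; try exact: rr_subspace.
- exact: zero_subspace.
- by rewrite -(rr_space_cons2 A [::] P); apply: rr_space_subr.
- by move=> _ /= -> Q; apply: vge0.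
- by rewrite -(rr_space_cons2 A [::] P).
Qed.

Lemma ellP A B : qdim iota (rr_space A B) [set 0] (ell A B).
Proof. by rewrite /ell; apply: (xgetPex 0%N (ell_exists A B)). Qed.

Lemma ell_card A B (T : finType) (s : T -> K) :
  (forall t, rr_space A B (s t)) -> injective s -> (#|T| <= #|F| ^ ell A B)%N.
Proof.
move=> hs is_; apply: (incongruent_card_le (rr_subspace A B) zero_subspace (ellP A B)).
by split=> // t u /= /eqP; rewrite subr_eq0 => /eqP /is_.
Qed.

Lemma ell_consr A B P : (ell A B <= ell A (P :: B) + place_deg P)%N.
Proof.
have [d dP dle] := rr_step A B P.
suff -> : ell A B = (d + ell A (P :: B))%N by lia.
apply: (qdim_unique (rr_subspace A B) zero_subspace (ellP A B)).
apply: qdim_add dP (ellP _ _); try exact: rr_subspace.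
- exact: zero_subspace.
- exact: rr_space_subr.
- by move=> _ /= -> Q; apply: vge0.
Qed.

Lemma ell_eq A B A' B' :
  (forall P, (count_mem P A)%:Z - (count_mem P B)%:Z =
             (count_mem P A')%:Z - (count_mem P B')%:Z) -> ell A B = ell A' B'.
Proof. by move=> h; rewrite /ell (rr_space_eq h). Qed.

Lemma ell_consl A B P : (ell (P :: A) B <= ell A B + place_deg P)%N.
Proof.
have -> : ell A B = ell (P :: A) (P :: B) by apply: ell_eq => Q; rewrite !count_mem_cons; case: (P == Q); lia.
exact: ell_consr.
Qed.

Lemma ell_catl A B C : (ell (C ++ A) B <= ell A B + ldeg C)%N.
Proof.
elim: C => [|P C IH]; first by rewrite /ldeg big_nil addn0.
by have := ell_consl (C ++ A) B P; rewrite ldeg_cons /=; lia.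
Qed.

Lemma ell_catr A B C : (ell A B <= ell A (C ++ B) + ldeg C)%N.
Proof.
elim: C => [|P C IH]; first by rewrite /ldeg big_nil addn0.
by have := ell_consr A (C ++ B) P; rewrite ldeg_cons /=; lia.
Qed.

Lemma ell_gt0 A B : (0 < ell A B)%N -> exists2 w, w != 0 & rr_space A B w.
Proof.
move=> l0; apply: contrapT => nw.
suff : ell A B = 0%N by lia.
apply: (qdim_unique (rr_subspace A B) zero_subspace (ellP A B)).
have -> : rr_space A B = [set 0]; last exact/qdim_refl/zero_subspace.
apply/seteqP; split=> [w hw|_ ->]; last by case: (rr_subspace A B).
by apply/eqP; apply: contrapT => /negP w0; apply: nw; exists w.
Qed.

Definition zdiv z : seq (place iota) :=
  xget [::] [set A | forall P, (count_mem P A)%:Z = Num.max 0 (P z)].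

Lemma zdivP z P : z != 0 -> (count_mem P (zdiv z))%:Z = Num.max 0 (P z).
Proof.
by move=> z0; have := xgetPex [::] (zero_divisor_ex ff z0); rewrite /= -/(zdiv z); apply.
Qed.

Lemma zdiv_sub z P : z != 0 ->
  (count_mem P (zdiv z))%:Z - (count_mem P (zdiv z^-1))%:Z = P z.
Proof.
move=> z0; rewrite !zdivP ?invr_eq0 // ordV.
by case: (lerP 0 (P z)) => h; case: (lerP 0 (- P z)) => h'; lia.
Qed.

Lemma rr_space_mulr A B x z : z != 0 ->
  rr_space A B x -> rr_space (A ++ zdiv z^-1) (B ++ zdiv z) (x * z).
Proof.
move=> z0 hx P; have := zdiv_sub P z0; rewrite !count_cat !PoszD.
move=> h; apply: (@vge_le _ _ _ _ _ ((count_mem P B)%:Z - (count_mem P A)%:Z + P z)).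
  by lia.
by apply: vgeM; [apply: hx|right].
Qed.

Lemma ell_equiv A B z : z != 0 -> ell (A ++ zdiv z^-1) (B ++ zdiv z) = ell A B.
Proof.
move=> z0.
have q1 : (1 < #|F|)%N by exact: card_finNzRing_gt1.
have le A' B' y : y != 0 -> (ell A' B' <= ell (A' ++ zdiv y^-1) (B' ++ zdiv y))%N.
  move=> y0; have [s [r [[sv is_] _]]] := qdim_family (rr_subspace A' B') zero_subspace (ellP A' B').
  rewrite -(leq_exp2l _ _ q1).
  have <- : #|{: 'rV[F]_(ell A' B')}| = (#|F| ^ ell A' B')%N by rewrite card_mx mul1n.
  apply: (ell_card (s := fun c => s c * y)) => [c|c c' /(mulIf y0) e]; first exact: rr_space_mulr.
  by apply: is_; rewrite /= e subrr.
apply/eqP; rewrite eqn_leq (le _ _ _ z0) andbT.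
have z0' : z^-1 != 0 by rewrite invr_eq0.
apply: leq_trans (le _ _ _ z0') _; rewrite invrK.
by rewrite (ell_eq (A' := A) (B' := B)) // => P; rewrite !count_cat !PoszD; lia.
Qed.

(* The residue ring modulo the zero divisor of [z] has dimension [ldeg (zdiv z)], and lifts of
   it combined with the powers [z ^ j], [j < l], are independent elements of the space below. *)
Lemma ell_growth z : z != 0 -> exists C, forall l,
  (l * ldeg (zdiv z) <= ell (C ++ flatten (nseq l (zdiv z^-1))) [::])%N.
Proof.
move=> z0; pose S := undup (zdiv z).
have zS P : P \in zdiv z -> P \in S by rewrite mem_undup.
have Sz P : P \in S -> 0 < P z.
  rewrite mem_undup -has_pred1 has_count -ltz_nat zdivP // lt_max ltxx.
  by [].
pose R := semilocal S [::].
have dim := semilocal_dim ff zS; rewrite -/R in dim.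
have [s [r [[sv is_] _]]] :=
  qdim_family (semilocal_subspace S [::]) (semilocal_subspace S (zdiv z)) dim.
have is' : incongruent R [set x | exists2 w, R w & x = z * w] s.
  split=> // c c' [w hw E]; apply: is_; rewrite E => P PS.
  rewrite -[X in vge P X]addr0; apply: vgeM; last exact: hw.
  by right; rewrite zdivP // max_r // ltW // Sz.
have sR : subring_set R.
  split=> [P _|x y hx hy P PS|x y hx hy P PS]; first exact: vge1.
    by apply: vgeB; [apply: hx|apply: hy].
  by rewrite -[X in vge P X]addr0; apply: vgeM; [apply: hx|apply: hy].
have Rz : R z by move=> P PS; right; rewrite /= ltW // Sz.
have inj := combinations_inj sR Rz z0 is'.
pose C := flatten [seq zdiv (s c)^-1 | c <- enum {: 'rV[F]_(ldeg (zdiv z))}].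
have sC c : rr_space C [::] (s c).
  move=> P; have [->|s0] := eqVneq (s c) 0; first exact: vge0.
  right; rewrite sub0r.
  have : (count_mem P (zdiv (s c)^-1) <= count_mem P C)%N.
    rewrite /C count_flatten -map_comp.
    have : c \in enum {: 'rV[F]_(ldeg (zdiv z))} by rewrite mem_enum.
    elim: (enum _) => // d e IH; rewrite inE /= => /predU1P[->|/IH]; first exact: leq_addr.
    by move/leq_trans; apply; apply: leq_addl.
  rewrite -lez_nat zdivP ?invr_eq0 // ordV ge_max => /andP[_].
  by rewrite lerNl.
exists C => l.
have q1 : (1 < #|F|)%N by exact: card_finNzRing_gt1.
rewrite -(leq_exp2l _ _ q1) mulnC expnM.
have <- : #|{ffun 'I_l -> 'rV[F]_(ldeg (zdiv z))}| = ((#|F| ^ ldeg (zdiv z)) ^ l)%N.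
  by rewrite card_ffun card_ord card_mx mul1n.
apply: (ell_card _ (inj l)) => c.
have [R0 _ _] := rr_subspace (C ++ flatten (nseq l (zdiv z^-1))) [::].
apply: (big_ind (rr_space _ _)) => // [x y hx hy|j _].
  exact: subspace_add (rr_subspace _ _) hx hy.
move=> P; rewrite count_cat count_flatten_nseq PoszD /= sub0r opprD.
apply: vgeM; first by have := sC (c j) P; rewrite /= sub0r.
right; rewrite ordX -mulr_natl natz PoszM zdivP ?invr_eq0 // ordV.
have := ltn_ord j; case: (lerP 0 (- P z)) => h; nia.
Qed.

Lemma ldeg_zeros_le z : z != 0 -> (ldeg (zdiv z) <= ldeg (zdiv z^-1))%N.
Proof.
move=> z0; have [C CP] := ell_growth z0.
have q1 : (1 < #|F|)%N by exact: card_finNzRing_gt1.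
rewrite -(leq_exp2l _ _ q1).
apply: (@geometric_rate_le _ _ (#|F| ^ (ell [::] [::] + ldeg C))).
  by rewrite expn_gt0 ltnW.
move=> l; rewrite -!expnM -expnD leq_exp2l //.
have := ell_catl [::] [::] (C ++ flatten (nseq l (zdiv z^-1))).
have := CP l; rewrite cats0 ldeg_cat ldeg_flatten_nseq; lia.
Qed.

Lemma ldeg_zeros_poles z : z != 0 -> ldeg (zdiv z) = ldeg (zdiv z^-1).
Proof.
move=> z0; apply/eqP; rewrite eqn_leq ldeg_zeros_le //=.
by have := @ldeg_zeros_le z^-1; rewrite invrK invr_eq0; apply.
Qed.

Definition defect A B : int := (ldeg A)%:Z - (ldeg B)%:Z - (ell A B)%:Z.

Lemma ldeg_perm A B : perm_eq A B -> ldeg A = ldeg B.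
Proof. by move=> h; apply: perm_big. Qed.

Lemma defect_eq A B A' B' :
  (forall P, (count_mem P A)%:Z - (count_mem P B)%:Z =
             (count_mem P A')%:Z - (count_mem P B')%:Z) -> defect A B = defect A' B'.
Proof.
move=> h; rewrite /defect (ell_eq h).
have : ldeg (A ++ B') = ldeg (A' ++ B).
  by apply/ldeg_perm/perm_eq_count => P; have := h P; rewrite !count_cat; lia.
rewrite !ldeg_cat; lia.
Qed.

Lemma count_le_perm A B : (forall P, count_mem P A <= count_mem P B)%N ->
  exists C, perm_eq B (A ++ C).
Proof.
move=> h; have [C CP] := seq_of_multiplicity
  (fun P => count_mem P B - count_mem P A)%N (undup_uniq B).
exists C; apply: perm_eq_count => P; rewrite count_cat CP mem_undup.
case: ifP => [_|/negbT/count_memPn PB]; first by have := h P; lia.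
by have := h P; rewrite PB; lia.
Qed.

Lemma defect_mono A B A' B' :
  (forall P, (count_mem P A)%:Z - (count_mem P B)%:Z <=
             (count_mem P A')%:Z - (count_mem P B')%:Z) -> defect A B <= defect A' B'.
Proof.
move=> h; have [|C CP] := @count_le_perm (A ++ B') (A' ++ B).
  by move=> P; have := h P; rewrite !count_cat; lia.
have -> : defect A B = defect (A ++ B') (B ++ B').
  by apply: defect_eq => P; rewrite !count_cat !PoszD; lia.
have -> : defect A' B' = defect (C ++ (A ++ B')) (B ++ B').
  apply: defect_eq => P; have /permP/(_ (pred1 P)) := CP.
  by rewrite !count_cat !PoszD; lia.
by rewrite /defect !ldeg_cat; have := ell_catl (A ++ B') (B ++ B') C; lia.
Qed.

Lemma defect_equiv A B z : z != 0 -> defect (A ++ zdiv z^-1) (B ++ zdiv z) = defect A B.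
Proof.
by move=> z0; rewrite /defect ell_equiv // !ldeg_cat (ldeg_zeros_poles z0); lia.
Qed.

Lemma defect_bounded : exists M : int, forall A B, defect A B <= M.
Proof.
have [p p0 p1] := uniformizer place0.
have [C CP] := ell_growth p0.
have dz : (0 < ldeg (zdiv p))%N.
  have : place0 \in zdiv p by rewrite -has_pred1 has_count -ltz_nat zdivP // p1.
  by move/perm_to_rem/ldeg_perm ->; rewrite ldeg_cons ltn_addr // place_deg_gt0.
exists (ldeg C)%:Z => A B.
apply: (@le_trans _ _ (defect A [::])).
  by apply: defect_mono => P /=; lia.
pose l := (ldeg A).+1; pose D := C ++ flatten (nseq l (zdiv p^-1)).
have [|w w0 hw] := @ell_gt0 D A.
  have := ell_catr D [::] A; rewrite cats0.
  have := CP l; rewrite -/D /l; nia.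
rewrite -(defect_equiv _ _ w0).
apply: (@le_trans _ _ (defect D [::])); last first.
  rewrite /defect /D ldeg_cat ldeg_flatten_nseq -(ldeg_zeros_poles p0).
  by have := CP l; rewrite /ldeg big_nil; lia.
apply: defect_mono => P /=; have := zdiv_sub P w0.
by have := vge_ord w0 (hw P); rewrite !count_cat /=; lia.
Qed.

Lemma riemann : exists (g : int) (n0 : int), forall A B,
  n0 <= (ldeg A)%:Z - (ldeg B)%:Z -> (ell A B)%:Z = (ldeg A)%:Z - (ldeg B)%:Z - g.
Proof.
have [M MP] := defect_bounded.
pose d0 := defect [::] [::].
pose good n := `[< exists A B, defect A B = n%:Z + d0 >].
have ex : exists n, good n by exists 0%N; apply/asboolP; exists [::], [::]; rewrite add0r.
have ub n : good n -> (n <= `|M - d0|)%N.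
  by move=> /asboolP[A [B AB]]; have := MP A B; lia.
have [n /asboolP[A0 [B0 AB0]] nmax] := ex_maxnP ex ub.
have gmax A B : defect A B <= defect A0 B0.
  have [le|lt] := lerP d0 (defect A B); last by lia.
  have /nmax : good `|defect A B - d0|%N by apply/asboolP; exists A, B; lia.
  by lia.
exists (defect A0 B0), ((ldeg A0)%:Z - (ldeg B0)%:Z + defect A0 B0 + 1) => A B degAB.
suff : defect A B = defect A0 B0 by rewrite {1}/defect; lia.
apply/eqP; rewrite eq_le gmax /=.
have [|w w0 hw] := @ell_gt0 (A ++ B0) (B ++ A0).
  have := gmax (A ++ B0) (B ++ A0); rewrite {1}/defect !ldeg_cat; lia.
have w0' : w^-1 != 0 by rewrite invr_eq0.
rewrite -(defect_equiv A B w0') invrK; apply: defect_mono => P.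
have := zdiv_sub P w0.
by have := vge_ord w0 (hw P); rewrite !count_cat /=; lia.
Qed.

End RiemannSpaces.

(** * Effective divisors *)

Section EffectiveDivisors.
Variables (F : finFieldType) (K : fieldType) (iota : {rmorphism F -> K}).
Implicit Types (P Q : place iota) (A B : effdiv iota) (S : seq (place iota)).

Lemma effdiv_deg_ldeg A : effdiv_deg A = ldeg (enum_mset A).
Proof. by rewrite /ldeg sum_mset. Qed.

Lemma effdiv_degD A B : effdiv_deg (msetD A B) = (effdiv_deg A + effdiv_deg B)%N.
Proof.
rewrite !effdiv_deg_ldeg -ldeg_cat; apply/ldeg_perm/perm_eq_count => P.
by rewrite count_cat !count_mem_mset !msetE2.
Qed.

Lemma effdiv_deg_msetn h P : effdiv_deg (msetn h P : effdiv iota) = (h * place_deg P)%N.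
Proof.
rewrite effdiv_deg_ldeg enum_msetn /ldeg big_nseq.
by elim: h => //= h ->; rewrite mulSn.
Qed.

Lemma effdiv_deg0 : effdiv_deg (mset0 : effdiv iota) = 0%N.
Proof. by rewrite effdiv_deg_ldeg enum_mset0 /ldeg big_nil. Qed.

Hypothesis ff : function_field iota.

Lemma low_degree_places n : exists S, forall P, (place_deg P <= n)%N -> P \in S.
Proof.
have [x [tx _]] := ff.
have nroot (p : {poly F}) : p != 0 -> (map_poly iota p).[x] != 0.
  by move=> p0; apply/eqP => px; apply: tx; exists p => //; apply/rootP.
have x0 : x != 0 by have := nroot 'X; rewrite -size_poly_eq0 size_polyX map_polyX hornerX; apply.
pose m := (#|F| ^ n)%N.
exists (zdiv iota x^-1 ++ flatten [seq zdiv iota (x ^+ (ij : 'I_m.+1 * 'I_m.+1).1 - x ^+ ij.2) |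
   ij <- enum {: 'I_m.+1 * 'I_m.+1}]) => P Pn.
have inz z : z != 0 -> 0 < P z -> P \in zdiv iota z.
  by move=> z0 Pz; rewrite -has_pred1 has_count -ltz_nat (zdivP ff) // lt_max Pz orbT.
rewrite mem_cat; apply/orP; have [Px|Px] := ltP (P x) 0.
  by left; apply: inz; rewrite ?invr_eq0 // ordV oppr_gt0.
right; apply/flattenP.
have [i [j [ij Pij]]] : exists i j : 'I_m.+1, i != j /\ vge P 1 (x ^+ i - x ^+ j).
  apply: contrapT => nij.
  have := incongruent_card_le (s := fun i : 'I_m.+1 => x ^+ i) (vge_subspace P 0)
    (vge_subspace P 1) (qdim_residue ff P).
  rewrite card_ord => H.
  have : (m.+1 <= m)%N.
    apply: leq_trans (H _) _; last by rewrite leq_exp2l // card_finNzRing_gt1.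
    split=> [i|i j Pij]; first by apply: vgeX; right.
    by apply/eqP; apply: contrapT => /negP ij; apply: nij; exists i, j.
  by rewrite ltnn.
exists (zdiv iota (x ^+ i - x ^+ j)).
  by apply/mapP; exists (i, j) => //; rewrite mem_enum.
have z0 : x ^+ i - x ^+ j != 0.
  have /nroot : 'X^i - 'X^j != 0 :> {poly F}.
    rewrite subr_eq0; apply/eqP => /(congr1 (fun p : {poly F} => p`_i)).
    rewrite !coefXn eqxx (_ : ((i : nat) == j) = false); last exact/negbTE.
    by move/eqP; rewrite oner_eq0.
  by rewrite rmorphB /= !map_polyXn hornerD hornerN !hornerXn.
by apply: inz => //; have := vge_ord z0 Pij; lia.
Qed.

Lemma finite_effdiv n : finite_set [set A : effdiv iota | effdiv_deg A = n].
Proof.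
have [S SP] := low_degree_places n.
have lists k : exists L : seq (seq (place iota)),
    forall s, (size s <= k)%N -> {subset s <= S} -> s \in L.
  elim: k => [|k [L LP]]; first by exists [:: [::]] => [[]].
  exists ([::] :: [seq P :: s | P <- S, s <- L]) => -[|P s] //= sk sub.
  rewrite inE; apply/orP; right; apply/allpairsP; exists (P, s); split=> //=.
    by apply: sub; rewrite inE eqxx.
  by apply: LP => // Q Qs; apply: sub; rewrite inE Qs orbT.
have [L LP] := lists n.
apply: (sub_finite_set _ (finite_seq [seq seq_mset s : effdiv iota | s <- L])).
move=> A /= An; apply/mapP; exists (enum_mset A); last by rewrite seq_mset_id.
have degP P : P \in enum_mset A -> (place_deg P <= n)%N.
  by move=> PA; rewrite -An effdiv_deg_ldeg (ldeg_perm (perm_to_rem PA)) ldeg_cons leq_addr.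
apply: LP => [|P /degP/SP //].
rewrite -An effdiv_deg_ldeg /ldeg -sum1_size; apply: leq_sum => P _.
exact: place_deg_gt0.
Qed.

Definition effn n : seq (effdiv iota) := fset_set [set A : effdiv iota | effdiv_deg A = n].

Lemma mem_effn n A : (A \in effn n) = (effdiv_deg A == n).
Proof.
rewrite /effn in_fset_set; last exact: finite_effdiv.
by apply/idP/idP => [/set_mem /eqP|/eqP h]; rewrite ?inE.
Qed.

Lemma effn_uniq n : uniq (effn n). Proof. exact: fset_uniq. Qed.

Definition prime_weight A : nat :=
  xget 0%N [set m | exists P h, [/\ (0 < h)%N, A = msetn h P & m = place_deg P]].

Lemma msetn_inj h k P Q : (0 < h)%N ->
  msetn h P = msetn k Q :> effdiv iota -> h = k /\ P = Q.
Proof.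
move=> h0 E; have : msetn h P P = msetn k Q P by rewrite E.
by rewrite msetnxx msetnE; case: eqP => [->|_] hk; rewrite hk // in h0.
Qed.

Lemma prime_weight_msetn h P : (0 < h)%N -> prime_weight (msetn h P) = place_deg P.
Proof.
move=> h0; rewrite /prime_weight; case: xgetP => [m _ [Q [k [k0 E ->]]]|/(_ (place_deg P))].
  by have [_ ->] := msetn_inj h0 E.
by case; exists P, h.
Qed.

Lemma prime_weight_neq0 A : prime_weight A != 0%N -> exists P h, (0 < h)%N /\ A = msetn h P.
Proof.
rewrite /prime_weight; case: xgetP => [m _ [P [h [h0 E _]]] _|]; first by exists P, h.
by [].
Qed.

Let prime_powers A : seq (effdiv iota) :=
  [seq (msetn h P : effdiv iota) | P <- finsupp A, h <- seq.iota 1 (A P)].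

Let prime_powersP A B :
  reflect (exists P h, [/\ (0 < h)%N, (h <= A P)%N & B = msetn h P]) (B \in prime_powers A).
Proof.
apply: (iffP idP) => [/allpairsPdep[P [h [_ + ->]]]|[P [h [h0 hA ->]]]].
  by rewrite mem_iota add1n ltnS => /andP[h0 hA]; exists P, h.
apply/allpairsPdep; exists P, h; split=> //; last by rewrite mem_iota add1n ltnS h0.
by rewrite msuppE in_mset (leq_trans h0).
Qed.

Let prime_powers_uniq A : uniq (prime_powers A).
Proof.
apply: allpairs_uniq_dep => [|P _|[P h] [Q k] /=]; first exact: fset_uniq.
  exact: iota_uniq.
move=> /allpairsPdep[P' [h' [_ + [-> ->]]]] _ E.
rewrite mem_iota => /andP[h0 _].
by have [-> ->] := msetn_inj h0 E.
Qed.

Lemma sum_prime_weight A n : (effdiv_deg A <= n)%N ->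
  effdiv_deg A = (\sum_(k < n.+1) \sum_(B <- effn k | msubset B A) prime_weight B)%N.
Proof.
move=> An.
have wpp B : msubset B A ->
    prime_weight B = (\sum_(X <- prime_powers A) (X == B) * prime_weight X)%N.
  move=> BA; have [Bp|nBp] := boolP (B \in prime_powers A).
    rewrite (bigD1_seq B) //= eqxx mul1n big1 ?addn0 // => X XB.
    by rewrite (negbTE XB).
  rewrite big_seq big1 => [|X Xp]; last first.
    by case: eqP => // XB; rewrite -XB Xp in nBp.
  apply/eqP; apply: contraNT nBp => /prime_weight_neq0[P [h [h0 E]]].
  apply/prime_powersP; exists P, h; split=> //.
  by move/msubsetP/(_ P): BA; rewrite E msetnxx.
under eq_bigr => k _ do under eq_bigr => B BA do rewrite wpp //.
under eq_bigr => k _ do rewrite exchange_big.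
rewrite exchange_big /=.
have inner X : X \in prime_powers A ->
    (\sum_(k < n.+1) \sum_(B <- effn k | msubset B A) (X == B) * prime_weight X)%N = prime_weight X.
  move=> /prime_powersP[P [h [h0 hA E]]].
  have XA : msubset X A.
    by apply/msubsetP => Q; rewrite E msetnE; case: eqP => [->|].
  have Xn : (effdiv_deg X < n.+1)%N.
    by rewrite ltnS; apply: leq_trans An; rewrite -(msetBDKC XA) effdiv_degD leq_addr.
  rewrite (bigD1 (Ordinal Xn)) //= [X in (_ + X)%N]big1 ?addn0 => [|k kX].
    rewrite big_mkcond (bigD1_seq X) ?effn_uniq ?mem_effn //= XA eqxx mul1n big1 ?addn0 //.
    by move=> B BX; rewrite eq_sym (negbTE BX) mul0n; case: ifP.
  rewrite big_seq_cond big1 // => B /andP[+ _]; rewrite mem_effn => /eqP Bk.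
  case: eqP => // XB; move: kX; rewrite -val_eqE /= -Bk XB eqxx //.
rewrite (eq_big_seq _ inner) /prime_powers big_allpairs_dep /=.
apply: eq_bigr => P _; rewrite (eq_big_seq (fun=> place_deg P)).
  by rewrite big_const_seq count_predT size_iota iter_addn_0 mulnC.
by move=> h; rewrite mem_iota => /andP[h0 _]; rewrite prime_weight_msetn.
Qed.

Definition eff_count n := size (effn n).
Definition prime_count n := (\sum_(A <- effn n) prime_weight A)%N.

Lemma eff_count0 : eff_count 0 = 1%N.
Proof.
have : perm_eq (effn 0) [:: mset0].
  apply: uniq_perm; rewrite ?effn_uniq // => A; rewrite mem_effn inE.
  apply/eqP/eqP => [|->]; last exact: effdiv_deg0.
  rewrite effdiv_deg_ldeg => A0; rewrite -[A]seq_mset_id.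
  case: (enum_mset A) A0 => [|P s]; last by rewrite ldeg_cons; have := place_deg_gt0 ff P; lia.
  by move=> _; apply/msetP => P; rewrite mset_seqE mset0E.
by move/perm_size.
Qed.

Lemma effn_sub_card B n k : effdiv_deg B = k -> (k <= n)%N ->
  size [seq A <- effn n | msubset B A] = eff_count (n - k).
Proof.
move=> Bk kn; rewrite /eff_count -(size_map (fun A : effdiv iota => msetD B A : effdiv iota)).
apply: perm_size; apply: uniq_perm; first exact/filter_uniq/effn_uniq.
  rewrite map_inj_uniq ?effn_uniq // => A C E; apply/msetP => P.
  by have := congr1 (fun D : effdiv iota => D P) E; rewrite !msetE2 => /addnI.
move=> A; rewrite mem_filter mem_effn; apply/andP/mapP => [[BA /eqP An]|[C CP ->]].
  exists (msetB A B : effdiv iota); last by rewrite msetBDKC.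
  rewrite mem_effn -(eqn_add2l k) -{1}Bk -effdiv_degD msetBDKC //.
  by rewrite An subnKC.
move: CP; rewrite mem_effn effdiv_degD Bk => /eqP ->; rewrite subnKC // eqxx; split=> //.
by apply/msubsetP => P; rewrite msetE2 leq_addr.
Qed.

Lemma eff_count_prime_count n :
  (n * eff_count n = \sum_(k < n.+1) prime_count k * eff_count (n - k))%N.
Proof.
have -> : (n * eff_count n = \sum_(A <- effn n) effdiv_deg A)%N.
  rewrite (eq_big_seq (fun=> n)) ?big_const_seq ?count_predT ?iter_addn_0 //.
  by move=> A; rewrite mem_effn => /eqP.
rewrite (eq_big_seq (fun A => \sum_(k < n.+1) \sum_(B <- effn k | msubset B A) prime_weight B)%N);
  last by move=> A; rewrite mem_effn => /eqP An; apply: sum_prime_weight; rewrite An.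
rewrite exchange_big; apply: eq_bigr => k _ /=.
rewrite (exchange_big_dep xpredT) //= /prime_count big_distrl /=.
apply: eq_big_seq => B; rewrite mem_effn => /eqP Bk.
rewrite -(effn_sub_card Bk) ?leq_ord // -sum1_size big_filter big_distrr /=.
by apply: eq_bigr => A _; rewrite muln1.
Qed.

Lemma prime_count0 : prime_count 0 = 0%N.
Proof.
rewrite /prime_count big_seq big1 // => A; rewrite mem_effn => /eqP A0.
apply/eqP; apply: contrapT => /negP /prime_weight_neq0 [P [h [h0 E]]].
by move: A0; rewrite E effdiv_deg_msetn; have := place_deg_gt0 ff P; nia.
Qed.

Lemma prime_count_le n : (prime_count n <= n * eff_count n)%N.
Proof.
by rewrite eff_count_prime_count big_ord_recr /= subnn eff_count0 muln1 leq_addl.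
Qed.

End EffectiveDivisors.

Section LinearSystems.
Variables (F : finFieldType) (K : fieldType) (iota : {rmorphism F -> K}).
Implicit Types (P Q : place iota) (A B : seq (place iota)) (D E : effdiv iota).
Hypotheses (ff : function_field iota) (place0 : place iota).

Lemma count_seq_mset A P : count_mem P (enum_mset (seq_mset A : effdiv iota)) = count_mem P A.
Proof. by have /permP := perm_eq_seq_mset A; apply. Qed.

Lemma effdiv_eq D E :
  (forall P, count_mem P (enum_mset D) = count_mem P (enum_mset E)) -> D = E.
Proof. by move=> h; apply/msetP => P; rewrite -!count_mem_mset; apply: h. Qed.

Definition linearly_equivalent A B D :=
  `[< exists2 z, z != 0 & forall P, P z = (count_mem P (enum_mset D))%:Z + (count_mem P B)%:Z - (count_mem P A)%:Z >].

Lemma linearly_equivalent_deg A B D : linearly_equivalent A B D ->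
  (effdiv_deg D)%:Z = (ldeg A)%:Z - (ldeg B)%:Z.
Proof.
move=> /asboolP[z z0 zP].
have : ldeg (enum_mset D ++ B ++ zdiv iota z^-1) = ldeg (A ++ zdiv iota z).
  apply/ldeg_perm/perm_eq_count => P; rewrite !count_cat.
  by have := zdiv_sub ff P z0; have := zP P; lia.
by rewrite !ldeg_cat (ldeg_zeros_poles ff place0 z0) effdiv_deg_ldeg; lia.
Qed.

Let q1 : (1 < #|F|)%N. Proof. exact: card_finNzRing_gt1. Qed.

Lemma rr_section A B : exists (s : 'rV[F]_(ell A B) -> K) (r : K -> 'rV[F]_(ell A B)),
  [/\ forall c, rr_space A B (s c), cancel s r & forall x, rr_space A B x -> s (r x) = x].
Proof.
have [s [r [[sv is_] rP]]] := qdim_family (rr_subspace A B) (zero_subspace iota) (ellP ff place0 A B).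
have sr x : rr_space A B x -> s (r x) = x.
  by move=> /rP /= /eqP; rewrite subr_eq0 => /eqP.
exists s, r; split=> // c; apply: is_; by rewrite /= sr // subrr.
Qed.

Lemma card_nonzero_section A B (s : 'rV[F]_(ell A B) -> K) r :
  (forall c, rr_space A B (s c)) -> cancel s r ->
  (forall x, rr_space A B x -> s (r x) = x) ->
  #|[set c | s c != 0]%SET| = (#|F| ^ ell A B - 1)%N.
Proof.
move=> sP sK rK; have s0 : s (r 0) = 0 by apply: rK; case: (rr_subspace A B).
have -> : [set c | s c != 0]%SET = [set~ r 0]%SET.
  apply/setP => c; rewrite !inE; congr (~~ _); apply/eqP/eqP => [|->] //.
  by move=> <-; rewrite sK.
by rewrite cardsC1 card_mx mul1n subn1.
Qed.

(* Each member of the linear system of [A - B] is the divisor of as many sections as there are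
   nonzero constants. *)
Lemma linear_system_card A B n : n%:Z = (ldeg A)%:Z - (ldeg B)%:Z ->
  (size [seq D <- effn iota n | linearly_equivalent A B D] *
     (#|F| ^ ell (iota := iota) [::] [::] - 1) =
   #|F| ^ ell A B - 1)%N.
Proof.
move=> nAB.
have [s [r [sP sK rK]]] := rr_section A B.
have [s0 [r0 [s0P s0K r0K]]] := rr_section [::] [::].
rewrite -(card_nonzero_section sP sK rK) -(card_nonzero_section s0P s0K r0K).
set Y := [set c | s c != 0]%SET; set Y0 := [set c | s0 c != 0]%SET.
set lin := [seq D <- effn iota n | _].
have /choice [d dP] : forall c, exists D : effdiv iota, s c != 0 ->
    forall P, P (s c) = (count_mem P (enum_mset D))%:Z + (count_mem P B)%:Z - (count_mem P A)%:Z.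
  move=> c; have [->|c0] := eqVneq (s c) 0; first by exists mset0.
  have [|C CP] := @count_le_perm _ _ iota (B ++ zdiv iota (s c)^-1) (A ++ zdiv iota (s c)).
    move=> P; rewrite !count_cat; have := zdiv_sub ff P c0.
    by have := vge_ord c0 (sP c P); lia.
  exists (seq_mset C) => _ P; rewrite count_seq_mset.
  have := zdiv_sub ff P c0; have /permP/(_ (pred1 P)) := CP; rewrite !count_cat; lia.
have dlin c : c \in Y -> d c \in lin.
  rewrite inE => c0; have h : linearly_equivalent A B (d c).
    by apply/asboolP; exists (s c) => //; apply: dP.
  by rewrite mem_filter h /= mem_effn // -eqz_nat (linearly_equivalent_deg h) nAB.
have ulin : uniq lin by apply/filter_uniq/effn_uniq.
have fiber D : D \in lin -> #|[set c in Y | d c == D]%SET| = #|Y0|.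
  rewrite mem_filter => /andP[/asboolP[z z0 zP] _].
  have zr : rr_space A B z by move=> P; right; rewrite zP; lia.
  pose f c := r (z * s0 c).
  have zs x : rr_space A B (z * s0 x).
    move=> P; rewrite -[X in vge P X]addr0; apply: vgeM; first exact: zr.
    by have := s0P x P; rewrite /= subrr.
  have fs x : s (f x) = z * s0 x by rewrite rK.
  have finj : injective f.
    move=> x y /(congr1 s); rewrite !fs => /(mulfI z0) /(congr1 r0).
    by rewrite !s0K.
  rewrite -(card_imset (mem Y0) finj); apply: eq_card => x; rewrite !inE.
  apply/andP/imsetP => [[x0 /eqP dx]|[y + ->]].
    have h : rr_space (iota := iota) [::] [::] (s x / z).
      move=> P; right; rewrite subrr ordM ?invr_eq0 // ordV.
      by have := zP P; have := dP x x0 P; rewrite dx => -> ->; rewrite subrr.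
    exists (r0 (s x / z)); first by rewrite inE r0K // mulf_neq0 // invr_eq0.
    by rewrite /f r0K // mulrC divfK // sK.
  rewrite inE => y0; have x0 : s (f y) != 0 by rewrite fs mulf_neq0.
  split=> //; apply/eqP/effdiv_eq => P.
  have := dP _ x0 P; rewrite fs ordM // zP (constant_ord0 ff P y0 (s0P _)); lia.
rewrite -[RHS]sum1_card.
rewrite [RHS](eq_bigr (fun c => \sum_(D <- lin) (d c == D) * 1)%N); last first.
  move=> c cY; rewrite (bigD1_seq (d c)) ?dlin //= eqxx muln1 big1 // => D Dc.
  by rewrite eq_sym (negbTE Dc).
rewrite exchange_big /= (eq_big_seq (fun=> #|Y0|)); last first.
  move=> D /fiber <-; rewrite -sum1_card [RHS]big_mkcond [LHS]big_mkcond /=.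
  by apply: eq_bigr => c _; rewrite !inE; case: (s c != 0); case: (d c == D).
by rewrite big_const_seq count_predT iter_addn_0 mulnC.
Qed.

Lemma eff_count_recurrence : exists (n0 e : nat), (0 < e)%N /\ forall k,
  (eff_count iota (n0 + k + place_deg place0) * (#|F| ^ (k + e) - 1) =
   eff_count iota (n0 + k) * (#|F| ^ (k + place_deg place0 + e) - 1))%N.
Proof.
have [g [m0 rP]] := riemann ff place0.
set d := place_deg place0.
pose n0 := (`|m0| + `|g| + 1)%N; pose e := `|n0%:Z - g|%N.
have e0 : (0 < e)%N by rewrite /e /n0; lia.
exists n0, e; split=> // k.
have wP : (0 < #|F| ^ ell (iota := iota) [::] [::] - 1)%N.
  rewrite subn_gt0 -{1}(expn0 #|F|) ltn_exp2l // lt0n; apply/eqP => l0.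
  have := ell_card ff place0 (A := [::]) (B := [::]) (s := fun a : F => iota a).
  rewrite l0 expn0 => H; move: q1; rewrite ltnNge H //; last exact: fmorph_inj.
  by move=> a P; rewrite /= subrr; apply: vge_iota.
set w := (_ - 1)%N in wP.
have ellE A B (n : nat) : n%:Z = (ldeg A)%:Z - (ldeg B)%:Z -> (n0 <= n)%N ->
    ell A B = (n - n0 + e)%N.
  move=> nAB nn; have h : m0 <= n%:Z by rewrite /n0 in nn; lia.
  by have := rP A B; rewrite -nAB => /(_ h) => E; rewrite /e; lia.
have count_up D : D \in effn iota (n0 + k) ->
    (size [seq D' <- effn iota (n0 + k + d) |
       linearly_equivalent (place0 :: enum_mset D) [::] D'] * w =
     #|F| ^ (k + d + e) - 1)%N.
  rewrite mem_effn // effdiv_deg_ldeg => /eqP Dn.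
  have h : (n0 + k + d)%:Z = (ldeg (place0 :: enum_mset D))%:Z - (ldeg (iota := iota) [::])%:Z.
    by rewrite ldeg_cons Dn /ldeg big_nil /d; lia.
  rewrite (linear_system_card h) (ellE _ _ _ h); last by lia.
  by congr (_ ^ _ - _)%N; lia.
have count_down D : D \in effn iota (n0 + k + d) ->
    (size [seq D' <- effn iota (n0 + k) |
       linearly_equivalent (enum_mset D) [:: place0] D'] * w = #|F| ^ (k + e) - 1)%N.
  rewrite mem_effn // effdiv_deg_ldeg => /eqP Dn.
  have h : (n0 + k)%:Z = (ldeg (enum_mset D))%:Z - (ldeg [:: place0])%:Z.
    by rewrite ldeg_cons Dn /ldeg big_nil /d; lia.
  rewrite (linear_system_card h) (ellE _ _ _ h); last by lia.
  by congr (_ ^ _ - _)%N; lia.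
have sym D D' : linearly_equivalent (place0 :: enum_mset D) [::] D' =
                linearly_equivalent (enum_mset D') [:: place0] D.
  apply/asboolP/asboolP => -[z z0 zP]; exists z^-1; rewrite ?invr_eq0 // => P;
  rewrite ordV zP !count_mem_cons /=; lia.
have sum_size (s1 s2 : seq (effdiv iota)) (R : rel (effdiv iota)) :
    (\sum_(D <- s1) size [seq D' <- s2 | R D D'] =
     \sum_(D' <- s2) size [seq D <- s1 | R D D'])%N.
  under eq_bigr => D _ do rewrite -sum1_size big_filter big_mkcond.
  rewrite exchange_big /=; apply: eq_bigr => D' _.
  by rewrite -big_mkcond -big_filter sum1_size.
have main := sum_size (effn iota (n0 + k)) (effn iota (n0 + k + d))
  (fun D D' => linearly_equivalent (place0 :: enum_mset D) [::] D').
have main_w : (\sum_(D <- effn iota (n0 + k)) (#|F| ^ (k + d + e) - 1) =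
   \sum_(D <- effn iota (n0 + k + d)) (#|F| ^ (k + e) - 1))%N.
  rewrite -(eq_big_seq _ count_up) -big_distrl /= main big_distrl /=.
  rewrite -(eq_big_seq _ count_down); apply: eq_bigr => D _.
  by congr (size _ * _)%N; apply: eq_filter => D'; rewrite sym.
move: main_w; rewrite !big_const_seq !count_predT !iter_addn_0 /eff_count => main_w.
by rewrite mulnC -main_w mulnC.
Qed.

End LinearSystems.

(** * Exponential sums *)

Section TruncatedSeries.
Variables (C : fieldType).
Implicit Types (p r s : {poly C}).

Definition eq_upto M p r := forall i, (i < M)%N -> p`_i = r`_i.

Lemma eq_uptoMl M s p r : eq_upto M p r -> eq_upto M (s * p) (s * r).
Proof.
move=> h i iM; rewrite !coefM; apply: eq_bigr => j _; congr (_ * _); apply: h.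
by rewrite (leq_ltn_trans _ iM) // leq_subr.
Qed.

Lemma eq_upto_trans M p r s : eq_upto M p r -> eq_upto M r s -> eq_upto M p s.
Proof. by move=> h1 h2 i iM; rewrite h1 ?h2. Qed.

Lemma eq_upto_sym M p r : eq_upto M p r -> eq_upto M r p.
Proof. by move=> h i iM; rewrite h. Qed.

Lemma eq_uptoD M p p' r r' : eq_upto M p r -> eq_upto M p' r' ->
  eq_upto M (p + p') (r + r').
Proof. by move=> h1 h2 i iM; rewrite !coefD h1 ?h2. Qed.

Lemma eq_uptoN M p r : eq_upto M p r -> eq_upto M (- p) (- r).
Proof. by move=> h i iM; rewrite !coefN h. Qed.

Lemma coef_Xderiv p i : ('X * p^`())`_i = p`_i *+ i.
Proof. by rewrite coefXM; case: i => [|i]; rewrite ?mulr0n // coef_deriv. Qed.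

Lemma eq_upto_Xderiv M p r : eq_upto M p r -> eq_upto M ('X * p^`()) ('X * r^`()).
Proof. by move=> h i iM; rewrite !coef_Xderiv h. Qed.

Lemma eq_upto_cancel M s p r : s`_0 = 1 -> eq_upto M (s * p) (s * r) -> eq_upto M p r.
Proof.
move=> s0 h i; elim/ltn_ind: i => i IH iM.
have := h i iM; rewrite !coefM !big_ord_recl /= s0 !mul1r !subn0.
rewrite [X in _ + X](eq_bigr (fun j : 'I_i => s`_(lift ord0 j) * r`_(i - lift ord0 j))).
  by move/addIr.
move=> j _; rewrite IH //; have := ltn_ord j; rewrite /= /bump /=; lia.
Qed.

Lemma geometric_log_deriv M (rs : seq C) :
  eq_upto M ((\prod_(a <- rs) (1 - a *: 'X)) * \sum_(a <- rs) \poly_(i < M) (if i == 0%N then 0 else a ^+ i))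
    (- ('X * (\prod_(a <- rs) (1 - a *: 'X))^`())).
Proof.
elim: rs => [|a rs IH]; first by rewrite !big_nil mulr0 derivC mulr0 oppr0.
rewrite !big_cons; set P := \prod_(_ <- _) _ in IH *; set S := \sum_(_ <- _) _ in IH *.
set G := \poly_(i < M) _.
rewrite derivM.
have -> : (1 - a *: 'X) * P * (G + S) = P * ((1 - a *: 'X) * G) + (1 - a *: 'X) * (P * S) by ring.
have -> : - ('X * ((1 - a *: 'X)^`() * P + (1 - a *: 'X) * P^`())) =
   P * (a *: 'X) + (1 - a *: 'X) * (- ('X * P^`())).
  by rewrite derivB derivZ derivX (derivC (1 : C)) -!mul_polyC; ring.
apply: eq_uptoD; last exact: eq_uptoMl.
apply: eq_uptoMl => i iM.
rewrite mulrBl mul1r coefB -scalerAl coefZ coefXM coefZ coefX !coef_poly iM.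
case: i iM => [|[|i]] iM /=; first by rewrite !mulr0 subr0.
  by rewrite (ltnW iM) mulr0 subr0 expr1 mulr1.
by rewrite (ltnW iM) mulr0 -exprS subrr.
Qed.

End TruncatedSeries.

Lemma poly_split_at0 (C : closedFieldType) (p : {poly C}) : p`_0 = 1 ->
  exists rs : seq C, p = \prod_(a <- rs) (1 - a *: 'X).
Proof.
move=> p0; have [r pr] := closed_field_poly_normal p.
have r0 z : z \in r -> z != 0.
  move=> zr; apply/eqP => z0; move: p0; rewrite -horner_coef0 pr hornerZ horner_prod.
  rewrite (big_rem z) //= hornerXsubC z0 subrr mul0r mulr0 => /eqP.
  by rewrite eq_sym oner_eq0.
exists [seq z^-1 | z <- r]; rewrite big_map.
pose c := lead_coef p * \prod_(z <- r) (- z).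
have pc : p = c *: \prod_(z <- r) (1 - z^-1 *: 'X).
  rewrite {1}pr /c -scalerA; congr (_ *: _).
  rewrite -scaler_prod; apply: eq_big_seq => z zr.
  rewrite scalerBr scalerA mulNr divff ?r0 // scaleN1r opprK addrC.
  by rewrite scaleNr -mul_polyC mulr1.
have c1 : c = 1.
  move: p0; rewrite {1}pc coefZ -horner_coef0 horner_prod big1 ?mulr1 // => z _.
  by rewrite !hornerE ?mulr0 ?subr0.
by rewrite {1}pc c1 scale1r.
Qed.

Section LogarithmicDerivative.
Variables (C : closedFieldType) (N c : nat -> nat) (Q : {poly C}) (n0 : nat).
Hypotheses (N0 : N 0%N = 1%N) (c0 : c 0%N = 0%N).
Hypothesis Nc : forall n, (n * N n = \sum_(k < n.+1) c k * N (n - k))%N.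
Hypotheses (Q0 : Q`_0 = 1)
  (QN : forall n, (n0 <= n)%N -> \sum_(j < n.+1) Q`_j * (N (n - j)%N)%:R = 0).

Lemma exponential_sum : exists s : seq (C * C), forall k, (0 < k)%N ->
  (c k)%:R = \sum_(x <- s) x.1 * x.2 ^+ k.
Proof.
pose P := \poly_(i < n0.+1) \sum_(j < i.+1) Q`_j * (N (i - j)%N)%:R.
have P0 : P`_0 = 1 by rewrite coef_poly /= big_ord1 Q0 mul1r subn0 N0.
have [rs rsP] := poly_split_at0 P0; have [bs bsP] := poly_split_at0 Q0.
exists ([seq (1, b) | b <- bs] ++ [seq (-1, a) | a <- rs]) => k k0.
rewrite big_cat !big_map /=; under eq_bigr do rewrite mul1r.
under [X in _ + X]eq_bigr do rewrite mulN1r.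
rewrite sumrN; set M := k.+1.
pose Z := \poly_(i < M) ((N i)%:R : C); pose D := \poly_(i < M) ((c i)%:R : C).
pose G (us : seq C) := \sum_(a <- us) \poly_(i < M) (if i == 0%N then 0 else a ^+ i).
have GE us : (G us)`_k = \sum_(a <- us) a ^+ k.
  rewrite coef_sum; apply: eq_bigr => a _; rewrite coef_poly ltnS leqnn.
  by rewrite (_ : (k == 0)%N = false) //; case: (k) k0.
rewrite -!GE -coefB.
have -> : (c k)%:R = D`_k by rewrite coef_poly ltnS leqnn.
suff : eq_upto M D (G bs - G rs) by apply.
have QZ : eq_upto M (Q * Z) P.
  move=> i iM; rewrite coefM coef_poly.
  have -> : \sum_(j < i.+1) Q`_j * Z`_(i - j) = \sum_(j < i.+1) Q`_j * (N (i - j)%N)%:R.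
    by apply: eq_bigr => j _; rewrite coef_poly (leq_ltn_trans _ iM) // leq_subr.
  by case: ltnP => // /ltnW /QN.
have XZ : eq_upto M ('X * Z^`()) (D * Z).
  move=> i iM; rewrite coef_Xderiv coef_poly iM /= -mulrnA mulnC Nc natr_sum coefM.
  apply: eq_bigr => j _; have := ltn_ord j; rewrite ltnS => ji.
  by rewrite natrM !coef_poly (leq_ltn_trans ji iM) (leq_ltn_trans (leq_subr _ _) iM).
have PQ0 : (P * Q)`_0 = 1 by rewrite coefM big_ord1 P0 Q0 mul1r.
apply: (eq_upto_cancel PQ0).
have lhs : eq_upto M (P * Q * D) (Q * (Q * (D * Z))).
  have -> : Q * (Q * (D * Z)) = (Q * D) * (Q * Z) by ring.
  have -> : P * Q * D = (Q * D) * P by ring.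
  by apply: eq_uptoMl; apply: eq_upto_sym.
apply: (eq_upto_trans lhs).
apply: (eq_upto_trans (r := Q * (Q * ('X * Z^`())))).
  by apply/eq_uptoMl/eq_uptoMl/eq_upto_sym.
have -> : Q * (Q * ('X * Z^`())) = Q * ('X * (Q * Z)^`()) + - (('X * Q^`()) * (Q * Z)).
  by rewrite derivM; ring.
have -> : P * Q * (G bs - G rs) = P * (Q * G bs) - Q * (P * G rs) by ring.
rewrite addrC.
have -> : P * (Q * G bs) - Q * (P * G rs) = - (- (P * (Q * G bs))) + Q * (- (P * G rs)) by ring.
apply: eq_uptoD.
  apply: eq_uptoN; apply: (eq_upto_trans (r := 'X * Q^`() * P)); first exact: eq_uptoMl.
  have -> : 'X * Q^`() * P = P * ('X * Q^`()) by ring.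
  have -> : - (P * (Q * G bs)) = P * (- (Q * G bs)) by ring.
  apply: eq_uptoMl; apply: eq_upto_sym.
  rewrite -['X * _]opprK; apply: eq_uptoN.
  by have := @geometric_log_deriv _ M bs; rewrite -bsP.
apply: eq_uptoMl; apply: (eq_upto_trans (eq_upto_Xderiv QZ)).
rewrite -['X * _]opprK; apply: eq_uptoN; apply: eq_upto_sym.
by have := @geometric_log_deriv _ M rs; rewrite -rsP.
Qed.

End LogarithmicDerivative.

Section GeometricRecurrence.
Variables (N : nat -> nat) (q d e n0 : nat).
Hypotheses (q1 : (1 < q)%N) (d0 : (0 < d)%N) (e0 : (0 < e)%N).
Hypothesis Nd : forall k,
  (N (n0 + k + d) * (q ^ (k + e) - 1) = N (n0 + k) * (q ^ (k + d + e) - 1))%N.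

Let s_gt0 k : (0 < q ^ (k + e) - 1)%N.
Proof. by rewrite subn_gt0 -{1}(expn0 q) ltn_exp2l // addn_gt0 e0 orbT. Qed.

Lemma recurrence_bound : exists U, forall n, (N n <= U * q ^ n)%N.
Proof.
pose U := (\max_(j < d) N (n0 + j))%N.
have NU k : (N (n0 + k) <= U * (q ^ (k + e) - 1))%N.
  elim/ltn_ind: k => k IH; have [kd|dk] := ltnP k d.
    apply: (@leq_trans U); last by rewrite leq_pmulr.
    exact: (leq_bigmax (F := fun j : 'I_d => N (n0 + j)) (Ordinal kd)).
  rewrite -(leq_pmul2r (s_gt0 (k - d))).
  have := Nd (k - d); rewrite -addnA subnK // => ->.
  by rewrite -mulnA [(_ * (q ^ (k - d + e) - 1))%N]mulnC mulnA leq_mul2r IH ?orbT //; lia.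
exists (U * q ^ e + \max_(j < n0) N j)%N => n.
have qn k : (0 < q ^ k)%N by rewrite expn_gt0 ltnW.
have [nn|nn] := ltnP n n0.
  apply: (@leq_trans (\max_(j < n0) N j)).
    exact: (leq_bigmax (F := fun j : 'I_n0 => N j) (Ordinal nn)).
  by apply: leq_trans (leq_pmulr _ (qn n)); apply: leq_addl.
rewrite -(subnKC nn); apply: leq_trans (NU _) _.
apply: (@leq_trans (U * q ^ e * q ^ (n0 + (n - n0)))); last by rewrite leq_mul2r leq_addr orbT.
rewrite -mulnA leq_mul2l; apply/orP; right; apply: leq_trans (leq_subr _ _) _.
rewrite -expnD; apply: leq_pexp2l; [exact: ltnW|lia].
Qed.

Lemma recurrence_annihilator (C : numFieldType) : exists Q : {poly C}, Q`_0 = 1 /\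
  forall n, (n0 + 2 * d <= n)%N -> \sum_(j < n.+1) Q`_j * (N (n - j)%N)%:R = 0.
Proof.
pose u : C := (q ^ d)%N%:R.
exists (1 - (u + 1) *: 'X^d + u *: 'X^(2 * d)); split=> [|n nn].
  have d1 : (0 == d)%N = false by apply/negbTE; rewrite eq_sym -lt0n.
  have d2 : (0 == 2 * d)%N = false by apply/negbTE; rewrite eq_sym -lt0n muln_gt0.
  by rewrite coefD coefB coef1 !coefZ !coefXn d1 d2 !mulr0 subr0 addr0.
pose k := (n - 2 * d - n0)%N.
have -> : \sum_(j < n.+1) (1 - (u + 1) *: 'X^d + u *: 'X^(2 * d))`_j * (N (n - j)%N)%:R =
   (N n)%:R - (u + 1) * (N (n - d)%N)%:R + u * (N (n - 2 * d)%N)%:R :> C.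
  have pick m : (m <= n)%N ->
      \sum_(j < n.+1) ('X^m : {poly C})`_j * (N (n - j)%N)%:R = (N (n - m)%N)%:R.
    move=> mn; rewrite (bigD1 (Ordinal (mn : (m < n.+1)%N))) //= coefXn eqxx mul1r big1 ?addr0 //.
    move=> j jm; rewrite coefXn (_ : (j == m :> nat) = false) ?mul0r //.
    by apply/negbTE; rewrite -val_eqE in jm.
  have pick0 := pick 0%N (leq0n n); rewrite subn0 in pick0.
  rewrite -pick0 -(pick d); last by lia.
  rewrite -(pick (2 * d)%N); last by lia.
  rewrite !mulr_sumr -sumrB -big_split /=; apply: eq_bigr => j _.
  by rewrite coefD coefB !coefZ expr0; ring.
have -> : n = (n0 + (k + d) + d)%N by rewrite /k; lia.
have -> : (n0 + (k + d) + d - d = n0 + k + d)%N by lia.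
have -> : (n0 + (k + d) + d - 2 * d = n0 + k)%N by lia.
have := Nd k; have := Nd (k + d); rewrite addnA.
have s0 m : (q ^ (m + e) - 1)%N%:R != 0 :> C by rewrite pnatr_eq0 -lt0n.
have sE m : (q ^ (m + e) - 1)%N%:R = (q ^ (m + e))%N%:R - 1 :> C.
  by rewrite natrB // expn_gt0 ltnW.
move=> /(congr1 (fun m => m%:R : C)); rewrite !natrM => h2.
move=> /(congr1 (fun m => m%:R : C)); rewrite !natrM => h1.
have e1 : (N (n0 + k + d))%:R = (N (n0 + k))%:R * (q ^ (k + d + e) - 1)%N%:R / (q ^ (k + e) - 1)%N%:R :> C.
  by rewrite -h1 mulfK.
have e2 : (N (n0 + k + d + d))%:R = (N (n0 + k))%:R * (q ^ (k + d + d + e) - 1)%N%:R / (q ^ (k + e) - 1)%N%:R :> C.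
  apply: (mulIf (s0 (k + d)%N)); rewrite h2 e1; ring.
rewrite e1 e2.
have -> : (q ^ (k + d + e) - 1)%N%:R = u * (q ^ (k + e))%N%:R - 1 :> C.
  by rewrite sE -natrM -expnD; congr (_%:R - 1); congr (_ ^ _)%N; lia.
have -> : (q ^ (k + d + d + e) - 1)%N%:R = u * (u * (q ^ (k + e))%N%:R) - 1 :> C.
  by rewrite sE -!natrM -!expnD; congr (_%:R - 1); congr (_ ^ _)%N; lia.
have := s0 k; rewrite sE => h; field; exact: h.
Qed.

End GeometricRecurrence.

Section ComplexNorm.
Variable R : realType.
Implicit Types (z w : R[i]) (x y : R).

Definition nm z : R := complex.Re `|z|.

Lemma nmE z : `|z| = (nm z)%:C%C.
Proof. by rewrite /nm RRe_real // normr_real. Qed.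

Lemma nm_ge0 z : 0 <= nm z.
Proof. by rewrite -ler0c -nmE normr_ge0. Qed.

Lemma nmM z w : nm (z * w) = nm z * nm w.
Proof. by apply: (@complexI R); rewrite rmorphM /= -!nmE normrM. Qed.

Lemma nmV z : nm z^-1 = (nm z)^-1.
Proof. by apply: (@complexI R); rewrite fmorphV /= -!nmE normfV. Qed.

Lemma nmX z n : nm (z ^+ n) = nm z ^+ n.
Proof. by apply: (@complexI R); rewrite rmorphXn /= -!nmE normrX. Qed.

Lemma nmD z w : nm (z + w) <= nm z + nm w.
Proof. by rewrite -lecR rmorphD /= -!nmE ler_normD. Qed.

Lemma nmN z : nm (- z) = nm z.
Proof. by rewrite /nm normrN. Qed.

Lemma nmB z w : nm (z - w) <= nm z + nm w.
Proof. by rewrite -(nmN w) nmD. Qed.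

Lemma nmC z w : nm (z - w) = nm (w - z).
Proof. by rewrite -nmN opprB. Qed.

Lemma nm0 : nm 0 = 0. Proof. by rewrite /nm normr0. Qed.
Lemma nm1 : nm 1 = 1. Proof. by rewrite /nm normr1. Qed.

Lemma nm_eq0 z : (nm z == 0) = (z == 0).
Proof. by rewrite -(inj_eq (@complexI R)) /= -nmE normr_eq0. Qed.

Lemma nm_gt0 z : (0 < nm z) = (z != 0).
Proof. by rewrite lt_def nm_eq0 nm_ge0 andbT. Qed.

Lemma nm_real x : nm x%:C%C = `|x|.
Proof. by rewrite /nm normc_def /= expr0n /= addr0 sqrtr_sqr. Qed.

Lemma nm_nat n : nm n%:R = n%:R.
Proof. by rewrite -(rmorph_nat (real_complex R)) nm_real normr_nat. Qed.

Lemma nm_sqr z : nm z ^+ 2 = complex.Re z ^+ 2 + complex.Im z ^+ 2.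
Proof. by rewrite /nm normc_def /= sqr_sqrtr // addr_ge0 // sqr_ge0. Qed.

Lemma nm_ReIm z : nm z <= `|complex.Re z| + `|complex.Im z|.
Proof.
rewrite -ler_sqr ?nnegrE ?nm_ge0 ?addr_ge0 // nm_sqr.
rewrite -(real_normK (num_real (complex.Re z))) -(real_normK (num_real (complex.Im z))).
by rewrite sqrrD lerD2r lerDl mulrn_wge0 // mulr_ge0.
Qed.

Lemma Re_le_nm z : `|complex.Re z| <= nm z.
Proof.
rewrite -ler_sqr ?nnegrE ?nm_ge0 // nm_sqr real_normK ?num_real //.
by rewrite lerDl sqr_ge0.
Qed.

Lemma Im_le_nm z : `|complex.Im z| <= nm z.
Proof.
rewrite -ler_sqr ?nnegrE ?nm_ge0 // nm_sqr real_normK ?num_real //.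
by rewrite lerDr sqr_ge0.
Qed.

Lemma nm_sum (I : Type) (r : seq I) (P : pred I) (f : I -> R[i]) :
  nm (\sum_(i <- r | P i) f i) <= \sum_(i <- r | P i) nm (f i).
Proof.
elim/big_ind2: _ => [|z x w y zx wy|//]; first by rewrite nm0.
by apply: le_trans (nmD _ _) _; apply: lerD.
Qed.

Lemma bernoulli x n : 0 <= x -> 1 + n%:R * x <= (1 + x) ^+ n.
Proof.
move=> x0; elim: n => [|n IH]; first by rewrite mul0r addr0 expr0.
rewrite exprS; apply: (@le_trans _ _ ((1 + x) * (1 + n%:R * x))).
  rewrite -natr1; have : 0 <= n%:R * x * x by rewrite !mulr_ge0.
  by rewrite !mulrDl !mulrDr !mul1r !mulr1; lra.
by rewrite ler_wpM2l // addr_ge0.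
Qed.

Lemma exp_le_linear (r C : R) : (forall n, r ^+ n.+1 <= C * n.+1%:R) -> r <= 1.
Proof.
move=> h; rewrite leNgt; apply/negP => r1.
pose d := r - 1; have d0 : 0 < d by rewrite subr_gt0.
have rd : r = 1 + d by rewrite /d addrC subrK.
have C0 : 0 <= C.
  by have := h 0%N; rewrite expr1 mulr1; lra.
pose m := (Num.truncn (2 * C / d ^+ 2)).+1.
have mP : 2 * C / d ^+ 2 < m%:R by rewrite /m truncnS_gt.
have m0 : (0 < m%:R :> R) by rewrite ltr0n.
have := h (m * 2).-1; rewrite prednK ?muln_gt0 // exprM natrM => h2.
have h1 := bernoulli m (ltW d0); rewrite -rd in h1.
have h3 : (m%:R * d) ^+ 2 <= (r ^+ m) ^+ 2.
  rewrite ler_sqr ?nnegrE; first by lra.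
    by rewrite mulr_ge0 // ltW.
  by rewrite exprn_ge0 // ltW // (lt_trans ltr01).
have h4 : m%:R * d ^+ 2 <= 2 * C.
  rewrite -(ler_pM2l m0); apply: le_trans (_ : m%:R * (m%:R * d ^+ 2) <= (m%:R * d) ^+ 2) _.
    by rewrite exprMn expr2 mulrA.
  by apply: (le_trans h3); apply: (le_trans h2); rewrite le_eqVlt; apply/orP; left; apply/eqP; ring.
by move: mP; rewrite ltr_pdivrMr ?exprn_gt0 // ltNge h4.
Qed.

End ComplexNorm.

Section ExponentialSums.
Variable R : realType.

Lemma exponential_sum_bases (f : nat -> R[i]) (q U : R) (s : seq (R[i] * R[i])) : 0 < q -> 0 <= U ->
  (forall k, (0 < k)%N -> f k = \sum_(x <- s) x.1 * x.2 ^+ k) ->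
  (forall k, nm (f k) <= U * k%:R * q ^+ k) ->
  exists s' : seq (R[i] * R[i]), (forall b, b \in s' -> nm b.2 <= q) /\
    forall k, (0 < k)%N -> f k = \sum_(x <- s') x.1 * x.2 ^+ k.
Proof.
move=> q0 U0 fs fU.
pose a b := \sum_(x <- s | x.2 == b) x.1.
pose bs := [seq b <- undup [seq x.2 | x <- s] | a b != 0].
have ubs : uniq bs by rewrite filter_uniq // undup_uniq.
have fbs k : (0 < k)%N -> f k = \sum_(b <- bs) a b * b ^+ k.
  move=> k0; rewrite fs // big_filter [RHS]big_mkcond /=.
  rewrite [RHS](eq_bigr (fun b => \sum_(x <- s) (x.2 == b)%:R * (x.1 * x.2 ^+ k))).
    rewrite exchange_big /=; apply: eq_big_seq => x xs.
    rewrite (bigD1_seq x.2) ?undup_uniq ?mem_undup ?map_f //= eqxx mul1r big1 ?addr0 //.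
    by move=> b bx; rewrite eq_sym (negbTE bx) mul0r.
  move=> b _; have -> : (if a b != 0 then a b * b ^+ k else 0) = a b * b ^+ k.
    by case: eqP => // ->; rewrite mul0r.
  rewrite /a mulr_suml big_mkcond; apply: eq_bigr => x _.
  by case: eqP => [->|_]; rewrite ?mul1r ?mul0r.
have bsq b0 : b0 \in bs -> nm b0 <= q.
  move=> b0s; pose G := \prod_(b <- rem b0 bs) ('X - b%:P).
  have Gb0 : G.[b0] != 0.
    rewrite horner_prod prodf_seq_neq0; apply/allP => b; rewrite /= hornerXsubC subr_eq0.
    by move=> bb; apply/eqP => e; move: bb; rewrite -e mem_rem_uniqF.
  have Gb b : b \in bs -> b != b0 -> G.[b] = 0.
    move=> bbs bb0; apply/rootP; rewrite root_prod_XsubC (rem_filter _ ubs) mem_filter /=.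
    by rewrite bb0.
  have fG k : \sum_(j < size G) G`_j * f (k.+1 + j)%N = a b0 * b0 ^+ k.+1 * G.[b0].
    under eq_bigr => j _ do rewrite fbs // mulr_sumr.
    have row b : \sum_(j < size G) G`_j * (a b * b ^+ (k.+1 + j)) = a b * b ^+ k.+1 * G.[b].
      by rewrite horner_coef mulr_sumr; apply: eq_bigr => j _; rewrite exprD; ring.
    rewrite exchange_big /= (bigD1_seq b0) //= row big_seq_cond big1 ?addr0 // => b.
    by move=> /andP[bb bb0]; rewrite row Gb // mulr0.
  pose c := nm (a b0) * nm G.[b0].
  have c0 : 0 < c.
    by rewrite mulr_gt0 // nm_gt0 //; move: b0s; rewrite mem_filter => /andP[].
  pose T := \sum_(j < size G) nm G`_j * (U * j.+1%:R * q ^+ j).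
  rewrite -[q]mul1r -ler_pdivrMr //; apply: (@exp_le_linear _ _ (T / c)) => k.
  rewrite expr_div_n ler_pdivrMr ?exprn_gt0 //.
  have -> : T / c * k.+1%:R * q ^+ k.+1 = T * k.+1%:R * q ^+ k.+1 / c.
    by rewrite -!mulrA; congr (_ * _); rewrite mulrC -mulrA.
  rewrite ler_pdivlMr //.
  have -> : nm b0 ^+ k.+1 * c = nm (\sum_(j < size G) G`_j * f (k.+1 + j)%N).
    by rewrite fG !nmM nmX /c; ring.
  apply: le_trans (nm_sum _ _ _) _; rewrite /T !mulr_suml; apply: ler_sum => j _.
  rewrite nmM -!mulrA ler_wpM2l ?nm_ge0 //; apply: le_trans (fU _) _.
  rewrite exprD -!mulrA ler_wpM2l //.
  have -> : j.+1%:R * (q ^+ j * (k.+1%:R * q ^+ k.+1)) = (j.+1 * k.+1)%N%:R * (q ^+ k.+1 * q ^+ j).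
    by rewrite natrM; ring.
  apply: ler_wpM2r; first by rewrite mulr_ge0 // exprn_ge0 // ltW.
  rewrite ler_nat; nia.
exists [seq (a b, b) | b <- bs]; split=> [_ /mapP[b /bsq bq ->] //|k k0].
by rewrite big_map fbs.
Qed.

End ExponentialSums.

Lemma prime_count_exponential_sum (R : realType) (F : finFieldType) (K : fieldType)
    (iota : {rmorphism F -> K}) : function_field iota ->
  exists s : seq (R[i] * R[i]), (forall b, b \in s -> nm b.2 <= #|F|%:R) /\
    forall k, (0 < k)%N -> (prime_count iota k)%:R = \sum_(b <- s) b.1 * b.2 ^+ k.
Proof.
move=> ff; have [[P0 _]|noP] := pselect (exists P : place iota, True); last first.
  exists [::]; split=> // k k0; rewrite big_nil /prime_count big1 // => A _.
  apply/eqP; apply: contrapT => /negP /prime_weight_neq0 [P _].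
  by apply: noP; exists P.
have q1 : (1 < #|F|)%N by exact: card_finNzRing_gt1.
have d0 := place_deg_gt0 ff P0.
have [n0 [e [e0 rec]]] := eff_count_recurrence ff P0.
have [Q [Q0 QN]] := recurrence_annihilator q1 d0 e0 rec R[i].
have [U UP] := recurrence_bound q1 d0 e0 rec.
have [s sP] := exponential_sum (eff_count0 ff) (eff_count_prime_count ff) Q0 QN.
apply: (exponential_sum_bases (U := U%:R) _ _ sP); rewrite ?ltr0n ?ler0n //.
  exact: ltnW.
move=> k; rewrite nm_nat -natrX -!natrM ler_nat.
apply: leq_trans (prime_count_le ff k) _; rewrite mulnC mulnAC leq_mul2r.
by rewrite UP orbT.
Qed.

(** * Differentiation of series *)

Section SecondOrder.
Variable R : realType.
Local Notation C := R[i].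
Implicit Types (D : set C) (f g df dg : C -> C) (s t c : C) (A B L : R).

(* A quantitative form of complex differentiability which passes to sums of series: [A] bounds
   [f], and, after rescaling by the length [L^-1], its derivative [df] and second-order Taylor
   remainder on [D]. *)
Definition c2bound D L f df A :=
  [/\ 0 <= A, forall s, D s -> nm (f s) <= A, forall s, D s -> nm (df s) <= L * A,
      forall s t, D s -> D t -> nm (f t - f s) <= L * A * nm (t - s)
    & forall s t, D s -> D t -> nm (f t - f s - (t - s) * df s) <= L ^+ 2 * A * nm (t - s) ^+ 2].

Variables (D : set C) (L : R).
Hypothesis L0 : 0 <= L.

Lemma c2bound_le f df A B : A <= B -> c2bound D L f df A -> c2bound D L f df B.
Proof.
move=> AB [A0 h0 h1 h2 h3]; have B0 := le_trans A0 AB.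
have LAB : L * A <= L * B by apply: ler_wpM2l.
have LLAB : L ^+ 2 * A <= L ^+ 2 * B by apply: ler_wpM2l; rewrite ?exprn_ge0.
split=> // [s Ds|s Ds|s t Ds Dt|s t Ds Dt].
- exact: le_trans (h0 _ Ds) AB.
- exact: le_trans (h1 _ Ds) LAB.
- by apply: le_trans (h2 _ _ Ds Dt) _; rewrite ler_wpM2r ?nm_ge0.
- by apply: le_trans (h3 _ _ Ds Dt) _; rewrite ler_wpM2r ?exprn_ge0 ?nm_ge0.
Qed.

Lemma c2bound_eq f df g A : (forall s, D s -> f s = g s) -> c2bound D L f df A -> c2bound D L g df A.
Proof.
move=> fg [A0 h0 h1 h2 h3]; split=> // [s Ds|s t Ds Dt|s t Ds Dt].
- by rewrite -fg // h0.
- by rewrite -!fg // h2.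
- by rewrite -!fg // h3.
Qed.

Lemma c2bound_cst c : c2bound D L (fun=> c) (fun=> 0) (nm c).
Proof.
split=> [|s _|s _|s t _ _|s t _ _]; rewrite ?nm_ge0 //.
- by rewrite nm0 mulr_ge0 ?nm_ge0.
- by rewrite subrr nm0 !mulr_ge0 ?nm_ge0.
- by rewrite subrr sub0r mulr0 oppr0 nm0 !mulr_ge0 ?exprn_ge0 ?nm_ge0.
Qed.

Lemma c2bound_id A : (forall s, D s -> nm s <= A) -> 0 <= A -> 1 <= L * A ->
  c2bound D L id (fun=> 1) A.
Proof.
move=> DA A0 LA; split=> [//|s /DA //|s _|s t _ _|s t _ _].
- by rewrite nm1.
- by rewrite ler_peMl ?nm_ge0.
- by rewrite mulr1 subrr nm0 !mulr_ge0 ?exprn_ge0 ?nm_ge0.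
Qed.

Lemma c2boundD f df g dg A B : c2bound D L f df A -> c2bound D L g dg B ->
  c2bound D L (fun s => f s + g s) (fun s => df s + dg s) (A + B).
Proof.
move=> [A0 h0 h1 h2 h3] [B0 k0 k1 k2 k3]; split=> [|s Ds|s Ds|s t Ds Dt|s t Ds Dt].
- exact: addr_ge0.
- by apply: le_trans (nmD _ _) _; apply: lerD; auto.
- by rewrite mulrDr; apply: le_trans (nmD _ _) _; apply: lerD; auto.
- have -> : f t + g t - (f s + g s) = (f t - f s) + (g t - g s) by ring.
  by rewrite mulrDr mulrDl; apply: le_trans (nmD _ _) _; apply: lerD; auto.
- have -> : f t + g t - (f s + g s) - (t - s) * (df s + dg s) =
     (f t - f s - (t - s) * df s) + (g t - g s - (t - s) * dg s) by ring.
  by rewrite mulrDr mulrDl; apply: le_trans (nmD _ _) _; apply: lerD; auto.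
Qed.

Lemma c2boundM f df g dg A B : c2bound D L f df A -> c2bound D L g dg B ->
  c2bound D L (fun s => f s * g s) (fun s => df s * g s + f s * dg s) (3 * (A * B)).
Proof.
move=> [A0 h0 h1 h2 h3] [B0 k0 k1 k2 k3].
have AB0 : 0 <= A * B by apply: mulr_ge0.
have LAB0 : 0 <= L * (A * B) by apply: mulr_ge0.
split=> [|s Ds|s Ds|s t Ds Dt|s t Ds Dt].
- by rewrite mulr_ge0.
- have : nm (f s * g s) <= A * B by rewrite nmM; apply: ler_pM; rewrite ?nm_ge0; auto.
  lra.
- apply: le_trans (nmD _ _) _; rewrite !nmM.
  have : nm (df s) * nm (g s) <= L * A * B by apply: ler_pM; rewrite ?nm_ge0; auto.
  have : nm (f s) * nm (dg s) <= A * (L * B) by apply: ler_pM; rewrite ?nm_ge0; auto.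
  rewrite mulrCA -!mulrA; lra.
- have -> : f t * g t - f s * g s = f t * (g t - g s) + g s * (f t - f s) by ring.
  apply: le_trans (nmD _ _) _; rewrite !nmM.
  have : nm (f t) * nm (g t - g s) <= A * (L * B * nm (t - s)) by apply: ler_pM; rewrite ?nm_ge0; auto.
  have : nm (g s) * nm (f t - f s) <= B * (L * A * nm (t - s)) by apply: ler_pM; rewrite ?nm_ge0; auto.
  have : 0 <= L * (A * B) * nm (t - s) by rewrite mulr_ge0 ?nm_ge0.
  set n := nm (t - s).
  have -> : A * (L * B * n) = L * (A * B) * n by ring.
  have -> : B * (L * A * n) = L * (A * B) * n by ring.
  have -> : L * (3 * (A * B)) * n = 3 * (L * (A * B) * n) by ring.
  lra.
- have -> : f t * g t - f s * g s - (t - s) * (df s * g s + f s * dg s) =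
     f t * (g t - g s - (t - s) * dg s) + g s * (f t - f s - (t - s) * df s) +
     (t - s) * dg s * (f t - f s) by ring.
  apply: le_trans (nmD _ _) _; apply: le_trans (lerD (nmD _ _) (lexx _)) _; rewrite !nmM.
  set n := nm (t - s); have n0 : 0 <= n by apply: nm_ge0.
  have e1 : nm (f t) * nm (g t - g s - (t - s) * dg s) <= A * (L ^+ 2 * B * n ^+ 2).
    by apply: ler_pM; rewrite ?nm_ge0; auto; apply: k3.
  have e2 : nm (g s) * nm (f t - f s - (t - s) * df s) <= B * (L ^+ 2 * A * n ^+ 2).
    by apply: ler_pM; rewrite ?nm_ge0; auto; apply: h3.
  have e3 : n * nm (dg s) * nm (f t - f s) <= n * (L * B) * (L * A * n).
    apply: ler_pM; rewrite ?mulr_ge0 ?nm_ge0 //; last exact: h2.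
    by apply: ler_wpM2l => //; apply: k1.
  apply: le_trans (lerD (lerD e1 e2) e3) _.
  by rewrite le_eqVlt; apply/orP; left; apply/eqP; ring.
Qed.

Lemma c2boundZ c f df A : c2bound D L f df A ->
  c2bound D L (fun s => c * f s) (fun s => c * df s) (nm c * A).
Proof.
move=> [A0 h0 h1 h2 h3]; have c0 := nm_ge0 c; split=> [|s Ds|s Ds|s t Ds Dt|s t Ds Dt].
- exact: mulr_ge0.
- by rewrite nmM; apply: ler_wpM2l => //; apply: h0.
- by rewrite nmM mulrCA; apply: ler_wpM2l => //; apply: h1.
- by rewrite -mulrBr nmM [L * _]mulrCA -mulrA; apply: ler_wpM2l => //; apply: h2.
- have -> : c * f t - c * f s - (t - s) * (c * df s) = c * (f t - f s - (t - s) * df s) by ring.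
  by rewrite nmM [L ^+ 2 * _]mulrCA -mulrA; apply: ler_wpM2l => //; apply: h3.
Qed.

Lemma c2boundV f df A d : c2bound D L f df A -> 0 < d -> (forall s, D s -> d <= nm (f s)) ->
  c2bound D L (fun s => (f s)^-1) (fun s => - (df s / f s ^+ 2))
    (d^-1 + A / d ^+ 2 + 2 * (A ^+ 2 / d ^+ 3)).
Proof.
move=> [A0 h0 h1 h2 h3] d0 df_.
have di0 : 0 < d^-1 by rewrite invr_gt0.
have f0 s : D s -> f s != 0.
  by move=> Ds; rewrite -nm_gt0; apply: lt_le_trans (df_ _ Ds).
have fi s : D s -> nm (f s)^-1 <= d^-1.
  by move=> Ds; rewrite nmV lef_pV2 ?posrE ?df_ // (lt_le_trans d0) ?df_.
have fi0 s : 0 <= nm (f s)^-1 by apply: nm_ge0.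
have q1 : 0 <= A / d ^+ 2 by rewrite divr_ge0 // exprn_ge0 // ltW.
have q2 : 0 <= A ^+ 2 / d ^+ 3 by rewrite divr_ge0 ?exprn_ge0 // ltW.
set T := _ + _ + _.
have T1 : d^-1 <= T by rewrite /T; lra.
have T2 : A / d ^+ 2 <= T by have := ltW di0; rewrite /T; lra.
have T3 : 2 * (A ^+ 2 / d ^+ 3) <= T by have := ltW di0; rewrite /T; lra.
have T0 : 0 <= T by apply: le_trans T1; apply: ltW.
split=> [//|s Ds|s Ds|s t Ds Dt|s t Ds Dt].
- exact: le_trans (fi _ Ds) T1.
- rewrite nmN -exprVn nmM nmX.
  apply: (@le_trans _ _ (L * A * (d^-1) ^+ 2)).
    apply: ler_pM; rewrite ?exprn_ge0 ?nm_ge0 ?h1 //.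
    by rewrite lerXn2r ?nnegrE ?nm_ge0 ?fi // ltW.
  by rewrite -mulrA ler_wpM2l // exprVn.
- have -> : (f t)^-1 - (f s)^-1 = - (f t - f s) * ((f t)^-1 * (f s)^-1).
    by field; rewrite !f0.
  rewrite !nmM nmN.
  apply: (@le_trans _ _ (L * A * nm (t - s) * (d^-1 * d^-1))).
    apply: ler_pM; rewrite ?mulr_ge0 ?nm_ge0 ?h2 //.
    by apply: ler_pM; rewrite ?nm_ge0 ?fi.
  have -> : L * A * nm (t - s) * (d^-1 * d^-1) = L * (A / d ^+ 2) * nm (t - s).
    by rewrite expr2 invfM; ring.
  by apply: ler_wpM2r; rewrite ?nm_ge0 // ler_wpM2l.
- have -> : (f t)^-1 - (f s)^-1 - (t - s) * - (df s / f s ^+ 2) =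
     - (f t - f s - (t - s) * df s) * ((f t)^-1 * (f s)^-1)
     + (t - s) * df s * (f t - f s) * ((f t)^-1 * ((f s)^-1 * (f s)^-1)).
    by field; rewrite !f0.
  set n := nm (t - s); have n0 : 0 <= n by apply: nm_ge0.
  apply: le_trans (nmD _ _) _; rewrite !nmM nmN -/n.
  have e1 : nm (f t - f s - (t - s) * df s) * (nm (f t)^-1 * nm (f s)^-1) <=
      L ^+ 2 * A * n ^+ 2 * (d^-1 * d^-1).
    apply: ler_pM; rewrite ?mulr_ge0 ?nm_ge0 //; first exact: h3.
    by apply: ler_pM; rewrite ?nm_ge0 ?fi.
  have e2 : n * nm (df s) * nm (f t - f s) * (nm (f t)^-1 * (nm (f s)^-1 * nm (f s)^-1)) <=
      n * (L * A) * (L * A * n) * (d^-1 * (d^-1 * d^-1)).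
    apply: ler_pM; rewrite ?mulr_ge0 ?nm_ge0 //.
      apply: ler_pM; rewrite ?mulr_ge0 ?nm_ge0 //; last exact: h2.
      by apply: ler_wpM2l => //; apply: h1.
    apply: ler_pM; rewrite ?mulr_ge0 ?nm_ge0 ?fi //.
    by apply: ler_pM; rewrite ?nm_ge0 ?fi.
  apply: le_trans (lerD e1 e2) _.
  have -> : L ^+ 2 * A * n ^+ 2 * (d^-1 * d^-1) + n * (L * A) * (L * A * n) * (d^-1 * (d^-1 * d^-1))
     = L ^+ 2 * (A / d ^+ 2 + A ^+ 2 / d ^+ 3) * n ^+ 2.
    by rewrite !exprS expr0 !mulr1 !invfM; ring.
  apply: ler_wpM2r; rewrite ?exprn_ge0 //; apply: ler_wpM2l; rewrite ?exprn_ge0 //.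
  by have := ltW di0; rewrite /T; lra.
Qed.

End SecondOrder.

Section ComplexSeries.
Variable R : realType.
Local Notation C := R[i].

Definition is_csum (u : nat -> C) (l : C) :=
  forall e : R, 0 < e -> exists N, forall n, (N <= n)%N -> nm (\sum_(i < n) u i - l) <= e.

Lemma is_csum_le (u : nat -> C) l (b : R) :
  (forall n, nm (\sum_(i < n) u i) <= b) -> is_csum u l -> nm l <= b.
Proof.
move=> ub ul; apply/ler_addgt0Pr => e e0; have [N /(_ N (leqnn N)) h] := ul e e0.
have -> : l = \sum_(i < N) u i - (\sum_(i < N) u i - l) by ring.
by apply: le_trans (nmB _ _) _; apply: lerD.
Qed.

Lemma is_csum_unique (u : nat -> C) l l' : is_csum u l -> is_csum u l' -> l = l'.
Proof.
move=> h h'; apply/eqP; rewrite -subr_eq0 -nm_eq0 eq_le nm_ge0 andbT.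
apply/ler_addgt0Pr => e e0; rewrite add0r.
have e2 : 0 < e / 2 by rewrite divr_gt0.
have [N NP] := h _ e2; have [N' NP'] := h' _ e2.
pose n := maxn N N'; have := NP n (leq_maxl _ _); have := NP' n (leq_maxr _ _).
set S := \sum_(_ < _) _ => a b.
have -> : l - l' = (S - l') - (S - l) by ring.
by apply: le_trans (nmB _ _) _; lra.
Qed.

Lemma is_csumD (u v : nat -> C) l m : is_csum u l -> is_csum v m ->
  is_csum (fun i => u i + v i) (l + m).
Proof.
move=> h h' e e0; have e2 : 0 < e / 2 by rewrite divr_gt0.
have [N NP] := h _ e2; have [N' NP'] := h' _ e2.
exists (maxn N N') => n; rewrite geq_max => /andP[/NP a /NP' b].
rewrite big_split /=.
have -> : \sum_(i < n) u i + \sum_(i < n) v i - (l + m) =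
  (\sum_(i < n) u i - l) + (\sum_(i < n) v i - m) by ring.
by apply: le_trans (nmD _ _) _; lra.
Qed.

Lemma is_csumZ (u : nat -> C) l c : is_csum u l -> is_csum (fun i => c * u i) (c * l).
Proof.
move=> h e e0; have c0 := nm_ge0 c.
have [N NP] := h (e / (nm c + 1)) (divr_gt0 e0 (ltr_wpDl c0 ltr01)).
exists N => n /NP; rewrite -mulr_sumr -mulrBr nmM => a.
apply: (@le_trans _ _ (nm c * (e / (nm c + 1)))); first exact: ler_wpM2l.
rewrite mulrCA ler_piMr ?(ltW e0) // ler_pdivrMr ?ltr_wpDl //; lra.
Qed.

Lemma is_csumN (u : nat -> C) l : is_csum u l -> is_csum (fun i => - u i) (- l).
Proof.
move=> /(is_csumZ (-1)); rewrite mulN1r.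
by under eq_fun do rewrite mulN1r.
Qed.

Lemma is_csumB (u v : nat -> C) l m : is_csum u l -> is_csum v m ->
  is_csum (fun i => u i - v i) (l - m).
Proof. by move=> hu hv; apply: is_csumD => //; apply: is_csumN. Qed.

Lemma is_csum_eq (u v : nat -> C) l : (forall i, u i = v i) -> is_csum u l -> is_csum v l.
Proof. by move=> /funext ->. Qed.

Lemma is_csum0 : is_csum (fun=> 0) 0.
Proof. by move=> e e0; exists 0%N => n _; rewrite big1 // subrr nm0 ltW. Qed.

Lemma is_csum_sum (I : Type) (r : seq I) (u : I -> nat -> C) (l : I -> C) :
  (forall i, is_csum (u i) (l i)) -> is_csum (fun n => \sum_(i <- r) u i n) (\sum_(i <- r) l i).
Proof.
move=> h; elim: r => [|i r IH].
  by rewrite big_nil; apply: is_csum_eq is_csum0 => n; rewrite big_nil.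
rewrite big_cons; apply: is_csum_eq (is_csumD (h i) IH) => n.
by rewrite big_cons.
Qed.

Lemma is_csum_shift (u : nat -> C) l m :
  is_csum (fun i => u (m + i)%N) l -> is_csum u (\sum_(i < m) u i + l).
Proof.
move=> h e e0; have [N NP] := h e e0; exists (m + N)%N => n mn.
have -> : n = (m + (n - m))%N by lia.
rewrite big_split_ord /=; set S := \sum_(i < m) u i.
have -> : S + \sum_(i < n - m) u (m + i)%N - (S + l) = \sum_(i < n - m) u (m + i)%N - l by ring.
by apply: NP; lia.
Qed.

Lemma real_series_cvg (v : nat -> R) (T : R) : (forall n, \sum_(i < n) `|v i| <= T) ->
  exists l, forall e : R, 0 < e -> exists N, forall n, (N <= n)%N -> `|\sum_(i < n) v i - l| <= e.
Proof.
move=> vT.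
have mono (w : nat -> R) : (forall i, 0 <= w i) -> (forall n, \sum_(i < n) w i <= 2 * T) ->
   exists l, forall e : R, 0 < e -> exists N, forall n, (N <= n)%N -> `|\sum_(i < n) w i - l| <= e.
  move=> w0 wT; pose S n := \sum_(i < n) w i.
  have nd : nondecreasing_seq S.
    by apply/nondecreasing_seqP => n; rewrite /S big_ord_recr /= lerDl.
  have ub : has_ubound (range S) by exists (2 * T) => _ [n _ <-]; apply: wT.
  have := nondecreasing_is_cvgn nd ub.
  move=> /cvg_ex [l Sl]; exists l => e e0.
  have /cvgrPdist_le /(_ e e0) [N _ NP] := Sl.
  by exists N => n Nn; rewrite distrC; apply: NP.
have T0 : 0 <= T by have := vT 0%N; rewrite big_ord0.
have [||l lP] := mono (fun i => v i + `|v i|).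
- by move=> i; rewrite -lerBlDr sub0r lerNl; have := ler_norm (- v i); rewrite normrN.
- move=> n; rewrite big_split /=.
  have := vT n; have : \sum_(i < n) v i <= \sum_(i < n) `|v i|.
    by apply: ler_sum => i _; apply: ler_norm.
  lra.
have [||m mP] := mono (fun i => `|v i|); first by move=> i; apply: normr_ge0.
  by move=> n; have := vT n; lra.
exists (l - m) => e e0; have e2 : 0 < e / 2 by rewrite divr_gt0.
have [N NP] := lP _ e2; have [N' NP'] := mP _ e2.
exists (maxn N N') => n; rewrite geq_max => /andP[/NP a /NP' b].
move: a; rewrite big_split /= => a.
have -> : \sum_(i < n) v i - (l - m) = (\sum_(i < n) v i + \sum_(i < n) `|v i| - l)
   - (\sum_(i < n) `|v i| - m) by ring.
by apply: le_trans (ler_normB _ _) _; lra.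
Qed.

Lemma csum_exists (u : nat -> C) (T : R) : (forall n, \sum_(i < n) nm (u i) <= T) ->
  exists l, is_csum u l.
Proof.
move=> uT.
have [n|a aP] := @real_series_cvg (fun i => complex.Re (u i)) T.
  by apply: le_trans (uT n); apply: ler_sum => i _; apply: Re_le_nm.
have [n|b bP] := @real_series_cvg (fun i => complex.Im (u i)) T.
  by apply: le_trans (uT n); apply: ler_sum => i _; apply: Im_le_nm.
exists (a +i* b)%C => e e0; have e2 : 0 < e / 2 by rewrite divr_gt0.
have [N NP] := aP _ e2; have [N' NP'] := bP _ e2.
exists (maxn N N') => n; rewrite geq_max => /andP[/NP h /NP' h'].
apply: le_trans (nm_ReIm _) _.
have ReS : complex.Re (\sum_(i < n) u i) = \sum_(i < n) complex.Re (u i).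
  by apply: (big_morph (@complex.Re R)) => // -[x y] [x' y'].
have ImS : complex.Im (\sum_(i < n) u i) = \sum_(i < n) complex.Im (u i).
  by apply: (big_morph (@complex.Im R)) => // -[x y] [x' y'].
have -> : complex.Re (\sum_(i < n) u i - (a +i* b)%C) = \sum_(i < n) complex.Re (u i) - a.
  by rewrite -ReS; case: (\sum_(i < n) u i).
have -> : complex.Im (\sum_(i < n) u i - (a +i* b)%C) = \sum_(i < n) complex.Im (u i) - b.
  by rewrite -ImS; case: (\sum_(i < n) u i).
lra.
Qed.

Lemma c2bound_series (D : set C) (L : R) (f df : nat -> C -> C) (A : nat -> R) (T : R) : 0 <= L ->
  (forall n, c2bound D L (f n) (df n) (A n)) -> (forall n, \sum_(i < n) A i <= T) ->
  exists F dF, [/\ forall s, D s -> is_csum (fun n => f n s) (F s),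
    forall s, D s -> is_csum (fun n => df n s) (dF s) & c2bound D L F dF T].
Proof.
move=> L0 fA AT.
have A0 n : 0 <= A n by have [] := fA n.
have T0 : 0 <= T by have := AT 0%N; rewrite big_ord0.
have bound (u : nat -> C) (c : R) : 0 <= c -> (forall n, nm (u n) <= c * A n) ->
    forall n, \sum_(i < n) nm (u i) <= c * T.
  move=> c0 h n; apply: (@le_trans _ _ (\sum_(i < n) c * A i)); first by apply: ler_sum => i _; apply: h.
  by rewrite -mulr_sumr ler_wpM2l.
have /choice [F FP] : forall s, exists l, D s -> is_csum (fun n => f n s) l.
  move=> s; have [Ds|nD] := pselect (D s); last by exists 0.
  have [|l lP] := @csum_exists (fun n => f n s) (1 * T); last by exists l.
  by apply: (bound (fun n => f n s)) => // n; rewrite mul1r; have [_ h _ _ _] := fA n; apply: h.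
have /choice [dF dFP] : forall s, exists l, D s -> is_csum (fun n => df n s) l.
  move=> s; have [Ds|nD] := pselect (D s); last by exists 0.
  have [|l lP] := @csum_exists (fun n => df n s) (L * T); last by exists l.
  by apply: (bound (fun n => df n s)) => // n; have [_ _ h _ _] := fA n; apply: h.
exists F, dF; split=> //.
have lim (u : nat -> C) l (c : R) : 0 <= c -> is_csum u l -> (forall n, nm (u n) <= c * A n) ->
    nm l <= c * T.
  move=> c0 ul h; apply: is_csum_le ul => n.
  by apply: le_trans (nm_sum _ _ _) _; apply: (bound u).
split=> // [s Ds|s Ds|s t Ds Dt|s t Ds Dt].
- rewrite -[T]mul1r; apply: (lim (fun n => f n s)) => // [|n]; first exact: FP.
  by rewrite mul1r; have [_ h _ _ _] := fA n; apply: h.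
- apply: (lim (fun n => df n s)) => // [|n]; first exact: dFP.
  by have [_ _ h _ _] := fA n; apply: h.
- rewrite -mulrA [T * _]mulrC mulrA.
  apply: (lim (fun n => f n t - f n s)) => [||n].
  + by rewrite mulr_ge0 ?nm_ge0.
  + by apply: is_csumB; apply: FP.
  by rewrite -mulrA [nm _ * A n]mulrC mulrA; have [_ _ _ h _] := fA n; apply: h.
- rewrite -mulrA [T * _]mulrC mulrA.
  apply: (lim (fun n => f n t - f n s - (t - s) * df n s)) => [||n].
  + by rewrite mulr_ge0 ?exprn_ge0 ?nm_ge0.
  + by apply: is_csumB; [apply: is_csumB; apply: FP|apply/is_csumZ/dFP].
  by rewrite -mulrA [nm _ ^+ 2 * A n]mulrC mulrA; have [_ _ _ _ h] := fA n; apply: h.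
Qed.

Lemma near_nm (a : C^o) (P : C^o -> Prop) :
  (\forall z \near a, P z) <-> exists2 e : R, 0 < e & forall z, nm (z - a) < e -> P z.
Proof.
split=> [/nbhs_ballP [e /= e0 h]|[e e0 h]].
  have er : e = (complex.Re e)%:C%C by rewrite RRe_real // gtr0_real.
  exists (complex.Re e); first by move: e0; rewrite {1}er ltcR.
  move=> z za; apply: h; rewrite /ball /= er nmE ltcR nmC.
  exact: za.
apply/nbhs_ballP; exists e%:C%C; first by rewrite /= ltcR.
by move=> z; rewrite /ball /= nmE ltcR nmC; apply: h.
Qed.

Lemma near_nm_punctured (a : C^o) (P : C^o -> Prop) :
  (\forall z \near a^', P z) <->
  exists2 e : R, 0 < e & forall z, z != a -> nm (z - a) < e -> P z.
Proof.
rewrite /dnbhs /within; split=> [/near_nm [e e0 h]|[e e0 h]].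
  by exists e => // z za ze; apply: h.
by apply/near_nm; exists e => // z ze za; apply: h.
Qed.

Lemma cvg_nm (u : nat -> C^o) (l : C^o) :
  (forall e : R, 0 < e -> exists N, forall n, (N <= n)%N -> nm (u n - l) <= e) ->
  u @ \oo --> l.
Proof.
move=> h; apply/cvgrPdist_le => e e0.
have er : e = (complex.Re e)%:C%C by rewrite RRe_real // gtr0_real.
have [|N NP] := h (complex.Re e); first by move: e0; rewrite {1}er ltcR.
exists N => // n /= Nn; rewrite distrC er nmE lecR; exact: NP.
Qed.

Lemma c2bound_is_derive (D : set C) (L : R) (f df : C -> C) (A : R) (a : C) :
  c2bound D L f df A -> (\forall z \near (a : C^o), D z) ->
  is_derive (a : C^o) 1 (f : C^o -> C^o) (df a).
Proof.
move=> [A0 _ _ _ h] /near_nm [e e0 eD].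
have Da : D a by apply: eD; rewrite subrr nm0.
suff cv : (fun t : C^o => t^-1 *: ((f : C^o -> C^o) (t *: 1 + a) - f a)) @ (0 : C^o)^' --> (df a : C^o).
  split; first by apply/cvg_ex; exists (df a).
  exact: cvg_lim cv.
apply/cvgrPdist_le => d d0.
have dr : d = (complex.Re d)%:C%C by rewrite RRe_real // gtr0_real.
have d'0 : 0 < complex.Re d by move: d0; rewrite {1}dr ltcR.
set d' := complex.Re d in dr d'0.
pose c := L ^+ 2 * A + 1.
have LA : 0 <= L ^+ 2 * A by rewrite mulr_ge0 // sqr_ge0.
have c0 : 0 < c by rewrite /c; lra.
apply/near_nm_punctured; exists (Num.min e (d' / c)).
  by rewrite lt_min e0 divr_gt0.
move=> t t0; rewrite subr0 lt_min => /andP[te tc].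
have -> : t *: 1 + a = t + a by rewrite /GRing.scale /= mulr1.
have Dt : D (t + a) by apply: eD; rewrite addrK.
rewrite dr nmE lecR.
have -> : df a - t^-1 *: (f (t + a) - f a) = - (t^-1 * (f (t + a) - f a - (t + a - a) * df a)).
  by rewrite /GRing.scale /= addrK; field.
rewrite nmN nmM nmV; have := h _ _ Da Dt; rewrite addrK => ht.
have nt : 0 < nm t by rewrite nm_gt0.
rewrite mulrC ler_pdivrMr //; apply: le_trans ht _.
rewrite expr2 mulrA ler_wpM2r ?nm_ge0 //.
have : nm t * c <= d' by rewrite -ler_pdivlMr // ltW.
by rewrite /c mulrDr mulr1 [nm t * _]mulrC; have := ltW nt; lra.
Qed.

End ComplexSeries.

Section ComplexExponential.
Variable R : realType.
Local Notation C := R[i].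
Implicit Types (x y : R) (z w s : C).

Lemma mvt_zero (f df : R -> R) x : (forall y, is_derive y 1 f (df y)) -> 0 < x ->
  exists2 c, 0 < c < x & f x - f 0 = df c * x.
Proof.
move=> fd x0; have fc : {within `[0, x], continuous f}.
  by apply: derivable_within_continuous => y _; have [] := fd y.
have [c] := MVT x0 (fun y _ => fd y) fc.
by rewrite in_itv /= subr0 => cx h; exists c.
Qed.

Lemma abs_sin_le x : `|sin x| <= `|x|.
Proof.
suff pos y : 0 < y -> `|sin y| <= y.
  have [x0|x0|->] := ltgtP x 0; last by rewrite sin0 normr0.
    by rewrite -normrN -sinN -(normrN x); apply: le_trans (pos _ _) (ler_norm _); rewrite oppr_gt0.
  by apply: le_trans (pos _ x0) (ler_norm _).
move=> y0; have [c _] := mvt_zero (@is_derive_sin R) y0.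
rewrite sin0 subr0 => ->; rewrite normrM (gtr0_norm y0); apply: ler_piMl; first exact: ltW.
by rewrite ler_norml cos_geN1 cos_le1.
Qed.

Lemma abs_cos_sub1_le x : `|cos x - 1| <= x ^+ 2.
Proof.
suff pos y : 0 < y -> `|cos y - 1| <= y ^+ 2.
  have [x0|x0|->] := ltgtP x 0; last by rewrite cos0 subrr normr0 sqr_ge0.
    by rewrite -cosN -sqrrN; apply: pos; rewrite oppr_gt0.
  exact: pos.
move=> y0; have [c /andP[c0 cy]] := mvt_zero (@is_derive_cos R) y0.
rewrite cos0 => ->; rewrite normrM normrN (gtr0_norm y0) expr2 ler_pM2r //.
by apply: le_trans (abs_sin_le _) _; rewrite gtr0_norm // ltW.
Qed.

Lemma abs_sin_sub_le x : `|x| <= 1 -> `|sin x - x| <= x ^+ 2.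
Proof.
suff pos y : 0 < y -> y <= 1 -> `|sin y - y| <= y ^+ 2.
  have [x0|x0|->] := ltgtP x 0; last by rewrite sin0 subrr normr0 sqr_ge0.
    rewrite -normrN => x1; have := pos (- x); rewrite oppr_gt0 x0 => /(_ isT).
    move=> /(_ (le_trans (ler_norm _) x1)); rewrite sinN sqrrN -normrN.
    by rewrite (_ : - (- sin x - - x) = sin x - x) //; ring.
  by move=> x1; apply: pos => //; apply: le_trans (ler_norm _) x1.
move=> y0 y1.
have fd (u : R) : is_derive u 1 (fun t : R => sin t - t) (cos u - 1).
  by apply: is_deriveB.
have [c /andP[c0 cy]] := mvt_zero fd y0.
rewrite sin0 !subr0 => ->; rewrite normrM (gtr0_norm y0) expr2 ler_pM2r //.
apply: le_trans (abs_cos_sub1_le _) _; rewrite expr2.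
have c1 : c <= 1 by lra.
nra.
Qed.

Lemma expR_taylor1 x : `|x| <= 2^-1 -> `|expR x - 1 - x| <= 2 * x ^+ 2.
Proof.
move=> /ler_normlP [x1 x2].
have h1 := expR_ge1Dx x; have h2 := expR_ge1Dx (- x).
have h3 : expR x * expR (- x) = 1 by rewrite -expRD subrr expR0.
have e0 := expR_gt0 x.
have x20 := sqr_ge0 x.
rewrite ler_norml; apply/andP; split; first by lra.
have : expR x * (1 - x) <= 1 by rewrite -[leRHS]h3 ler_pM2l.
move=> h4.
have h5 : 0 <= x ^+ 2 * (1 - 2 * x) by rewrite mulr_ge0 ?sqr_ge0 //; lra.
have h6 : 1 <= (1 + x + 2 * x ^+ 2) * (1 - x).
  have -> : (1 + x + 2 * x ^+ 2) * (1 - x) = 1 + x ^+ 2 * (1 - 2 * x) by ring.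
  lra.
have h7 : expR x <= 1 + x + 2 * x ^+ 2.
  by rewrite -(ler_pM2r (_ : 0 < 1 - x)); lra.
lra.
Qed.

Lemma cexpD z w : cexp (z + w) = cexp z * cexp w.
Proof.
case: z w => [a b] [c d]; rewrite /cexp /= expRD cosD sinD.
apply/eqP; rewrite eq_complex /=; apply/andP; split; apply/eqP; ring.
Qed.

Lemma cexp0 : cexp 0 = 1 :> C.
Proof. by rewrite /cexp /= expR0 cos0 sin0 mulr1 mulr0. Qed.

Lemma nm_cexp z : nm (cexp z) = expR (complex.Re z).
Proof.
apply/eqP; rewrite -(@eqrXn2 _ 2) ?nm_ge0 ?expR_ge0 //.
rewrite nm_sqr /cexp /= !exprMn -mulrDr cos2Dsin2 mulr1 //.
Qed.

Lemma cexp_neq0 z : cexp z != 0.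
Proof. by rewrite -nm_gt0 nm_cexp expR_gt0. Qed.

Lemma cexpN z : cexp (- z) = (cexp z)^-1.
Proof.
by apply: (mulfI (cexp_neq0 z)); rewrite -cexpD subrr cexp0 divff ?cexp_neq0.
Qed.

Lemma cexp_taylor_small z : nm z <= 2^-1 -> nm (cexp z - 1 - z) <= 6 * nm z ^+ 2.
Proof.
case: z => a b; set z := (a +i* b)%C => z1.
have a1 : `|a| <= 2^-1 by apply: le_trans (Re_le_nm z) z1.
have b1 : `|b| <= 2^-1 by apply: le_trans (Im_le_nm z) z1.
apply: le_trans (nm_ReIm _) _.
have -> : complex.Im (cexp z - 1 - z) = expR a * sin b - b.
  by rewrite /cexp /=; congr (_ - _); apply: subr0.
rewrite nm_sqr /cexp /=.
have ea := expR_taylor1 a1; have cb := abs_cos_sub1_le b; have sb := abs_sin_le b.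
have sb2 : `|sin b - b| <= b ^+ 2 by apply: abs_sin_sub_le; apply: le_trans b1 _; lra.
have a22 : a ^+ 2 = `|a| ^+ 2 by rewrite real_normK ?num_real.
have b22 : b ^+ 2 = `|b| ^+ 2 by rewrite real_normK ?num_real.
have cos1 : `|cos b| <= 1 by rewrite ler_norml cos_geN1 cos_le1.
have ea1 : `|expR a - 1| <= 2 * `|a|.
  have -> : expR a - 1 = (expR a - 1 - a) + a by ring.
  apply: le_trans (ler_normD _ _) _.
  have := normr_ge0 a; nra.
have re : `|expR a * cos b - 1 - a| <= 2 * `|a| ^+ 2 + 2 * `|b| ^+ 2.
  have -> : expR a * cos b - 1 - a = (expR a - 1 - a) * cos b + (1 + a) * (cos b - 1) by ring.
  apply: le_trans (ler_normD _ _) _; rewrite !normrM.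
  have h1 : `|expR a - 1 - a| * `|cos b| <= 2 * `|a| ^+ 2 * 1 by apply: ler_pM; rewrite // -a22.
  have h2 : `|1 + a| * `|cos b - 1| <= 2 * `|b| ^+ 2.
    apply: ler_pM; rewrite // -?b22 //.
    by apply: le_trans (ler_normD _ _) _; rewrite normr1; lra.
  lra.
have im : `|expR a * sin b - b| <= 2 * (`|a| * `|b|) + `|b| ^+ 2.
  have -> : expR a * sin b - b = (expR a - 1) * sin b + (sin b - b) by ring.
  apply: le_trans (ler_normD _ _) _; rewrite !normrM.
  have h1 : `|expR a - 1| * `|sin b| <= 2 * `|a| * `|b| by apply: ler_pM.
  rewrite -b22; lra.
have := sqr_ge0 (`|a| - `|b|); rewrite sqrrB.
have := sqr_ge0 `|a|; have := sqr_ge0 `|b|.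
rewrite a22 b22; lra.
Qed.

Lemma cexp_taylor (H : R) : exists2 K, 0 <= K &
  forall z, nm z <= H -> nm (cexp z - 1 - z) <= K * nm z ^+ 2.
Proof.
pose M := expR H + 1 + `|H|.
have M0 : 0 <= M by rewrite /M; have := expR_ge0 H; have := normr_ge0 H; lra.
exists (6 + 4 * M); first by lra.
move=> z zH; have z2 : 0 <= nm z ^+ 2 by apply: sqr_ge0.
have [z1|z1] := lerP (nm z) 2^-1.
  by apply: le_trans (cexp_taylor_small z1) _; rewrite ler_wpM2r //; lra.
apply: (@le_trans _ _ M).
  apply: le_trans (nmB _ _) _; rewrite /M; apply: lerD; last exact: le_trans zH (ler_norm _).
  apply: le_trans (nmB _ _) _; rewrite nm1 lerD2r nm_cexp ler_expR.
  by apply: le_trans zH; apply: le_trans (Re_le_nm z); apply: ler_norm.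
have h : 4^-1 <= nm z ^+ 2 by have := nm_ge0 z; nra.
nra.
Qed.

Lemma c2bound_cexp (B : R) c : exists A,
  c2bound [set s | nm s <= B] 1 (fun s => cexp (c * s)) (fun s => c * cexp (c * s)) A.
Proof.
pose H := 2 * (nm c * `|B|).
have [K K0 KP] := cexp_taylor H.
pose E := expR (nm c * `|B|).
have E0 : 0 <= E by apply: expR_ge0.
have c0 := nm_ge0 c; have B0 := normr_ge0 B.
have H0 : 0 <= H by rewrite /H mulr_ge0 // mulr_ge0.
have sB s : nm s <= B -> nm s <= `|B| by move=> h; apply: le_trans h (ler_norm _).
have eE s : nm s <= B -> nm (cexp (c * s)) <= E.
  move=> h; rewrite nm_cexp ler_expR; apply: le_trans (ler_norm _) _.
  by apply: le_trans (Re_le_nm _) _; rewrite nmM ler_wpM2l // sB.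
pose A := E + E * nm c + E * K * nm c ^+ 2 + E * (nm c + K * nm c * H).
have k0 : 0 <= E * nm c by rewrite mulr_ge0.
have k1 : 0 <= E * K * nm c ^+ 2 by rewrite !mulr_ge0.
have k2 : 0 <= E * (nm c + K * nm c * H) by rewrite mulr_ge0 // addr_ge0 // !mulr_ge0.
have A0 : 0 <= A by rewrite /A; lra.
have diff s t : cexp (c * t) - cexp (c * s) - (t - s) * (c * cexp (c * s)) =
    cexp (c * s) * (cexp (c * (t - s)) - 1 - c * (t - s)).
  have -> : c * t = c * s + c * (t - s) by ring.
  by rewrite cexpD; ring.
have hH s t : nm s <= B -> nm t <= B -> nm (c * (t - s)) <= H.
  move=> hs ht; rewrite nmM /H mulrCA ler_wpM2l //; apply: le_trans (nmB _ _) _.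
  by have := sB _ hs; have := sB _ ht; lra.
have second s t : nm s <= B -> nm t <= B ->
    nm (cexp (c * t) - cexp (c * s) - (t - s) * (c * cexp (c * s))) <=
    E * K * nm c ^+ 2 * nm (t - s) ^+ 2.
  move=> hs ht; rewrite diff nmM -2!mulrA; apply: ler_pM; rewrite ?nm_ge0 ?eE //.
  by apply: le_trans (KP _ (hH _ _ hs ht)) _; rewrite nmM exprMn.
exists A; split=> //= [s hs|s hs|s t hs ht|s t hs ht].
- by apply: le_trans (eE _ hs) _; rewrite /A; lra.
- rewrite mul1r nmM mulrC; apply: (@le_trans _ _ (E * nm c)); last by rewrite /A; lra.
  by rewrite ler_wpM2r // eE.
- have -> : cexp (c * t) - cexp (c * s) = (cexp (c * t) - cexp (c * s) - (t - s) * (c * cexp (c * s)))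
     + (t - s) * (c * cexp (c * s)) by ring.
  apply: le_trans (nmD _ _) _; apply: (@le_trans _ _ (E * (nm c + K * nm c * H) * nm (t - s))); last first.
    by rewrite mul1r ler_wpM2r ?nm_ge0 // /A; lra.
  have n0 := nm_ge0 (t - s).
  have h1 : nm ((t - s) * (c * cexp (c * s))) <= E * nm c * nm (t - s).
    rewrite !nmM mulrC; apply: ler_wpM2r => //; rewrite mulrC; apply: ler_wpM2r => //; exact: eE.
  have h2 := second _ _ hs ht; have := hH _ _ hs ht; rewrite nmM => h3.
  have h4 : E * K * nm c ^+ 2 * nm (t - s) ^+ 2 <= E * (K * nm c * H) * nm (t - s).
    have -> : E * K * nm c ^+ 2 * nm (t - s) ^+ 2 = (E * K * nm c * nm (t - s)) * (nm c * nm (t - s)) by ring.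
    have -> : E * (K * nm c * H) * nm (t - s) = (E * K * nm c * nm (t - s)) * H by ring.
    by apply: ler_wpM2l => //; rewrite !mulr_ge0.
  lra.
- apply: le_trans (second _ _ hs ht) _; rewrite expr1n mul1r ler_wpM2r ?sqr_ge0 // /A; lra.
Qed.

Definition cpow x s : C := cexp (s * (ln x)%:C%C).

Lemma cpowM x y s : 0 < x -> 0 < y -> cpow (x * y) s = cpow x s * cpow y s.
Proof. by move=> x0 y0; rewrite /cpow lnM ?posrE // rmorphD mulrDr cexpD. Qed.

Lemma cpowX x n s : 0 < x -> cpow (x ^+ n) s = cpow x s ^+ n.
Proof.
move=> x0; elim: n => [|n IH]; first by rewrite !expr0 /cpow ln1 mulr0 cexp0.
by rewrite !exprS cpowM ?exprn_gt0 // IH.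
Qed.

Lemma nm_cpow x s : nm (cpow x s) = expR (complex.Re s * ln x).
Proof.
rewrite nm_cexp; congr expR; case: s => a b /=.
by rewrite mulr0 subr0.
Qed.

Lemma cpow_neq0 x s : cpow x s != 0. Proof. exact: cexp_neq0. Qed.

End ComplexExponential.

(** * Meromorphic functions *)

Section Meromorphy.
Variable R : realType.
Local Notation C := (R[i]^o).
Implicit Types (f g : C -> C) (a c l s z : C).

Definition mero_at f a := exists (k : nat) (g : C -> C),
  holomorphic_at g a /\ \forall z \near a^', f z = g z / (z - a) ^+ k.

Lemma near_punctured_sub a (P : C -> Prop) : (\forall z \near a, P z) -> \forall z \near a^', P z.
Proof. by move=> /near_nm [e e0 h]; apply/near_nm_punctured; exists e => // z _; apply: h. Qed.

Lemma holomorphic_mero f a : holomorphic_at f a -> mero_at f a.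
Proof.
by move=> hf; exists 0%N, f; split=> //; apply: nearW => z; rewrite expr0 divr1.
Qed.

Lemma mero_eq f g a : (\forall z \near a^', f z = g z) -> mero_at f a -> mero_at g a.
Proof.
move=> fg [k [h [hh fh]]]; exists k, h; split=> //.
by apply: filterS2 fg fh => z <-.
Qed.

Lemma derivable_mulr f g z : derivable f z 1 -> derivable g z 1 ->
  derivable (fun w => f w * g w : C) z 1.
Proof. by move=> hf hg; exact: (@derivableM _ _ f g z 1 hf hg). Qed.

Lemma derivable_addr f g z : derivable f z 1 -> derivable g z 1 ->
  derivable (fun w => f w + g w : C) z 1.
Proof. by move=> hf hg; exact: (@derivableD _ _ _ f g z 1 hf hg). Qed.

Lemma derivable_subX a k z : derivable (fun w : C => (w - a) ^+ k : C) z 1.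
Proof.
have d1 : derivable (fun w : C => w - a : C) z 1.
  have -> : (fun w : C => w - a : C) = (id : C -> C) - cst a by apply/funext.
  by apply: derivableB; [exact: derivable_id|exact: derivable_cst].
elim: k => [|k IH].
  have -> : (fun w : C => (w - a) ^+ 0 : C) = cst 1 by apply/funext => w; rewrite expr0.
  exact: derivable_cst.
have -> : (fun w : C => (w - a) ^+ k.+1 : C) = (fun w : C => (w - a) * (w - a) ^+ k : C).
  by apply/funext => w; rewrite exprS.
exact: (derivable_mulr d1 IH).
Qed.

Lemma holomorphic_powerM k f a : holomorphic_at f a ->
  holomorphic_at (fun z => (z - a) ^+ k * f z) a.
Proof.
apply: filterS => z fz.
exact: (derivable_mulr (@derivable_subX a k z) fz).
Qed.

Lemma mero_punctured_eq a (P : C -> Prop) :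
  (forall z, z != a -> P z) -> \forall z \near a^', P z.
Proof. by move=> h; apply/near_nm_punctured; exists 1 => // z za _; apply: h. Qed.

Lemma meroD f g a : mero_at f a -> mero_at g a -> mero_at (fun z => f z + g z) a.
Proof.
move=> [k [F [hF fF]]] [m [G [hG gG]]].
exists (k + m)%N, (fun z => (z - a) ^+ m * F z + (z - a) ^+ k * G z); split.
  have h1 := holomorphic_powerM m hF; have h2 := holomorphic_powerM k hG.
  by apply: filterS2 h1 h2 => z d1 d2; exact: (derivable_addr d1 d2).
have ne : \forall z \near a^', z != a by apply: mero_punctured_eq.
apply: (@filterS3 _ a^' _ _ _ _ _ _ fF gG ne) => z -> -> za.
have za0 : z - a != 0 by rewrite subr_eq0.
by rewrite exprD; field; rewrite !expf_neq0.
Qed.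

Lemma meroM f g a : mero_at f a -> mero_at g a -> mero_at (fun z => f z * g z) a.
Proof.
move=> [k [F [hF fF]]] [m [G [hG gG]]].
exists (k + m)%N, (fun z => F z * G z); split.
  by apply: filterS2 hF hG => z d1 d2; exact: (derivable_mulr d1 d2).
have ne : \forall z \near a^', z != a by apply: mero_punctured_eq.
apply: (@filterS3 _ a^' _ _ _ _ _ _ fF gG ne) => z -> -> za.
have za0 : z - a != 0 by rewrite subr_eq0.
by rewrite exprD; field; rewrite !expf_neq0.
Qed.

Lemma mero_cst c a : mero_at (fun=> c) a.
Proof.
apply: holomorphic_mero; apply/near_nm; exists 1 => // z _; exact: derivable_cst.
Qed.

Lemma mero_sum (I : Type) (r : seq I) (f : I -> C -> C) a :
  (forall i, mero_at (f i) a) -> mero_at (fun z => \sum_(i <- r) f i z) a.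
Proof.
move=> h; elim: r => [|i r IH].
  by under eq_fun do rewrite big_nil; exact: mero_cst.
by under eq_fun do rewrite big_cons; exact: meroD.
Qed.

Lemma is_derive_cexp l z : is_derive z 1 (fun s : C => cexp (l * s) : C) (l * cexp (l * z)).
Proof.
have [A hA] := c2bound_cexp (nm z + 1) l.
apply: (c2bound_is_derive hA); apply/near_nm; exists 1 => // w wz /=.
have -> : w = (w - z) + z by rewrite subrK.
by apply: le_trans (nmD _ _) _; rewrite addrC lerD2l ltW.
Qed.

Lemma mero_inv f a : (forall z, derivable f z 1) -> (f a = 0 -> 'D_1 f a != 0) ->
  mero_at (fun z => (f z)^-1) a.
Proof.
move=> df f'0.
have [fa0|fa0] := eqVneq (f a) 0; last first.
  apply: holomorphic_mero.
  have fc : f @ a --> f a.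
    by apply: differentiable_continuous; apply/derivable1_diffP.
  have : \forall z \near a, f z != 0 by exact: (cvgr_neq0 _ fc fa0).
  by apply: filterS => z fz; exact: (derivableV fz (df z)).
have lim : (fun t : C => t^-1 *: (f (t *: 1 + a) - f a)) @ (0 : C)^' --> 'D_1 f a.
  exact: (df a).
have nz : \forall t \near (0 : C)^', t^-1 *: (f (t *: 1 + a) - f a) != 0.
  exact: (cvgr_neq0 _ lim (f'0 fa0)).
have fnz : \forall z \near a^', f z != 0.
  move/near_nm_punctured: nz => [e e0 h]; apply/near_nm_punctured; exists e => // z za ze.
  have := h (z - a); rewrite subr_eq0 subr0 => /(_ za ze); rewrite fa0 subr0.
  apply: contra => /eqP fz0; apply/eqP.
  by rewrite /GRing.scale /= mulr1 subrK fz0 mulr0.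
exists 2%N, (fun z => (z - a) ^+ 2 / f z); split; last first.
  apply: mero_punctured_eq => z za; have za0 : z - a != 0 by rewrite subr_eq0.
  by rewrite mulrAC divff ?mul1r // expf_neq0.
have at_a : derivable (fun z : C => (z - a) ^+ 2 / f z) a 1.
  apply/cvg_ex; exists ('D_1 f a)^-1.
  have limV := @cvgV _ _ _ (dnbhs_filter (0 : C)) _ _ (f'0 fa0) lim.
  pose q (t : C) : C := t^-1 *: ((t *: 1 + a - a) ^+ 2 / f (t *: 1 + a) - (a - a) ^+ 2 / f a).
  have eq_q : {near (0 : C)^', (fun t : C => (t^-1 *: (f (t *: 1 + a) - f a))^-1 : C) =1 q}.
    apply: mero_punctured_eq => t t0; rewrite /q /GRing.scale /= mulr1 fa0 subrr expr0n mul0r !subr0.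
    by rewrite addrK invfM invrK expr2 -!mulrA mulKf.
  have FF : Filter ((0 : C)^') by exact: dnbhs_filter.
  exact: (cvg_trans (near_eq_cvg eq_q) limV).
move/near_nm_punctured: fnz => [e e0 h]; rewrite /holomorphic_at.
apply/near_nm; exists e; first exact: e0.
move=> z ze.
have [->|za] := eqVneq z a; first exact: at_a.
apply: (derivable_mulr (@derivable_subX a 2 z)).
by apply: derivableV; [exact: h|exact: df].
Qed.

Lemma mero_geometric c l a : l != 0 -> mero_at (fun s => (1 - c * cexp (l * s))^-1) a.
Proof.
move=> l0.
have d (z : C) : is_derive z 1 (fun s : C => 1 - c * cexp (l * s) : C) (- (c * (l * cexp (l * z)))).
  have -> : - (c * (l * cexp (l * z))) = 0 - c *: (l * cexp (l * z)) by rewrite sub0r.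
  apply: is_deriveB; apply: is_deriveZ; exact: is_derive_cexp.
apply: mero_inv => [z|]; first by have [] := d z.
move=> e; have -> := @derive_val _ _ _ _ _ _ _ (d a).
rewrite oppr_eq0 mulf_neq0 //; last by rewrite mulf_neq0 // cexp_neq0.
apply/eqP => c0; move/eqP: e; rewrite c0 mul0r subr0; exact/negP/oner_neq0.
Qed.

End Meromorphy.

(** * Single and double series *)

Section BinomialSeries.
Variable R : realType.
Local Notation C := R[i].
Implicit Types (s u : C).

Fixpoint binc s (m : nat) : C :=
  if m is m'.+1 then binc s m' * (- (s + m'%:R) / m'.+1%:R) else 1.

Lemma binc_rec s m : m.+1%:R * binc s m.+1 = - (s + m%:R) * binc s m.
Proof. by rewrite /= mulrCA [X in binc s m * X]mulrC divfK ?pnatr_eq0 // mulrC. Qed.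

Lemma binc_c2bound (B : R) : exists2 K, 0 <= K &
  forall m, exists dm, c2bound [set s | nm s <= B] 1 (fun s => binc s m) dm (K * 6 ^+ m).
Proof.
pose n := (Num.truncn `|B|).+1.
have nB : B <= n%:R by apply: le_trans (ler_norm _) _; apply: ltW; rewrite truncnS_gt.
have n1 : 1 <= n%:R :> R by rewrite ler1n.
pose a (j : nat) : R := (n%:R + j%:R) / j.+1%:R.
have j0 (j : nat) : 0 < j.+1%:R :> R by rewrite ltr0n.
have a0 j : 0 <= a j by rewrite divr_ge0 // addr_ge0.
have factor j : c2bound [set s | nm s <= B] 1 (fun s => - (s + j%:R) / j.+1%:R)
    (fun=> - (j.+1%:R)^-1) (a j).
  have nmj : nm (j.+1%:R : C)^-1 = (j.+1%:R)^-1 by rewrite nmV nm_nat.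
  have jn : j.+1%:R != 0 :> C by rewrite pnatr_eq0.
  have aj : (j.+1%:R)^-1 <= a j.
    by rewrite /a ler_pdivlMr // mulVf ?gt_eqF //; have := ler0n R j; lra.
  split=> [//|s sB|s sB|s t sB tB|s t sB tB].
  - rewrite nmM nmj nmN; apply: ler_wpM2r; first by rewrite invr_ge0 ltW.
    by apply: le_trans (nmD _ _) _; rewrite nm_nat lerD2r; apply: le_trans sB nB.
  - by rewrite nmN nmj mul1r.
  - have -> : - (t + j%:R) / j.+1%:R - - (s + j%:R) / j.+1%:R = - (t - s) / (j.+1%:R : C).
      by move: (j.+1%:R : C) jn => J jn; field.
    by rewrite nmM nmj nmN mul1r mulrC; apply: ler_wpM2r; rewrite ?nm_ge0.
  - have -> : - (t + j%:R) / j.+1%:R - - (s + j%:R) / j.+1%:R - (t - s) * - (j.+1%:R)^-1 = 0 :> C.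
      by move: (j.+1%:R : C) jn => J jn; field.
    by rewrite nm0 !mulr_ge0 ?exprn_ge0 ?nm_ge0.
pose P (m : nat) : R := \prod_(j < m) a j.
have P0 m : 0 <= P m by apply: prodr_ge0.
have base m : exists dm, c2bound [set s | nm s <= B] 1 (fun s => binc s m) dm (3 ^+ m * P m).
  elim: m => [|m [dm hm]].
    exists (fun=> 0); rewrite /P big_ord0 mulr1 expr0.
    by have := c2bound_cst [set s | nm s <= B] ler01 (1 : C); rewrite nm1.
  exists (fun s => dm s * (- (s + m%:R) / m.+1%:R) + binc s m * - (m.+1%:R)^-1).
  have -> : 3 ^+ m.+1 * P m.+1 = 3 * (3 ^+ m * P m * a m).
    by rewrite /P big_ord_recr /= exprS; ring.
  exact: (c2boundM ler01 hm (factor m)).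
have P2 m : P m <= n%:R ^+ n * 2 ^+ m.
  have an j : a j <= n%:R.
    rewrite /a ler_pdivrMr // -(natr1 j).
    have : 0 <= (n%:R - 1) * j%:R :> R by rewrite mulr_ge0 ?subr_ge0.
    by rewrite mulrDr mulrBl mulr1 mul1r; lra.
  have Pn k : P k <= n%:R ^+ k.
    elim: k => [|k IH]; first by rewrite /P big_ord0 expr0.
    have -> : P k.+1 = P k * a k by rewrite /P big_ord_recr.
    by rewrite exprSr; apply: ler_pM.
  elim: m => [|m IH].
    rewrite /P big_ord0 expr0 mulr1; exact: exprn_ege1.
  have [mn|nm_] := ltnP m n.
    apply: le_trans (Pn _) _; apply: (@le_trans _ _ (n%:R ^+ n)); first exact: ler_weXn2l.
    rewrite ler_peMr ?exprn_ge0 //; apply: exprn_ege1; lra.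
  have -> : P m.+1 = P m * a m by rewrite /P big_ord_recr.
  rewrite exprSr mulrA; apply: ler_pM => //.
  rewrite /a ler_pdivrMr // -(natr1 m); have : n%:R <= m%:R :> R by rewrite ler_nat.
  by lra.
exists (n%:R ^+ n); first exact: exprn_ge0.
move=> m; have [dm hm] := base m; exists dm; apply: (c2bound_le ler01 _ hm).
have -> : 6 = 3 * 2 :> R by ring.
by rewrite exprMn mulrCA ler_wpM2l ?exprn_ge0.
Qed.

Let rho : R := 36^-1.
Let disc := [set u : C | nm u <= rho].

Let c2bound_pow (m : nat) :
  c2bound disc 36 (fun u => u ^+ m) (fun u => m%:R * u ^+ m.-1) (12^-1 ^+ m).
Proof.
have L0 : 0 <= 36 :> R by lra.
elim: m => [|m IH].
  rewrite expr0.
  have -> : (fun u : C => u ^+ 0) = (fun=> 1) by apply/funext => u; rewrite expr0.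
  have -> : (fun u : C => 0%:R * u ^+ 0.-1) = (fun=> 0) by apply/funext => u; rewrite mul0r.
  by have := c2bound_cst disc L0 (1 : C); rewrite nm1.
have hid : c2bound disc 36 id (fun=> 1) rho.
  apply: c2bound_id => //; first by rewrite /rho invr_ge0.
  by rewrite /rho divff // pnatr_eq0.
have -> : (fun u : C => u ^+ m.+1) = (fun u => u ^+ m * id u).
  by apply/funext => u; rewrite exprSr.
have -> : (fun u : C => m.+1%:R * u ^+ m.+1.-1) = (fun u => m%:R * u ^+ m.-1 * id u + u ^+ m * 1).
  apply/funext => u /=; rewrite mulr1 -natr1 mulrDl mul1r; congr (_ + _).
  by case: m {IH} => [|m]; rewrite ?mul0r // exprSr mulrA.
have -> : 12^-1 ^+ m.+1 = 3 * (12^-1 ^+ m * rho) :> R.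
  by rewrite exprSr /rho; field.
by apply: c2boundM.
Qed.

Let geom_half (m : nat) : \sum_(i < m) 2^-1 ^+ i <= 2 :> R.
Proof.
suff -> : \sum_(i < m) 2^-1 ^+ i = 2 * (1 - 2^-1 ^+ m) :> R.
  by have : 0 <= 2^-1 ^+ m :> R by [rewrite exprn_ge0 // invr_ge0]; lra.
elim: m => [|m IH]; first by rewrite big_ord0 expr0 subrr mulr0.
by rewrite big_ord_recr /= IH exprSr; field.
Qed.

Lemma ln_taylor (x y : R) : 0 <= x -> 0 <= y ->
  `|ln (1 + y) - ln (1 + x)| <= `|y - x| /\
  `|ln (1 + y) - ln (1 + x) - (y - x) / (1 + x)| <= (y - x) ^+ 2.
Proof.
move=> x0 y0; pose X := 1 + x; pose Y := 1 + y.
have X0 : 0 < X by rewrite /X; lra.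
have Y0 : 0 < Y by rewrite /Y; lra.
have Xi : 0 < X^-1 by rewrite invr_gt0.
have Yi : 0 < Y^-1 by rewrite invr_gt0.
have up (a b : R) : 0 < a -> 0 < b -> ln b - ln a <= (b - a) / a.
  move=> a0 b0; rewrite -ln_div ?posrE //.
  have -> : b / a = 1 + (b - a) / a by field; rewrite gt_eqF.
  apply: le_ln1Dx.
  rewrite -subr_gt0; have -> : (b - a) / a - -1 = b / a by field; rewrite gt_eqF.
  by rewrite divr_gt0.
have h1 := up X Y X0 Y0; have h2 := up Y X Y0 X0.
have d : Y - X = y - x by rewrite /X /Y; ring.
rewrite -/X -/Y -d.
have X1 : X^-1 <= 1 by rewrite invf_le1 // /X; lra.
have Y1 : Y^-1 <= 1 by rewrite invf_le1 // /Y; lra.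
have XX : X * X^-1 = 1 by rewrite divff // gt_eqF.
have YY : Y * Y^-1 = 1 by rewrite divff // gt_eqF.
have e : (Y - X) * X^-1 - (Y - X) * Y^-1 = (Y - X) ^+ 2 * (X^-1 * Y^-1).
  by field; rewrite !gt_eqF.
have q1 : X^-1 * Y^-1 <= 1 by apply: mulr_ile1 => //; apply: ltW.
have q2 : (Y - X) ^+ 2 * (X^-1 * Y^-1) <= (Y - X) ^+ 2.
  by rewrite ler_piMr // sqr_ge0.
split; last by rewrite ler_norml; apply/andP; split; have := sqr_ge0 (Y - X); lra.
have [h|h] := lerP 0 (Y - X).
  rewrite (ger0_norm h) ler_norml; apply/andP; split.
    have : 0 <= (Y - X) * Y^-1 by rewrite mulr_ge0 // ltW.
    lra.
  apply: le_trans h1 _; apply: ler_piMr => //.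
rewrite (ltr0_norm h) ler_norml; apply/andP; split.
  have h3 : (X - Y) * Y^-1 <= X - Y by apply: ler_piMr => //; lra.
  lra.
have : (Y - X) * X^-1 <= 0 by rewrite mulr_le0_ge0 // ltW.
lra.
Qed.

Let seg := [set u : C | exists2 x : R, 0 <= x <= rho & u = x%:C%C].

Let c2bound_ln :
  c2bound seg 36 (fun u => (ln (1 + complex.Re u))%:C%C) (fun u => (1 + u)^-1) 1.
Proof.
have inv1 (x : R) : 0 <= x -> nm (1 + x%:C%C)^-1 <= 1.
  move=> x0; rewrite nmV -(rmorph1 (real_complex R)) -rmorphD nm_real ger0_norm; last by lra.
  by rewrite invf_le1; lra.
split=> // [_ [x /andP[x0 x1] ->]|_ [x /andP[x0 x1] ->]||] /=.
- rewrite nm_real; have [+ _] := ln_taylor (lexx 0) x0.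
  rewrite addr0 ln1 subr0 subr0 => h; apply: le_trans h _; rewrite ger0_norm //.
  by apply: le_trans x1 _; rewrite /rho; lra.
- by apply: le_trans (inv1 _ x0) _; lra.
- move=> _ _ [x /andP[x0 x1] ->] [y /andP[y0 y1] ->] /=.
  rewrite -!rmorphB !nm_real; have [h _] := ln_taylor x0 y0.
  by apply: le_trans h _; have := normr_ge0 (y - x); lra.
- move=> _ _ [x /andP[x0 x1] ->] [y /andP[y0 y1] ->] /=.
  have -> : (ln (1 + y))%:C%C - (ln (1 + x))%:C%C - (y%:C%C - x%:C%C) * (1 + x%:C%C)^-1 =
     (ln (1 + y) - ln (1 + x) - (y - x) / (1 + x))%:C%C.
    by rewrite !rmorphB rmorphM rmorphB fmorphV rmorphD rmorph1.
  rewrite -rmorphB !nm_real; have [_ h] := ln_taylor x0 y0.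
  by apply: le_trans h _; rewrite real_normK ?num_real //; have := sqr_ge0 (y - x); lra.
Qed.

Lemma c2bound_comp (D D' : set C) (L A A' : R) (f df g dg : C -> C) : 0 <= L ->
  c2bound D' 1 g dg A' -> c2bound D L f df A -> (forall u, D u -> D' (f u)) ->
  c2bound D L (fun u => g (f u)) (fun u => dg (f u) * df u) (A' * (1 + A + A ^+ 2)).
Proof.
move=> L0 [A'0 k0 k1 k2 k3] [A0 h0 h1 h2 h3] DD'.
have A20 := sqr_ge0 A.
split=> [|u Du|u Du|u v Du Dv|u v Du Dv].
- by rewrite mulr_ge0 //; lra.
- apply: le_trans (k0 _ (DD' _ Du)) _; rewrite ler_peMr //; lra.
- rewrite nmM; apply: (@le_trans _ _ (1 * A' * (L * A))).
    by apply: ler_pM; rewrite ?nm_ge0; auto.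
  rewrite mul1r mulrCA ler_wpM2l // ler_wpM2l //; lra.
- apply: le_trans (k2 _ _ (DD' _ Du) (DD' _ Dv)) _; rewrite mul1r.
  apply: (@le_trans _ _ (A' * (L * A * nm (v - u)))); first by rewrite ler_wpM2l // h2.
  rewrite mulrA ler_wpM2r ?nm_ge0 // mulrCA ler_wpM2l // ler_wpM2l //; lra.
- have -> : g (f v) - g (f u) - (v - u) * (dg (f u) * df u) =
     (g (f v) - g (f u) - (f v - f u) * dg (f u)) + dg (f u) * (f v - f u - (v - u) * df u) by ring.
  apply: le_trans (nmD _ _) _.
  have e1 := k3 _ _ (DD' _ Du) (DD' _ Dv).
  have e2 : nm (f v - f u) ^+ 2 <= (L * A * nm (v - u)) ^+ 2.
    by rewrite lerXn2r ?nnegrE ?mulr_ge0 ?nm_ge0 // h2.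
  have e3 : nm (dg (f u) * (f v - f u - (v - u) * df u)) <= 1 * A' * (L ^+ 2 * A * nm (v - u) ^+ 2).
    by rewrite nmM; apply: ler_pM; rewrite ?nm_ge0 //; [apply/k1/DD'|apply: h3].
  apply: (@le_trans _ _ (1 ^+ 2 * A' * (L * A * nm (v - u)) ^+ 2 + 1 * A' * (L ^+ 2 * A * nm (v - u) ^+ 2))).
    by apply: lerD => //; apply: le_trans e1 _; rewrite ler_wpM2l ?mulr_ge0 ?exprn_ge0.
  have -> : 1 ^+ 2 * A' * (L * A * nm (v - u)) ^+ 2 + 1 * A' * (L ^+ 2 * A * nm (v - u) ^+ 2) =
    L ^+ 2 * (A' * (A + A ^+ 2)) * nm (v - u) ^+ 2 by ring.
  rewrite ler_wpM2r ?sqr_ge0 // ler_wpM2l ?sqr_ge0 // ler_wpM2l //; lra.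
Qed.

Lemma quadratic_increment_constant (g : R -> C) (r K : R) : 0 <= r ->
  (forall x y, 0 <= x <= r -> 0 <= y <= r -> nm (g y - g x) <= K * `|y - x| ^+ 2) ->
  g r = g 0.
Proof.
move=> r0 h; apply/eqP; rewrite -subr_eq0 -nm_eq0 eq_le nm_ge0 andbT.
have bound n : nm (g r - g 0) <= K * r ^+ 2 / n.+1%:R.
  pose x (i : nat) : R := r * (i%:R / n.+1%:R).
  have n0 : 0 < n.+1%:R :> R by rewrite ltr0n.
  have xr i : (i <= n.+1)%N -> 0 <= x i <= r.
    move=> ni; rewrite /x mulr_ge0 ?divr_ge0 //= ler_piMr // ler_pdivrMr // mul1r.
    by rewrite ler_nat.
  have -> : g r - g 0 = \sum_(i < n.+1) (g (x i.+1) - g (x i)).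
    rewrite -(big_mkord xpredT (fun i => g (x i.+1) - g (x i))) telescope_sumr //.
    by rewrite /x divff ?gt_eqF // mul0r mulr0 mulr1.
  apply: le_trans (nm_sum _ _ _) _.
  apply: (@le_trans _ _ (\sum_(i < n.+1) K * r ^+ 2 / n.+1%:R ^+ 2)).
    apply: ler_sum => i _; apply: le_trans (h _ _ (xr _ _) (xr _ _)) _ => //.
      by apply: ltnW; apply: ltn_ord.
    rewrite /x -mulrBr -mulrBl -natrB // subSnn mul1r real_normK ?num_real //.
    by rewrite exprMn exprVn mulrA.
  rewrite sumr_const card_ord -mulr_natr le_eqVlt; apply/orP; left; apply/eqP.
  by field; rewrite gt_eqF.
rewrite leNgt; apply/negP => g0.
pose n := Num.truncn (K * r ^+ 2 / nm (g r - g 0)).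
have := bound n; rewrite leNgt => /negP; apply.
by rewrite ltr_pdivrMr ?ltr0n // [ltRHS]mulrC -ltr_pdivrMr // /n truncnS_gt.
Qed.

Lemma binomial_series s (x : R) : 0 <= x <= rho ->
  is_csum (fun m => binc s m * x%:C%C ^+ m) (cpow (1 + x) s)^-1.
Proof.
move=> xr.
have L0 : 0 <= 36 :> R by lra.
have [K K0 KP] := binc_c2bound (nm s).
have bK m : nm (binc s m) <= K * 6 ^+ m by have [dm [_ h _ _ _]] := KP m; apply: h => /=.
pose f m (u : C) := binc s m * u ^+ m.
pose df m (u : C) := binc s m * (m%:R * u ^+ m.-1).
have fP m : c2bound disc 36 (f m) (df m) (K * 2^-1 ^+ m).
  apply: c2bound_le (c2boundZ (binc s m) (c2bound_pow m)) => //.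
  have -> : 2^-1 = 6 * 12^-1 :> R by field.
  by rewrite exprMn mulrA ler_wpM2r ?exprn_ge0 ?invr_ge0.
have sumP m : \sum_(i < m) K * 2^-1 ^+ i <= K * 2.
  by rewrite -mulr_sumr ler_wpM2l.
have [G [dG [GP dGP Gc]]] := c2bound_series L0 fP sumP.
have ode u : disc u -> (1 + u) * dG u + s * G u = 0.
  move=> Du; have h := is_csumD (is_csumZ (1 + u) (dGP _ Du)) (is_csumZ s (GP _ Du)).
  apply: (is_csum_unique h) => e e0.
  have part n : \sum_(i < n) ((1 + u) * df i u + s * f i u) = - df n u.
    elim: n => [|n IH]; first by rewrite big_ord0 /df mul0r mulr0 oppr0.
    rewrite big_ord_recr /= IH /df /f.
    have -> : binc s n.+1 * (n.+1%:R * u ^+ n.+1.-1) = - (s + n%:R) * binc s n * u ^+ n.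
      by rewrite -binc_rec; ring.
    by case: n {IH} => [|n]; rewrite /= ?expr0 ?exprSr; ring.
  pose n0 := Num.truncn (36 * K / e).
  exists n0.+1 => n n0n; rewrite part subr0 nmN.
  have [_ _ h1 _ _] := fP n; apply: le_trans (h1 _ Du) _.
  have n1 : n.+1%:R * 2^-1 ^+ n <= 1 :> R.
    elim: (n) => [|m IH]; first by rewrite expr0 mulr1.
    have : 0 <= 2^-1 ^+ m :> R by rewrite exprn_ge0 // invr_ge0.
    move: IH; rewrite exprSr -(natr1 m.+1) -(natr1 m) => IH hm.
    have := mulr_ge0 (ler0n R m) hm; lra.
  have n2 : 36 * K / e < n%:R by apply: lt_le_trans (truncnS_gt _) _; rewrite ler_nat.
  have n3 : 36 * K <= n%:R * e by rewrite -ler_pdivrMr // ltW.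
  have p0 : 0 <= 2^-1 ^+ n :> R by rewrite exprn_ge0 // invr_ge0.
  have n4 : n%:R * 2^-1 ^+ n <= 1 :> R by move: n1; rewrite -(natr1 n); lra.
  have -> : 36 * (K * 2^-1 ^+ n) = (36 * K) * 2^-1 ^+ n by ring.
  apply: (@le_trans _ _ (n%:R * e * 2^-1 ^+ n)); first exact: ler_wpM2r.
  by rewrite mulrAC -[leRHS]mul1r ler_wpM2r // ltW.
have segD u : seg u -> disc u.
  move=> [y /andP[y0 y1] ->]; suff : nm y%:C%C <= rho by [].
  by rewrite nm_real ger0_norm.
have Gseg : c2bound seg 36 G dG (K * 2).
  case: Gc => a0 a1 a2 a3 a4; split=> // [u /segD|u /segD|u v /segD + /segD|u v /segD + /segD];
    [exact: a1|exact: a2|exact: a3|exact: a4].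
have [A hA] := c2bound_cexp 1 s.
have Eseg := c2bound_comp L0 hA c2bound_ln.
have {}Eseg := Eseg _.
have lnD u : seg u -> nm (ln (1 + complex.Re u))%:C%C <= 1.
  by case: c2bound_ln => _ + _ _ _; apply.
have prod := c2boundM L0 Gseg (Eseg lnD).
case: prod => _ _ _ _ prod.
pose g (y : R) := G y%:C%C * cexp (s * (ln (1 + y))%:C%C).
have gconst : g x = g 0.
  have [x0 x1] := andP xr.
  apply: (@quadratic_increment_constant g x _ x0) => y z /andP[y0 y1] /andP[z0 z1].
  have sy : seg y%:C%C by exists y => //; rewrite y0 (le_trans y1).
  have sz : seg z%:C%C by exists z => //; rewrite z0 (le_trans z1).
  have := prod _ _ sy sz; rewrite /= -rmorphB nm_real.
  have -> : dG y%:C%C * cexp (s * (ln (1 + y))%:C%C) +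
    G y%:C%C * (s * cexp (s * (ln (1 + y))%:C%C) * (1 + y%:C%C)^-1) = 0.
    have y1c : 1 + y%:C%C != 0 :> C.
      by rewrite -(rmorph1 (real_complex R)) -rmorphD (inj_eq (@complexI R)) gt_eqF //; lra.
    have -> : dG y%:C%C = - (s * G y%:C%C) / (1 + y%:C%C).
      by apply: (mulIf y1c); rewrite divfK //; have := ode _ (segD _ sy) => /eqP;
         rewrite addr_eq0 mulrC => /eqP.
    by field.
  by rewrite mulr0 subr0; apply.
have G0 : G 0 = 1.
  have D0 : disc 0 by rewrite /disc /= nm0 /rho invr_ge0.
  apply: (is_csum_unique (GP _ D0)).
  rewrite -[X in is_csum _ X]addr0.
  have -> : 1 + 0 = \sum_(i < 1) f i 0 + 0 by rewrite big_ord1 /f expr0 mulr1.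
  apply: is_csum_shift; apply: (is_csum_eq _ (@is_csum0 R)) => i.
  by rewrite /f add1n expr0n mulr0.
have Gx : G x%:C%C * cpow (1 + x) s = 1.
  by move: gconst; rewrite /g /cpow addr0 ln1 mulr0 cexp0 mulr1 G0.
have <- : G x%:C%C = (cpow (1 + x) s)^-1.
  by apply: (mulIf (cpow_neq0 (1 + x) s)); rewrite mulVf ?cpow_neq0.
apply: GP; apply: segD; by exists x.
Qed.

End BinomialSeries.

Lemma sub1r_geometric (A : comNzRingType) (x : A) n :
  (1 - x) * \sum_(i < n) x ^+ i = 1 - x ^+ n.
Proof. by rewrite -[LHS]opprK -mulNr opprB -subrX1 opprB. Qed.

Lemma powers_vanish (R : realType) (x e : R) : 0 <= x -> x < 1 -> 0 < e ->
  exists N, forall n, (N <= n)%N -> x ^+ n <= e.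
Proof.
move=> x0 x1 e0.
suff [N NP] : exists N, x ^+ N <= e.
  by exists N => n Nn; apply: le_trans NP; rewrite ler_wiXn2l // ltW.
have [->|xn0] := eqVneq x 0; first by exists 1%N; rewrite expr1 ltW.
have xp : 0 < x by rewrite lt_def xn0.
have xi1 : 1 < x^-1 by rewrite invf_gt1.
have xd : 0 < x^-1 - 1 by rewrite subr_gt0.
pose n := (Num.truncn (e^-1 / (x^-1 - 1))).+1; exists n.
have h := bernoulli n (ltW xd); rewrite (_ : 1 + (x^-1 - 1) = x^-1) in h; last by ring.
have : e^-1 / (x^-1 - 1) < n%:R by rewrite truncnS_gt.
rewrite ltr_pdivrMr // => h'.
have : e^-1 <= x^-1 ^+ n by apply: le_trans (ltW h') _; apply: le_trans h; rewrite lerDr ler01.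
by rewrite exprVn lef_pV2 // posrE exprn_gt0.
Qed.

Lemma geometric_sum_le (R : realType) (x : R) n : 0 <= x -> x < 1 -> \sum_(i < n) x ^+ i <= (1 - x)^-1.
Proof.
move=> x0 x1; have d0 : 0 < 1 - x by rewrite subr_gt0.
rewrite -[leRHS]mul1r ler_pdivlMr // mulrC sub1r_geometric.
by rewrite gerBl exprn_ge0.
Qed.

Lemma cpowVE (R : realType) (x : R) (s : R[i]) : (cpow x s)^-1 = cexp (- (ln x)%:C%C * s).
Proof. by rewrite /cpow -cexpN mulrC mulNr. Qed.

Lemma mero_cexp (R : realType) (l a : R[i]) : mero_at (fun s => cexp (l * s)) a.
Proof.
apply: holomorphic_mero; apply/near_nm; exists 1 => // s _.
by have [] := is_derive_cexp l s.
Qed.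

Lemma mero_cpowV (R : realType) (x : R) (a : R[i]) : mero_at (fun s => (cpow x s)^-1) a.
Proof.
have -> : (fun s => (cpow x s)^-1) = (fun s : R[i] => cexp (- (ln x)%:C%C * s)).
  by apply/funext => s; rewrite cpowVE.
exact: mero_cexp.
Qed.

Section SingleSum.
Variable R : realType.
Local Notation C := R[i].
Variables (q c : R) (g : C).
Hypotheses (q1 : 1 < q) (c0 : 0 <= c).

Let q0 : 0 < q. Proof. exact: lt_trans ltr01 q1. Qed.

Let qi (m : nat) : 0 < q ^- m. Proof. by rewrite invr_gt0 exprn_gt0. Qed.

Let lnq0 : ln q != 0. Proof. by rewrite gt_eqF // ln_gt0. Qed.

Let z (s : C) : C := (cpow q s)^-1.

Let zE s : z s = cexp (- (ln q)%:C%C * s).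
Proof. exact: cpowVE. Qed.

Lemma powers_unbounded (b : R) : exists n, b <= q ^+ n.
Proof.
pose n := (Num.truncn (b / (q - 1))).+1; exists n.
have q10 : 0 < q - 1 by rewrite subr_gt0.
have h := bernoulli n (ltW q10); rewrite (_ : 1 + (q - 1) = q) in h; last by ring.
have : b / (q - 1) < n%:R by rewrite truncnS_gt.
by rewrite ltr_pdivrMr // => h'; lra.
Qed.

Variable B : nat.
Hypothesis cB : 36 * c <= q ^+ B.

Let r : R := c / q ^+ B.

Let r0 : 0 <= r. Proof. by rewrite divr_ge0 // exprn_ge0 // ltW. Qed.

Let r36 : r <= 36^-1.
Proof.
rewrite /r ler_pdivrMr ?exprn_gt0 //; have := cB.
have h : 0 <= 36^-1 :> R by rewrite invr_ge0.
by move=> /(ler_wpM2l h); rewrite mulKf ?pnatr_eq0.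
Qed.

Let y (m : nat) (s : C) : C := (q ^- m)%:C%C * (g * z s).

Let term (m : nat) (s : C) : C :=
  (r ^+ m)%:C%C * (binc s m * ((g * z s) ^+ B * (1 - y m s)^-1)).

Let c2bound_power (D : set C) (f df : C -> C) A (n : nat) : c2bound D 1 f df A ->
  exists dfn An, c2bound D 1 (fun s => f s ^+ n) dfn An.
Proof.
move=> h; elim: n => [|n [d [An hn]]].
  exists (fun=> 0), (nm (1 : C)).
  have -> : (fun s => f s ^+ 0) = (fun=> 1 : C) by apply/funext => s; rewrite expr0.
  exact: c2bound_cst ler01 _.
have -> : (fun s => f s ^+ n.+1) = (fun s => f s ^+ n * f s).
  by apply/funext => s; rewrite exprSr.
by eexists; eexists; apply: (c2boundM ler01 hn h).
Qed.

Lemma term_tail (b : R) : exists (m0 : nat) (G dG : C -> C) (A : R),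
  c2bound [set s | nm s <= b] 1 G dG A /\
  forall s, nm s <= b -> is_csum (fun m => term (m0 + m)%N s) (G s).
Proof.
set D := [set s : C | nm s <= b].
have [K K0 KP] := binc_c2bound b.
have [Z hz] := c2bound_cexp b (- (ln q)%:C%C).
have hy := c2boundZ g hz; set Y := nm g * Z in hy.
have Y0 : 0 <= Y by case: hy.
have [m0 m0P] := powers_unbounded (2 * Y).
have [dW [W hW]] := c2bound_power B hy.
have W0 : 0 <= W by case: hW.
have y2 m : (m0 <= m)%N -> q ^- m * Y <= 2^-1.
  move=> mm; have : q ^- m <= q ^- m0.
    by rewrite lef_pV2 ?posrE ?exprn_gt0 // ler_weXn2l // ltW.
  move=> h; apply: (@le_trans _ _ (q ^- m0 * Y)); first exact: ler_wpM2r.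
  by rewrite mulrC ler_pdivrMr ?exprn_gt0 //; lra.
pose V : R := (2^-1)^-1 + 2 / 2^-1 ^+ 2 + 2 * (2 ^+ 2 / 2^-1 ^+ 3).
have V0 : 0 <= V.
  by rewrite /V !addr_ge0 ?mulr_ge0 ?invr_ge0 ?exprn_ge0 ?invr_ge0.
have inv_bound m : (m0 <= m)%N -> exists dv, c2bound D 1 (fun s => (1 - y m s)^-1) dv V.
  move=> mm; have hm := c2boundZ (- (q ^- m)%:C%C) hy.
  have h1 := c2boundD (c2bound_cst D ler01 (1 : C)) hm.
  have nmq : nm (- (q ^- m)%:C%C : C) = q ^- m by rewrite nmN nm_real gtr0_norm.
  rewrite nm1 nmq in h1.
  have h2 : c2bound D 1 (fun s => 1 - y m s) (fun s => 0 + - (q ^- m)%:C%C * (g * (- (ln q)%:C%C * cexp (- (ln q)%:C%C * s)))) 2.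
    apply: (c2bound_le ler01 (A := 1 + q ^- m * Y)); first by have := y2 m mm; lra.
    by apply: c2bound_eq h1 => s _; rewrite /y zE mulNr.
  eexists; apply: (c2boundV ler01 h2 (d := 2^-1)) => [|s Ds]; first by rewrite invr_gt0.
  have : nm (y m s) <= 2^-1.
    apply: le_trans (y2 m mm); rewrite /y nmM nm_real gtr0_norm //.
    apply: ler_wpM2l; first exact: ltW.
    by case: hy => _ h _ _ _; rewrite zE; apply: h.
  move=> h; have : nm 1 <= nm (1 - y m s) + nm (y m s).
    by rewrite -{1}[1](subrK (y m s)) nmD.
  by rewrite nm1; lra.
have bound m : exists dt, c2bound D 1 (term (m0 + m)%N) dt (9 * K * W * V * 2^-1 ^+ m).
  have [dv hv] := inv_bound _ (leq_addr m m0).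
  have [db hb] := KP (m0 + m)%N.
  have hWv := c2boundM ler01 hW hv.
  have hall := c2boundZ (r ^+ (m0 + m))%:C%C (c2boundM ler01 hb hWv).
  eexists; apply: (c2bound_eq (f := fun s => (r ^+ (m0 + m))%:C%C * (binc s (m0 + m) *
      ((g * cexp (- (ln q)%:C%C * s)) ^+ B * (1 - y (m0 + m) s)^-1)))).
    by move=> s _; rewrite /term zE.
  apply: (c2bound_le ler01 _ hall).
  rewrite nm_real ger0_norm ?exprn_ge0 //.
  have -> : r ^+ (m0 + m) * (3 * (K * 6 ^+ (m0 + m) * (3 * (W * V)))) =
     9 * K * W * V * (6 * r) ^+ (m0 + m).
    by rewrite (exprMn (m0 + m) 6 r); ring.
  rewrite ler_wpM2l ?mulr_ge0 //.
  apply: (@le_trans _ _ (2^-1 ^+ (m0 + m))).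
    have r6 : 6 * r <= 2^-1 by have := r36; lra.
    by apply: lerXn2r => //; rewrite nnegrE ?invr_ge0 // mulr_ge0.
  rewrite exprD ler_piMl ?exprn_ge0 ?invr_ge0 // exprn_ile1 ?invr_ge0 //; lra.
have /choice [dt dtP] := bound.
have sumP n : \sum_(i < n) 9 * K * W * V * 2^-1 ^+ i <= 9 * K * W * V * (1 - 2^-1)^-1.
  by rewrite -mulr_sumr ler_wpM2l ?mulr_ge0 // geometric_sum_le ?invr_ge0 //; lra.
have [G [dG [GP _ Gc]]] := c2bound_series ler01 dtP sumP.
by exists m0, G, dG; eexists; split; first exact: Gc.
Qed.

Lemma continuation_ex : exists T : C -> C, forall s, is_csum (fun m => term m s) (T s).
Proof.
have /choice [T TP] : forall s, exists l, is_csum (fun m => term m s) l; last by exists T.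
move=> s; have [m0 [G [dG [A [_ GP]]]]] := term_tail (nm s).
by eexists; apply: (@is_csum_shift _ _ _ m0); exact: GP.
Qed.

Lemma mero_binc m (a : C) : mero_at (fun s => binc s m) a.
Proof.
elim: m => [|m IH]; first exact: mero_cst.
apply: (meroM IH); apply: meroM; last exact: mero_cst.
by apply: holomorphic_mero; apply/near_nm; exists 1.
Qed.

Lemma mero_exp (f : C -> C) n (a : C) : mero_at f a -> mero_at (fun s => f s ^+ n) a.
Proof.
move=> hf; elim: n => [|n IH].
  by under eq_fun do rewrite expr0; exact: mero_cst.
by under eq_fun do rewrite exprS; exact: meroM.
Qed.

Lemma mero_term m (a : C) : mero_at (term m) a.
Proof.
apply: meroM; first exact: mero_cst.
apply: meroM; first exact: mero_binc.
apply: meroM.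
  apply: mero_exp; apply: meroM; first exact: mero_cst.
  by rewrite (_ : z = fun s => cexp (- (ln q)%:C%C * s)); [exact: mero_cexp|apply/funext].
have -> : (fun s => (1 - y m s)^-1) = (fun s => (1 - ((q ^- m)%:C%C * g) * cexp (- (ln q)%:C%C * s))^-1).
  by apply/funext => s; rewrite /y zE mulrA.
by apply: mero_geometric; rewrite oppr_eq0 (inj_eq (@complexI R)).
Qed.

Lemma mero_continuation (T : C -> C) : (forall s, is_csum (fun m => term m s) (T s)) ->
  forall a : C, mero_at T a.
Proof.
move=> TP a; have [m0 [G [dG [A [Gc GP]]]]] := term_tail (nm a + 1).
have sa (s : C) : nm (s - a) < 1 -> nm s <= nm a + 1.
  move=> h; rewrite -[s](subrK a); apply: le_trans (nmD _ _) _; rewrite addrC lerD2l; exact: ltW.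
apply: (@mero_eq _ (fun s => \sum_(m < m0) term m s + G s)).
  apply: near_punctured_sub; apply/near_nm; exists 1 => // s /sa h.
  by apply: (is_csum_unique _ (TP s)); apply: is_csum_shift; apply: GP.
apply: meroD; first by apply: mero_sum => m; apply: mero_term.
apply: holomorphic_mero; apply/near_nm; exists 1 => // s hs.
have [] // := c2bound_is_derive Gc (a := s).
apply/near_nm; exists (1 - nm (s - a)); first by rewrite subr_gt0.
move=> w ws; apply: sa; have -> : w - a = (w - s) + (s - a) by ring.
by apply: le_lt_trans (nmD _ _) _; lra.
Qed.

Lemma continuation_eq (T : C -> C) s : (forall s, is_csum (fun m => term m s) (T s)) ->
  nm (g * z s) < 1 ->
  is_csum (fun b => g ^+ (B + b) * (cpow (c + q ^+ (B + b)) s)^-1) (T s).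
Proof.
move=> TP; set w := g * z s; set p := nm w => p1.
have p0 : 0 <= p by apply: nm_ge0.
have d0 : 0 < 1 - p by rewrite subr_gt0.
have yp m : nm (y m s) <= p.
  rewrite /y nmM nm_real gtr0_norm // -/w ler_piMl //.
  by rewrite invf_le1 ?exprn_gt0 // exprn_ege1 // ltW.
have y1 m : 1 - y m s != 0.
  rewrite subr_eq0; apply/eqP => e; have := yp m; rewrite -e nm1; lra.
have expand b : is_csum (fun m => (r ^+ m)%:C%C * (binc s m * (w ^+ B * y m s ^+ b)))
    (g ^+ (B + b) * (cpow (c + q ^+ (B + b)) s)^-1).
  have qb : 0 < q ^+ (B + b) by rewrite exprn_gt0.
  have x1 : 0 <= c / q ^+ (B + b) <= 36^-1.
    apply/andP; split; first by rewrite divr_ge0 // ltW.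
    apply: le_trans r36; rewrite /r; apply: ler_wpM2l => //.
    by rewrite lef_pV2 ?posrE ?exprn_gt0 // ler_weXn2l ?leq_addr // ltW.
  have := is_csumZ (w ^+ (B + b)) (binomial_series s x1).
  have -> : c + q ^+ (B + b) = q ^+ (B + b) * (1 + c / q ^+ (B + b)).
    by field; rewrite gt_eqF.
  have x2 : 0 < 1 + c / q ^+ (B + b) by have [] := andP x1; lra.
  rewrite cpowM // cpowX // invfM -[(cpow q s ^+ _)^-1]exprVn mulrA -(exprMn _ g) -/(z s) -/w.
  apply: is_csum_eq => m.
  rewrite /y -/w (exprMn b (q ^- m)%:C%C) (exprD w).
  have -> : (c / q ^+ (B + b))%:C%C ^+ m = (r ^+ m)%:C%C * (q ^- m)%:C%C ^+ b :> C.
    rewrite -!rmorphXn -rmorphM; congr (_%:C%C); rewrite /r -!exprVn -exprM [(m * b)%N]mulnC.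
    by rewrite exprD !exprMn -!exprM; ring.
  by ring.
have [K K0 KP] := binc_c2bound (nm s).
have bK m : nm (binc s m) <= K * 6 ^+ m by have [dm [_ h _ _ _]] := KP m; apply: h => /=.
pose S := K * (1 - p)^-1 * (1 - 2^-1)^-1.
have S0 : 0 <= S by rewrite !mulr_ge0 ?invr_ge0 ?(ltW d0) //; lra.
have diff n : nm (\sum_(b < n) g ^+ (B + b) * (cpow (c + q ^+ (B + b)) s)^-1 - T s) <= S * p ^+ n.
  have h := is_csumB (is_csum_sum (index_enum 'I_n) (fun b : 'I_n => expand b)) (TP s).
  apply: (is_csum_le _ h) => N.
  apply: le_trans (nm_sum _ _ _) _.
  apply: (@le_trans _ _ (\sum_(m < N) K * (1 - p)^-1 * p ^+ n * 2^-1 ^+ m)); last first.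
    rewrite -mulr_sumr; have -> : S * p ^+ n = K * (1 - p)^-1 * p ^+ n * (1 - 2^-1)^-1 by rewrite /S; ring.
    rewrite ler_wpM2l ?geometric_sum_le ?mulr_ge0 ?invr_ge0 ?exprn_ge0 ?(ltW d0) //; lra.
  apply: ler_sum => m _.
  have -> : \sum_(b < n) (r ^+ m)%:C%C * (binc s m * (w ^+ B * y m s ^+ b)) - term m s =
     - ((r ^+ m)%:C%C * (binc s m * (w ^+ B * (1 - y m s)^-1)) * y m s ^+ n).
    rewrite -mulr_sumr -mulr_sumr -mulr_sumr /term -/w.
    have -> : \sum_(b < n) y m s ^+ b = (1 - y m s ^+ n) * (1 - y m s)^-1.
      by apply: (mulIf (y1 m)); rewrite divfK // mulrC sub1r_geometric.
    by ring.
  rewrite nmN !nmM nm_real ger0_norm ?exprn_ge0 // !nmX -/p nmV.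
  have i1 : (nm (1 - y m s))^-1 <= (1 - p)^-1.
    have : nm 1 <= nm (1 - y m s) + nm (y m s) by rewrite -{1}[1](subrK (y m s)) nmD.
    rewrite nm1 => h1; have h2 := yp m.
    by rewrite lef_pV2 ?posrE //; lra.
  have i2 : p ^+ B * (nm (1 - y m s))^-1 <= (1 - p)^-1.
    apply: le_trans i1; rewrite ler_piMl ?invr_ge0 ?nm_ge0 // exprn_ile1 // ltW //.
  have i3 : nm (binc s m) * (p ^+ B * (nm (1 - y m s))^-1) <= K * 6 ^+ m * (1 - p)^-1.
    by apply: ler_pM; rewrite ?nm_ge0 ?mulr_ge0 ?exprn_ge0 ?invr_ge0 ?nm_ge0.
  have i4 : r ^+ m * 6 ^+ m <= 2^-1 ^+ m.
    have r6 : r * 6 <= 2^-1 by have := r36; lra.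
    by rewrite -exprMn; apply: lerXn2r => //; rewrite nnegrE ?invr_ge0 // mulr_ge0.
  have i5 : nm (y m s) ^+ n <= p ^+ n by rewrite lerXn2r ?nnegrE ?nm_ge0.
  apply: (@le_trans _ _ (r ^+ m * (K * 6 ^+ m * (1 - p)^-1) * p ^+ n)).
    apply: ler_pM => //; rewrite ?mulr_ge0 ?exprn_ge0 ?nm_ge0 ?invr_ge0 ?nm_ge0 //.
    by rewrite ler_wpM2l ?exprn_ge0.
  have -> : r ^+ m * (K * 6 ^+ m * (1 - p)^-1) * p ^+ n =
     (K * (1 - p)^-1 * p ^+ n) * (r ^+ m * 6 ^+ m) by ring.
  by rewrite ler_wpM2l ?mulr_ge0 ?invr_ge0 ?exprn_ge0 ?(ltW d0).
move=> e e0; have S1 : 0 < S + 1 by rewrite ltr_wpDl.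
have [n0 n0P] := powers_vanish p0 p1 (divr_gt0 e0 S1).
exists n0 => n nn; apply: le_trans (diff n) _.
apply: (@le_trans _ _ (S * (e / (S + 1)))); first by apply: ler_wpM2l => //; apply: n0P.
by rewrite mulrCA ger_pMr // ler_pdivrMr // mul1r lerDl.
Qed.

End SingleSum.

Lemma single_sum_continuation (R : realType) (q c : R) (g : R[i]) : 1 < q -> 0 <= c ->
  exists T : R[i] -> R[i], (forall a, mero_at T a) /\
    forall s, nm (g * (cpow q s)^-1) < 1 ->
      is_csum (fun b => g ^+ b.+1 * (cpow (c + q ^+ b.+1) s)^-1) (T s).
Proof.
move=> q1 c0; have [B0 B0P] := powers_unbounded q1 (36 * c).
pose B := B0.+1; have q0 : 0 < q by apply: lt_trans q1.
have cB : 36 * c <= q ^+ B.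
  by apply: le_trans B0P _; rewrite ler_weXn2l // ltW.
have [T TP] := continuation_ex g q1 c0 cB.
exists (fun s => \sum_(b < B0) g ^+ b.+1 * (cpow (c + q ^+ b.+1) s)^-1 + T s); split=> [a|s gs].
  apply: meroD; last exact: (mero_continuation q1 c0 cB TP).
  apply: mero_sum => b; apply: meroM; first exact: mero_cst.
  exact: mero_cpowV.
apply: is_csum_shift.
apply: is_csum_eq (continuation_eq q1 c0 cB TP gs) => b.
by rewrite /B addSn.
Qed.

Section DoubleSum.
Variable R : realType.
Local Notation C := R[i].

Lemma geometric_tail_le (x : R) n m : 0 <= x -> x < 1 ->
  \sum_(i < m | (n <= i)%N) x ^+ i.+1 <= x ^+ n * (1 - x)^-1.
Proof.
move=> x0 x1; have [mn|mn] := leqP m n.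
  rewrite big1 ?mulr_ge0 ?exprn_ge0 ?invr_ge0 ?subr_ge0 ?(ltW x1) // => i ni.
  by have := ltn_ord i; lia.
have -> : m = (n + (m - n))%N by lia.
rewrite big_split_ord /= big1 => [|i]; last by have := ltn_ord i; lia.
rewrite add0r; under eq_bigl => i do rewrite leq_addr.
apply: (@le_trans _ _ (\sum_(i < m - n) x ^+ n * x ^+ i)).
  by apply: ler_sum => i _; rewrite -exprD ler_wiXn2l // ltW.
by rewrite -mulr_sumr; apply: ler_wpM2l; [exact: exprn_ge0|exact: geometric_sum_le].
Qed.

Lemma geometric_sumS_le (x : R) m : 0 <= x -> x < 1 ->
  \sum_(i < m) x ^+ i.+1 <= (1 - x)^-1.
Proof.
by move=> x0 x1; have := geometric_tail_le 0 m x0 x1; rewrite expr0 mul1r.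
Qed.

Section Dominated.
Variables (a : nat -> nat -> C) (x y : R).
Hypotheses (x0 : 0 <= x) (x1 : x < 1) (y0 : 0 <= y) (y1 : y < 1).
Hypothesis axy : forall i j, nm (a i j) <= x ^+ i.+1 * y ^+ j.+1.

Lemma square_tail_le (P : nat -> nat -> bool) n m1 m2 : (n <= m1)%N -> (n <= m2)%N ->
  (forall i j, (i < n)%N -> (j < n)%N -> P i j) ->
  nm (\sum_(i < m1) \sum_(j < m2 | P i j) a i j - \sum_(i < n) \sum_(j < n) a i j) <=
    (x ^+ n + y ^+ n) * ((1 - x)^-1 * (1 - y)^-1).
Proof.
move=> nm1 nm2 Psq.
have -> : \sum_(i < n) \sum_(j < n) a i j =
    \sum_(i < m1) \sum_(j < m2) (if (i < n)%N && (j < n)%N then a i j else 0).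
  rewrite (big_ord_widen _ (fun i => \sum_(j < n) a i j) nm1) big_mkcond /=.
  apply: eq_bigr => i _; case: ltnP => _; last by rewrite big1.
  by rewrite (big_ord_widen _ (fun j => a i j) nm2) big_mkcond.
rewrite -sumrB; apply: le_trans (nm_sum _ _ _) _.
pose t (i j : nat) := (if (n <= i)%N then x ^+ i.+1 else 0) * y ^+ j.+1 +
  x ^+ i.+1 * (if (n <= j)%N then y ^+ j.+1 else 0).
apply: (@le_trans _ _ (\sum_(i < m1) \sum_(j < m2) t i j)).
  apply: ler_sum => i _; rewrite big_mkcond -sumrB; apply: le_trans (nm_sum _ _ _) _.
  apply: ler_sum => j _; rewrite /t.
  have := Psq i j; case: ltnP => ni; case: ltnP => nj /=.
  - by move=> -> //; rewrite subrr nm0 mul0r mulr0 addr0.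
  - move=> _; rewrite subr0 mul0r add0r; case: ifP => _; first exact: axy.
    by rewrite nm0 mulr_ge0 ?exprn_ge0.
  - move=> _; rewrite subr0 mulr0 addr0; case: ifP => _; first exact: axy.
    by rewrite nm0 mulr_ge0 ?exprn_ge0.
  - move=> _; have h := mulr_ge0 (exprn_ge0 i.+1 x0) (exprn_ge0 j.+1 y0).
    rewrite subr0; case: ifP => _; last by rewrite nm0 addr_ge0.
    by apply: le_trans (axy _ _) _; rewrite lerDl.
under eq_bigr => i _ do rewrite big_split /= -!mulr_sumr.
rewrite big_split /= -!mulr_suml -!big_mkcond /= mulrDl.
have hx : 0 <= (1 - x)^-1 by rewrite invr_ge0 subr_ge0 ltW.
have hy : 0 <= (1 - y)^-1 by rewrite invr_ge0 subr_ge0 ltW.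
have sx (Q : pred 'I_m1) : 0 <= \sum_(i < m1 | Q i) x ^+ i.+1 by apply: sumr_ge0 => i _; exact: exprn_ge0.
have sy (Q : pred 'I_m2) : 0 <= \sum_(i < m2 | Q i) y ^+ i.+1 by apply: sumr_ge0 => i _; exact: exprn_ge0.
apply: lerD.
  rewrite mulrA; apply: ler_pM; [exact: sx|exact: sy|exact: geometric_tail_le|].
  exact: geometric_sumS_le.
rewrite mulrCA; apply: ler_pM; [exact: sx|exact: sy|exact: geometric_sumS_le|].
exact: geometric_tail_le.
Qed.

Lemma box_shift (w : C) (k l n : nat) :
  (forall i j, a (k + i)%N (l + j)%N = w * a i j) ->
  \sum_(i < k + n) \sum_(j < l + n) a i j =
    \sum_(j < l + n) \sum_(i < k) a i j + \sum_(i < k + n) \sum_(j < l) a i j -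
    \sum_(i < k) \sum_(j < l) a i j + w * \sum_(i < n) \sum_(j < n) a i j.
Proof.
move=> aw.
rewrite big_split_ord /=; under [X in _ + X]eq_bigr do rewrite big_split_ord /=.
rewrite big_split /= [in RHS]exchange_big /=.
rewrite [X in _ + X - _]big_split_ord /=.
have -> : \sum_(i < n) \sum_(j < n) a (k + i)%N (l + j)%N = w * \sum_(i < n) \sum_(j < n) a i j.
  by rewrite mulr_sumr; apply: eq_bigr => i _; rewrite mulr_sumr; apply: eq_bigr.
by ring.
Qed.

(* The index shift by (k, l) multiplies the terms by w, so the part of the sum outside the
   shifted quadrant determines (1 - w) times the sum. *)
Lemma shifted_square_sum (w U V : C) (k l : nat) : 1 - w != 0 ->
  (forall i j, a (k + i)%N (l + j)%N = w * a i j) ->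
  is_csum (fun j => \sum_(i < k) a i j) U -> is_csum (fun i => \sum_(j < l) a i j) V ->
  forall e, 0 < e -> exists n, forall m (P : nat -> nat -> bool), (n <= m)%N ->
    (forall i j, (i < n)%N -> (j < n)%N -> P i j) ->
    nm (\sum_(i < m) \sum_(j < m | P i j) a i j -
      (U + V - \sum_(i < k) \sum_(j < l) a i j) * (1 - w)^-1) <= e.
Proof.
move=> w1 aw hU hV e e0.
set K := \sum_(i < k) _; set S := (_ * _).
have [G G0 tail] : exists2 G, 0 <= G & forall (P : nat -> nat -> bool) n m1 m2, (n <= m1)%N ->
    (n <= m2)%N -> (forall i j, (i < n)%N -> (j < n)%N -> P i j) ->
    nm (\sum_(i < m1) \sum_(j < m2 | P i j) a i j - \sum_(i < n) \sum_(j < n) a i j) <=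
      (x ^+ n + y ^+ n) * G.
  exists ((1 - x)^-1 * (1 - y)^-1) => [|P n m1 m2]; last exact: square_tail_le.
  by rewrite mulr_ge0 // invr_ge0 subr_ge0 ltW.
have d0 : 0 <= nm (1 - w)^-1 by exact: nm_ge0.
have [h h0 Ah] : exists2 h, 0 < h & (2 * G + (2 * G + 2) * nm (1 - w)^-1) * h <= e.
  have A0 : 0 <= 2 * G + (2 * G + 2) * nm (1 - w)^-1.
    have G2 : 0 <= 2 * G by exact: mulr_ge0 (ler0n _ 2) G0.
    exact: addr_ge0 G2 (mulr_ge0 (addr_ge0 G2 (ler0n _ 2)) d0).
  have A1 := ltr_wpDl A0 (@ltr01 R).
  exists (e / (2 * G + (2 * G + 2) * nm (1 - w)^-1 + 1)); first exact: divr_gt0.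
  by rewrite mulrCA ger_pMr // ler_pdivrMr // mul1r lerDl.
have [n1 n1P] := powers_vanish x0 x1 h0.
have [n2 n2P] := powers_vanish y0 y1 h0.
have [n3 n3P] := hU h h0.
have [n4 n4P] := hV h h0.
pose n := (n1 + n2 + n3 + n4)%N; have n3l : (n3 <= l + n)%N by rewrite /n; lia.
have n4k : (n4 <= k + n)%N by rewrite /n; lia.
exists n => m P mn Psq.
have xy : (x ^+ n + y ^+ n) * G <= 2 * h * G.
  apply: ler_wpM2r => //.
  have hx : x ^+ n <= h by apply: n1P; rewrite /n; lia.
  have hy : y ^+ n <= h by apply: n2P; rewrite /n; lia.
  by lra.
set B := \sum_(i < n) \sum_(j < n) a i j.
have hB : nm (B - S) <= (2 * h * G + 2 * h) * nm (1 - w)^-1.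
  have e1 := box_shift n aw.
  have t1 : nm (\sum_(i < k + n) \sum_(j < l + n) a i j - B) <= 2 * h * G.
    by apply: le_trans xy; apply: (tail (fun _ _ => true)) => //; exact: leq_addl.
  have t2 := n3P (l + n)%N n3l; have t3 := n4P (k + n)%N n4k.
  have -> : B - S = - (\sum_(i < k + n) \sum_(j < l + n) a i j - B
      - (\sum_(j < l + n) \sum_(i < k) a i j - U)
      - (\sum_(i < k + n) \sum_(j < l) a i j - V)) * (1 - w)^-1.
    apply: (mulIf w1); rewrite mulrBl /S !divfK // e1 -/K -/B; ring.
  rewrite nmM nmN; apply: ler_wpM2r => //.
  apply: le_trans (nmB _ _) _; rewrite mulr2n.
  have -> : 2 * h * G + 2 * h = 2 * h * G + h + h by ring.
  apply: (lerD _ t3).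
  exact: le_trans (nmB _ _) (lerD t1 t2).
have := tail P n m m mn mn Psq; rewrite -/B; set T := \sum_(i < m) _ => hT.
have -> : T - S = (T - B) + (B - S) by ring.
apply: le_trans (nmD _ _) _; apply: le_trans Ah.
apply: (le_trans (lerD (le_trans hT xy) hB)).
by rewrite le_eqVlt; apply/orP; left; apply/eqP; ring.
Qed.

End Dominated.

Lemma double_term_le (q1 q2 : R) (b g s : C) i j : 1 < q1 -> 1 < q2 ->
  nm b <= q1 -> nm g <= q2 -> 0 < complex.Re s ->
  nm (b ^+ i * g ^+ j * (cpow (q1 ^+ i + q2 ^+ j) s)^-1) <=
    (q1 * (expR (complex.Re s / 2 * ln q1))^-1) ^+ i * (q2 * (expR (complex.Re s / 2 * ln q2))^-1) ^+ j.
Proof.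
move=> q11 q21 bq gq s0; set t := complex.Re s in s0 *.
have q10 : 0 < q1 by exact: lt_trans ltr01 q11.
have q20 : 0 < q2 by exact: lt_trans ltr01 q21.
have x0 : 0 < q1 ^+ i by exact: exprn_gt0.
have y0 : 0 < q2 ^+ j by exact: exprn_gt0.
have pE (q : R) k : 0 < q -> expR (t / 2 * ln q) ^+ k = expR (t / 2 * ln (q ^+ k)).
  by move=> q0; rewrite lnXn // -expRM_natl mulrnAr mulr_natl.
rewrite !nmM !nmX nmV nm_cpow -/t !exprMn !exprVn !pE // mulrACA -invfM -expRD.
apply: ler_pM; rewrite ?mulr_ge0 ?exprn_ge0 ?nm_ge0 ?invr_ge0 ?expR_ge0 //.
  by apply: ler_pM; rewrite ?exprn_ge0 ?nm_ge0 // lerXn2r ?nnegrE ?nm_ge0 // ltW.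
rewrite lef_pV2 ?posrE ?expR_gt0 // ler_expR.
have h1 : ln (q1 ^+ i) <= ln (q1 ^+ i + q2 ^+ j) by rewrite ler_ln ?posrE ?addr_gt0 // lerDl ltW.
have h2 : ln (q2 ^+ j) <= ln (q1 ^+ i + q2 ^+ j) by rewrite ler_ln ?posrE ?addr_gt0 // lerDr ltW.
rewrite -mulrDr -mulrA ler_pM2l // ler_pdivrMl //.
by rewrite -[2]/(1 + 1) mulrDl !mul1r lerD.
Qed.

Lemma ratio_lt1 (q t : R) : 1 < q -> 1 < t -> q * (expR (t * ln q))^-1 < 1.
Proof.
move=> q1 t1; rewrite ltr_pdivrMr ?expR_gt0 // mul1r.
rewrite -[ltLHS]lnK ?posrE ?(lt_trans ltr01) // ltr_expR ltr_pMl //; exact: ln_gt0.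
Qed.

Lemma double_sum_continuation (q1 q2 : R) (k l : nat) (b g : C) : 1 < q1 -> 1 < q2 ->
  (0 < k)%N -> q1 ^+ k = q2 ^+ l -> nm b <= q1 -> nm g <= q2 ->
  exists S : C -> C, (forall a, mero_at S a) /\
    forall s, 2 < complex.Re s -> forall e, 0 < e ->
    exists n, forall m (P : nat -> nat -> bool), (n <= m)%N ->
    (forall i j, (i < n)%N -> (j < n)%N -> P i j) ->
    nm (\sum_(i < m) \sum_(j < m | P i j)
          b ^+ i.+1 * g ^+ j.+1 * (cpow (q1 ^+ i.+1 + q2 ^+ j.+1) s)^-1 - S s) <= e.
Proof.
move=> q11 q21 k0 qkl bq gq.
have q10 : 0 < q1 by exact: lt_trans ltr01 q11.
have q20 : 0 < q2 by exact: lt_trans ltr01 q21.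
have /choice [T1 T1P] : forall i : nat, exists T : C -> C, (forall a, mero_at T a) /\
    forall s, nm (g * (cpow q2 s)^-1) < 1 ->
      is_csum (fun j => g ^+ j.+1 * (cpow (q1 ^+ i.+1 + q2 ^+ j.+1) s)^-1) (T s).
  by move=> i; apply: single_sum_continuation => //; rewrite exprn_ge0 // ltW.
have /choice [T2 T2P] : forall j : nat, exists T : C -> C, (forall a, mero_at T a) /\
    forall s, nm (b * (cpow q1 s)^-1) < 1 ->
      is_csum (fun i => b ^+ i.+1 * (cpow (q2 ^+ j.+1 + q1 ^+ i.+1) s)^-1) (T s).
  by move=> j; apply: single_sum_continuation => //; rewrite exprn_ge0 // ltW.
pose a i j s := b ^+ i.+1 * g ^+ j.+1 * (cpow (q1 ^+ i.+1 + q2 ^+ j.+1) s)^-1.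
pose w s := b ^+ k * g ^+ l * (cpow (q1 ^+ k) s)^-1.
exists (fun s => (\sum_(i < k) b ^+ i.+1 * T1 i s + \sum_(j < l) g ^+ j.+1 * T2 j s -
   \sum_(i < k) \sum_(j < l) a i j s) * (1 - w s)^-1); split=> [z|s s2].
  apply: meroM; last first.
    have -> : (fun s => (1 - w s)^-1) = (fun s : C => (1 - b ^+ k * g ^+ l * cexp (- (ln (q1 ^+ k))%:C%C * s))^-1).
      by apply/funext => s; rewrite /w cpowVE.
    apply: mero_geometric; rewrite oppr_eq0 (inj_eq (@complexI R)) gt_eqF // ln_gt0 //.
    by rewrite exprn_egt1 // -lt0n.
  apply: meroD.
    apply: meroD; apply: mero_sum => i; apply: meroM; try exact: mero_cst.
      by have [] := T1P i.
    by have [] := T2P i.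
  have -> : (fun s => - \sum_(i < k) \sum_(j < l) a i j s) = (fun s => -1 * \sum_(i < k) \sum_(j < l) a i j s).
    by apply/funext => s; rewrite mulN1r.
  apply: meroM; first exact: mero_cst.
  apply: mero_sum => i; apply: mero_sum => j; apply: meroM; first exact: mero_cst.
  exact: mero_cpowV.
have s0 : 0 < complex.Re s by exact: lt_trans (ltr0n _ 2) s2.
have s1 : 1 < complex.Re s by apply: lt_trans s2; rewrite ltr1n.
have sh : 1 < complex.Re s / 2 by rewrite ltr_pdivlMr // mul1r.
have ratio (q : R) (c : C) t : 1 < q -> nm c <= q -> 1 < t -> nm c * (expR (t * ln q))^-1 < 1.
  move=> q' cq t1; apply: le_lt_trans (ratio_lt1 q' t1).
  by rewrite ler_wpM2r // invr_ge0 expR_ge0.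
have ratio0 (q t : R) : 1 < q -> 0 <= q * (expR (t * ln q))^-1.
  by move=> q'; rewrite mulr_ge0 ?invr_ge0 ?expR_ge0 // ltW // (lt_trans ltr01).
have w1 : 1 - w s != 0.
  rewrite subr_eq0; apply/eqP => e; have : nm (w s) < 1; last by rewrite -e nm1 ltxx.
  rewrite /w !nmM !nmX nmV nm_cpow.
  apply: (@le_lt_trans _ _ ((q1 ^+ k * q1 ^+ k) * (expR (complex.Re s * ln (q1 ^+ k)))^-1)).
    apply: ler_wpM2r; first by rewrite invr_ge0 expR_ge0.
    by rewrite {2}qkl; apply: ler_pM; rewrite ?exprn_ge0 ?nm_ge0 // lerXn2r ?nnegrE ?nm_ge0 // ltW.
  have q1k : 1 < q1 ^+ k by rewrite exprn_egt1 // -lt0n.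
  have h := ratio_lt1 q1k sh; have h0 := ratio0 _ (complex.Re s / 2) q1k.
  have -> : complex.Re s * ln (q1 ^+ k) = complex.Re s / 2 * ln (q1 ^+ k) + complex.Re s / 2 * ln (q1 ^+ k).
    by field.
  by rewrite expRD invfM mulrACA; apply: mulr_ilt1.
have dom i j : nm (a i j s) <= (q1 * (expR (complex.Re s / 2 * ln q1))^-1) ^+ i.+1 *
    (q2 * (expR (complex.Re s / 2 * ln q2))^-1) ^+ j.+1 by exact: double_term_le.
have aw i j : a (k + i)%N (l + j)%N s = w s * a i j s.
  rewrite /a /w -!addnS !exprD.
  have -> : q1 ^+ k * q1 ^+ i.+1 + q2 ^+ l * q2 ^+ j.+1 = q1 ^+ k * (q1 ^+ i.+1 + q2 ^+ j.+1).
    by rewrite -qkl mulrDr.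
  by rewrite cpowM ?exprn_gt0 ?addr_gt0 ?exprn_gt0 // invfM; ring.
have hU : is_csum (fun j => \sum_(i < k) a i j s) (\sum_(i < k) b ^+ i.+1 * T1 i s).
  apply: (@is_csum_sum _ _ _ (fun (i : 'I_k) j => a i j s)) => i; have [_ /(_ s) h] := T1P i.
  apply: is_csum_eq (is_csumZ _ (h _)) => [j|]; first by rewrite /a mulrA.
  by rewrite nmM nmV nm_cpow; apply: ratio.
have hV : is_csum (fun i => \sum_(j < l) a i j s) (\sum_(j < l) g ^+ j.+1 * T2 j s).
  apply: (@is_csum_sum _ _ _ (fun (j : 'I_l) i => a i j s)) => j; have [_ /(_ s) h] := T2P j.
  apply: is_csum_eq (is_csumZ _ (h _)) => [i|]; first by rewrite /a addrC mulrA [g ^+ _ * _]mulrC.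
  by rewrite nmM nmV nm_cpow; apply: ratio.
exact: (shifted_square_sum (ratio0 _ _ q11) (ratio_lt1 q11 sh)
  (ratio0 _ _ q21) (ratio_lt1 q21 sh) dom w1 aw hU hV).
Qed.

End DoubleSum.

Section DivisorsOfLowDegree.
Variables (F : finFieldType) (K : fieldType) (iota : {rmorphism F -> K}).
Hypothesis ff : function_field iota.

Definition low_effdivs n : seq (effdiv iota) := flatten [seq effn iota k | k <- seq.iota 0 n].

Lemma low_effdivsS n : low_effdivs n.+1 = low_effdivs n ++ effn iota n.
Proof. by rewrite /low_effdivs -addn1 iotaD map_cat flatten_cat /= cats0. Qed.

Lemma mem_low_effdivs n A : (A \in low_effdivs n) = (effdiv_deg A < n)%N.
Proof.
elim: n => [|n IH]; first by rewrite in_nil.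
by rewrite low_effdivsS mem_cat IH mem_effn // ltnS [RHS]leq_eqVlt orbC.
Qed.

Lemma low_effdivs_uniq n : uniq (low_effdivs n).
Proof.
elim: n => [|n IH] //; rewrite low_effdivsS cat_uniq IH effn_uniq andbT /=.
by apply/hasPn => A; rewrite mem_effn // mem_low_effdivs => /eqP ->; rewrite ltnn.
Qed.

Lemma big_low_effdivs (V : nmodType) n (f : effdiv iota -> V) :
  \sum_(A <- low_effdivs n) f A = \sum_(k < n) \sum_(A <- effn iota k) f A.
Proof.
elim: n => [|n IH]; first by rewrite big_nil big_ord0.
by rewrite low_effdivsS big_cat IH big_ord_recr.
Qed.

Lemma von_mangoldtE (R : realType) (A : effdiv iota) :
  von_mangoldt R A = ln #|F|%:R * (prime_weight A)%:R.
Proof.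
have E (P : place iota) h : (0 < h)%N ->
    ln (effdiv_norm (msetn 1 P : effdiv iota))%:R = ln #|F|%:R * (prime_weight (msetn h P : effdiv iota))%:R :> R.
  move=> h0; have F0 : 0 < #|F|%:R :> R by rewrite ltr0n; exact/ltnW/card_finNzRing_gt1.
  by rewrite prime_weight_msetn // /effdiv_norm effdiv_deg_msetn mul1n natrX lnXn // mulr_natr.
rewrite /von_mangoldt; case: xgetP => [y _ [P [h [h0 -> ->]]]|none]; first exact: E.
have [->|/prime_weight_neq0 [P [h [h0 Ah]]]] := eqVneq (prime_weight A) 0%N; first by rewrite mulr0.
by case: (none (ln (effdiv_norm (msetn 1 P : effdiv iota))%:R)); exists P, h.
Qed.

End DivisorsOfLowDegree.

Section Phi.
Variables (R : realType) (F1 F2 : finFieldType) (K1 K2 : fieldType).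
Variables (iota1 : {rmorphism F1 -> K1}) (iota2 : {rmorphism F2 -> K2}).
Hypotheses (ff1 : function_field iota1) (ff2 : function_field iota2).

Lemma G2FF_prime_count n M : (n < M)%N -> G2FF R iota1 iota2 n =
  \sum_(i < M) \sum_(j < M | (#|F1| ^ i + #|F2| ^ j)%N == n)
    ln #|F1|%:R * ln #|F2|%:R * (prime_count iota1 i)%:R * (prime_count iota2 j)%:R.
Proof.
move=> nM; pose r := [seq p <- [seq (A, B) | A <- low_effdivs iota1 M, B <- low_effdivs iota2 M] |
  (effdiv_norm p.1 + effdiv_norm p.2)%N == n].
have -> : G2FF R iota1 iota2 n = \sum_(p <- r) von_mangoldt R p.1 * von_mangoldt R p.2.
  rewrite /G2FF [RHS]fsbig_seq; last first.
    by rewrite /r filter_uniq // allpairs_uniq ?low_effdivs_uniq // => -[A B] [A' B'] _ _ [-> ->].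
  apply: eq_fsbigl; apply/seteqP; split=> -[A B] /=; rewrite mem_filter /=; last by case/andP => /eqP.
  move=> AB; rewrite AB eqxx /=; apply: allpairs_f; rewrite mem_low_effdivs //.
    by rewrite (leq_trans _ nM) // ltnS -AB; apply: leq_trans (leq_addr _ _); exact/ltnW/ltn_expl/card_finNzRing_gt1.
  by rewrite (leq_trans _ nM) // ltnS -AB; apply: leq_trans (leq_addl _ _); exact/ltnW/ltn_expl/card_finNzRing_gt1.
rewrite big_filter big_mkcond /=.
transitivity (\sum_(A <- low_effdivs iota1 M) \sum_(B <- low_effdivs iota2 M)
    if (effdiv_norm A + effdiv_norm B)%N == n then von_mangoldt R A * von_mangoldt R B else 0).
  exact: big_allpairs.
rewrite big_low_effdivs; apply: eq_bigr => i _.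
rewrite (eq_bigr _ (fun A _ => @big_low_effdivs _ _ iota2 _ M _)).
rewrite exchange_big [RHS]big_mkcond /=; apply: eq_bigr => j _.
transitivity (\sum_(A <- effn iota1 i) \sum_(B <- effn iota2 j)
    if (#|F1| ^ i + #|F2| ^ j)%N == n
    then ln #|F1|%:R * ln #|F2|%:R * (prime_weight A)%:R * (prime_weight B)%:R else 0 : R).
  rewrite big_seq [RHS]big_seq; apply: eq_bigr => A; rewrite mem_effn // => /eqP dA.
  rewrite big_seq [RHS]big_seq; apply: eq_bigr => B; rewrite mem_effn // => /eqP dB.
  by rewrite /effdiv_norm dA dB !von_mangoldtE //; case: ifP => // _; ring.
case: ifP => _; last by rewrite big1 // => A _; rewrite big1.
rewrite /prime_count !natr_sum -mulrA big_distrlr mulr_sumr; apply: eq_bigr => A _.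
by rewrite mulr_sumr; apply: eq_bigr => B _; rewrite mulrA.
Qed.

Lemma Phi2FF_partial_prime_count (s : R[i]) N : Phi2FF_partial iota1 iota2 s N =
  \sum_(i < N) \sum_(j < N | (#|F1| ^ i.+1 + #|F2| ^ j.+1 <= N)%N)
    (ln #|F1|%:R * ln #|F2|%:R)%:C%C * (prime_count iota1 i.+1)%:R * (prime_count iota2 j.+1)%:R *
    (cpow (#|F1|%:R ^+ i.+1 + #|F2|%:R ^+ j.+1) s)^-1.
Proof.
pose f i j n : R[i] := if (#|F1| ^ i + #|F2| ^ j)%N == n then
  (ln #|F1|%:R * ln #|F2|%:R * (prime_count iota1 i)%:R * (prime_count iota2 j)%:R)%:C%C / natcpow n s else 0.
transitivity (\sum_(1 <= n < N.+1) \sum_(i < N) \sum_(j < N) f i.+1 j.+1 n).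
  rewrite /Phi2FF_partial big_nat [RHS]big_nat; apply: eq_bigr => n /andP[_ nN].
  rewrite (G2FF_prime_count nN) rmorph_sum /= mulr_suml big_ord_recl /=.
  rewrite [X in X + _](_ : _ = 0) ?add0r; last first.
    rewrite big1 => [|j _]; last by rewrite prime_count0 // mulr0 mul0r.
    by rewrite (rmorph0 (real_complex R)) mul0r.
  apply: eq_bigr => i _; rewrite big_mkcond big_ord_recl /= (prime_count0 ff2) mulr0 if_same add0r.
  rewrite rmorph_sum mulr_suml; apply: eq_bigr => j _; rewrite /f /bump /= add1n.
  by case: ifP => // _; rewrite mul0r.
rewrite exchange_big; apply: eq_bigr => i _; rewrite exchange_big [RHS]big_mkcond; apply: eq_bigr => j _.
rewrite /f; set x := (#|F1| ^ i.+1 + #|F2| ^ j.+1)%N.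
have x0 : (0 < x)%N.
  have F0 : (0 < #|F1|)%N by exact/ltnW/card_finNzRing_gt1.
  by rewrite addn_gt0 expn_gt0 F0.
case: ifP => xN; last first.
  rewrite big_nat big1 // => n /andP[_ nN]; case: eqP => // xn.
  by rewrite xn -ltnS nN in xN.
rewrite (bigD1_seq x) ?iota_uniq ?mem_index_iota ?x0 ?ltnS //= eqxx big1 ?addr0 => [|n].
  by rewrite !rmorphM /= !rmorph_nat /natcpow /cpow /x natrD !natrX.
by rewrite eq_sym => /negPf ->.
Qed.


Lemma Phi2FF_continuation (k1 k2 : nat) : (0 < k1)%N -> #|F1|%:R ^+ k1 = #|F2|%:R ^+ k2 :> R ->
  exists Phi : R[i]^o -> R[i]^o, meromorphic Phi /\
    forall s : R[i], 2 < complex.Re s -> Phi2FF_partial iota1 iota2 s @ \oo --> Phi s.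
Proof.
move=> k10 q12.
have q1 : 1 < #|F1|%:R :> R by rewrite ltr1n card_finNzRing_gt1.
have q2 : 1 < #|F2|%:R :> R by rewrite ltr1n card_finNzRing_gt1.
have [s1 [s1q s1E]] := prime_count_exponential_sum R ff1.
have [s2 [s2q s2E]] := prime_count_exponential_sum R ff2.
pose in12 (x y : R[i] * R[i]) := x \in s1 /\ y \in s2.
pose term (x y : R[i] * R[i]) s i j : R[i] :=
  x.2 ^+ i.+1 * y.2 ^+ j.+1 * (cpow (#|F1|%:R ^+ i.+1 + #|F2|%:R ^+ j.+1) s)^-1.
pose trunc x y s N : R[i]^o :=
  \sum_(i < N) \sum_(j < N | (#|F1| ^ i.+1 + #|F2| ^ j.+1 <= N)%N) term x y s i j.
have /choice [S SP] : forall xy : (R[i] * R[i]) * (R[i] * R[i]), exists S : R[i] -> R[i],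
    (forall a, mero_at S a) /\
    (in12 xy.1 xy.2 -> forall s, 2 < complex.Re s -> trunc xy.1 xy.2 s @ \oo --> (S s : R[i]^o)).
  move=> [x y]; have [[xs ys]|nin] := pselect (in12 x y); last first.
    by exists (fun=> 0); split=> // a; exact: mero_cst.
  have [S [Sm Sc]] := double_sum_continuation q1 q2 k10 q12 (s1q _ xs) (s2q _ ys).
  exists S; split=> // _ s sr; apply: cvg_nm => e e0.
  have [n nP] := Sc s sr e e0; exists (n + (#|F1| ^ n + #|F2| ^ n))%N => N nN.
  apply: (nP N (fun i j => (#|F1| ^ i.+1 + #|F2| ^ j.+1 <= N)%N)) => [|i j ni nj]; first exact: leq_trans (leq_addr _ _) nN.
  apply: leq_trans nN; apply: leq_trans (leq_addl _ _).
  by apply: leq_add; rewrite leq_pexp2l // ltnW // card_finNzRing_gt1.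
pose c : R[i] := (ln #|F1|%:R * ln #|F2|%:R)%:C%C.
exists (fun s => c * \sum_(x <- s1) \sum_(y <- s2) x.1 * y.1 * S (x, y) s); split=> [a|s sr].
  apply: meroM; first exact: mero_cst.
  apply: mero_sum => x; apply: mero_sum => y; apply: meroM; first exact: mero_cst.
  by have [] := SP (x, y).
have -> : Phi2FF_partial iota1 iota2 s =
    (fun N => c * \sum_(x <- s1) \sum_(y <- s2) x.1 * y.1 * trunc x y s N : R[i]^o).
  apply/funext => N; rewrite Phi2FF_partial_prime_count -/c.
  transitivity (\sum_(i < N) \sum_(j < N | (#|F1| ^ i.+1 + #|F2| ^ j.+1 <= N)%N)
      \sum_(x <- s1) \sum_(y <- s2) c * (x.1 * y.1 * term x y s i j)).
    apply: eq_bigr => i _; apply: eq_bigr => j _.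
    rewrite s1E // s2E // -[c * _ * _]mulrA big_distrlr /=.
    rewrite mulr_sumr mulr_suml; apply: eq_bigr => x _.
    rewrite mulr_sumr mulr_suml; apply: eq_bigr => y _.
    by rewrite /term; ring.
  rewrite mulr_sumr.
  under eq_bigr => i _ do rewrite exchange_big /=.
  rewrite exchange_big; apply: eq_bigr => x _ /=.
  rewrite mulr_sumr.
  under eq_bigr => i _ do rewrite exchange_big /=.
  rewrite exchange_big; apply: eq_bigr => y _ /=.
  by rewrite /trunc !mulr_sumr; apply: eq_bigr => i _; rewrite !mulr_sumr.
have cvg_scale (z : R[i]) (u : nat -> R[i]^o) (l : R[i]^o) :
    u @ \oo --> l -> (fun N => z * u N : R[i]^o) @ \oo --> (z * l : R[i]^o).
  by move=> ul; apply: cvgM ul; exact: cvg_cst.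
have cvg_sum (T : eqType) (r : seq T) (u : T -> nat -> R[i]^o) (l : T -> R[i]^o) :
    (forall x, x \in r -> u x @ \oo --> l x) ->
    (fun N => \sum_(x <- r) u x N : R[i]^o) @ \oo --> (\sum_(x <- r) l x : R[i]^o).
  elim: r => [|x r IH] h.
    by rewrite big_nil; under eq_fun do rewrite big_nil; exact: cvg_cst.
  rewrite big_cons; under eq_fun do rewrite big_cons.
  by apply: cvgD; [apply: h; rewrite mem_head|apply: IH => y yr; apply: h; rewrite in_cons yr orbT].
apply: (cvg_scale); apply: (cvg_sum) => x xs; apply: (cvg_sum) => y ys; apply: cvg_scale.
by have [_] := SP (x, y); apply.
Qed.

End Phi.

Theorem theorem1 (R : realType)
    (p1 r1 p2 r2 : nat) (F1 F2 : finFieldType) (K1 K2 : fieldType)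
    (iota1 : {rmorphism F1 -> K1}) (iota2 : {rmorphism F2 -> K2})
    (prime_p1 : prime p1) (prime_p2 : prime p2)
    (card_F1 : #|F1| = (p1 ^ r1)%N) (card_F2 : #|F2| = (p2 ^ r2)%N)
    (ff1 : function_field iota1) (ff2 : function_field iota2) :
  p1 = p2 ->
  exists Phi : R[i]^o -> R[i]^o,
    meromorphic Phi /\
    forall s : R[i], 2 < complex.Re s ->
      Phi2FF_partial iota1 iota2 s @ \oo --> Phi s.
Proof.
move=> p12.
have h0 : (0 < r2)%N.
  by rewrite lt0n; apply: contraTneq (card_finNzRing_gt1 F2) => r20; rewrite card_F2 r20.
have h1 : #|F1|%:R ^+ r2 = #|F2|%:R ^+ r1 :> R.
  by rewrite -!natrX card_F1 card_F2 p12 -!expnM mulnC.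
exact: (Phi2FF_continuation ff1 ff2 h0 h1).
Qed.
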